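(* Let $D\subset\mathbf{R}^n$ be a bounded open region. Suppose $1<p<n$ and $\frac{n}{p}<r\le\infty$, and let $q$ satisfy $\frac1r+\frac pq=1$ (so that $q<\frac{np}{n-p}$). Suppose $V\in L^r(D)$ and $u\in W^{1,p}_0(D)$ is a nontrivial solution of $-\Delta_p u=V|u|^{p-2}u$ in $D$. Then $$K_{q,p}^p\,\|V_+\|_r\ge 1 .$$ Moreover, let $u_*\ge 0$ be a normalized nonnegative extremal for $K_{q,p}$, i.e. $u_*\in W_0^{1,p}(D)$, $u_*\ge0$, $\|\nabla u_*\|_p=1$, $\|u_*\|_q=K_{q,p}$. Then, with $$V(x)=c_*\,u_*^{q-p}(x),\qquad c_*=\|u_*\|_q^{-q},$$ the equation $-\Delta_p u=V|u|^{p-2}u$ holds with $u=u_*$, and equality $K_{q,p}^p\|V_+\|_r=1$ is attained.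
   Context: $D$ is a bounded open region in $\mathbf{R}^n$; nothing is assumed about its boundary. $\Delta_p u=\mathrm{div}(|\nabla u|^{p-2}\nabla u)$. The potential $V$ is real-valued and integrable, $V_+=\max(V,0)$, and $u$ may be complex-valued. A function $u\in W_0^{1,p}(D)$ solves $-\Delta_p u=V|u|^{p-2}u$ if this holds in the distribution sense: $\int_D|\nabla u|^{p-2}\nabla u\cdot\nabla\psi\,dx=\int_D V|u|^{p-2}u\,\psi\,dx$ for all $\psi\in C_0^\infty(D)$ (expressions such as $|u|^{p-2}u$ are read as $0$ where $u=0$, and likewise for the gradient). The Sobolev constant is $K_{q,p}=\sup_{0\ne u\in W_0^{1,p}(D)}\|u\|_q/\|\nabla u\|_p$, norms being taken over $D$. Under the stated conditions a normalized nonnegative extremal $u_*$ exists. When $q=p$ (i.e. $r=\infty$), $u_*^{q-p}$ is the constant function $1$. *)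

(* Defs.v *)
From HB Require Import structures.
From mathcomp Require Import all_boot all_order all_algebra.
From mathcomp Require Import all_classical all_reals all_analysis.
From mathcomp Require Import complex.

Set Implicit Arguments.
Unset Strict Implicit.
Unset Printing Implicit Defensive.

Import Order.TTheory GRing.Theory Num.Theory.
Import numFieldNormedType.Exports.

Local Open Scope classical_set_scope.
Local Open Scope ring_scope.
Local Open Scope complex_scope.

(* As for [n.-tuple T] in the library, ['rV[R]_n] carries the sigma-algebra
   generated by the coordinates, that is, the Borel sigma-algebra of R^n. *)
Definition rV_display (R : realType) : measure_display.
Proof. exact: default_measure_display. Qed.

Section measurable_rV.
Context {R : realType}.
Variable n : nat.

Let coord (i : 'I_n) (x : 'rV[R]_n) : measurableTypeR R := x ord0 i.

Let rV_set0 : g_sigma_preimage coord set0.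
Proof. exact: sigma_algebra0. Qed.

Let rV_setC A : g_sigma_preimage coord A -> g_sigma_preimage coord (~` A).
Proof. exact: sigma_algebraC. Qed.

Let rV_bigcup (F : (set 'rV[R]_n)^nat) :
  (forall i, g_sigma_preimage coord (F i)) ->
  g_sigma_preimage coord (\bigcup_i (F i)).
Proof. exact: sigma_algebra_bigcup. Qed.

HB.instance Definition _ := @isMeasurable.Build (rV_display R)
  'rV[R]_n (g_sigma_preimage coord) rV_set0 rV_setC rV_bigcup.

End measurable_rV.

Section rV_measurability.
Context {R : realType}.

Lemma measurable_rV_coord n (i : 'I_n) :
  measurable_fun [set: 'rV[R]_n]
    (fun x : 'rV[R]_n => x ord0 i : measurableTypeR R).
Proof.
move=> _ Y mY; rewrite setTI; apply: sub_sigma_algebra => /=.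
rewrite -bigcup_seq/=; exists i => /=; first by rewrite mem_index_enum.
by exists Y => //; rewrite setTI.
Qed.

Lemma measurable_fun_rVP d (T : measurableType d) n (f : T -> 'rV[R]_n) :
  (forall i, measurable_fun [set: T]
     (fun t => f t ord0 i : measurableTypeR R)) ->
  measurable_fun [set: T] f.
Proof.
move=> mf _ A mA; rewrite setTI.
suff : measurable `<=` [set B | measurable (f @^-1` B)] by exact.
apply: smallest_sub.
  split => /=; first by rewrite preimage_set0.
  - by move=> B mB; rewrite setTD -preimage_setC; exact: measurableC.
  - by move=> F mF; rewrite preimage_bigcup; exact: bigcup_measurable.
rewrite -bigcup_seq => B [i _] [C mC <-] /=.
rewrite setTI -comp_preimage -[X in measurable X]setTI.
exact: (mf i).
Qed.

Definition rV_cons n (x : R * 'rV[R]_n) : 'rV[R]_n.+1 :=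
  \row_i (if unlift ord0 i is Some j then x.2 ord0 j else x.1).

Lemma measurable_rV_cons n :
  measurable_fun [set: measurableTypeR R * 'rV[R]_n] (@rV_cons n).
Proof.
apply: measurable_fun_rVP => i; rewrite /rV_cons.
under eq_fun do rewrite mxE.
case: (unlift ord0 i) => [j|]; last exact: measurable_fst.
exact: (measurableT_comp (@measurable_rV_coord n j) measurable_snd).
Qed.

Lemma measurable_rV_behead n :
  measurable_fun [set: 'rV[R]_n.+1]
    (fun v : 'rV[R]_n.+1 => \row_j v ord0 (lift ord0 j) : 'rV[R]_n).
Proof.
apply: measurable_fun_rVP => i; under eq_fun do rewrite mxE.
exact: measurable_rV_coord.
Qed.

End rV_measurability.

(* One step of the construction of the Lebesgue measure on R^n: the product of
   [lebesgue_measure] with a measure on R^n, carried to R^n.+1 by [rV_cons]. *)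
Section lebesgue_rV_succ.
Context {R : realType}.
Variables (n : nat) (mu : {sigma_finite_measure set 'rV[R]_n -> \bar R}).
Local Open Scope ereal_scope.

Definition lebesgue_rV_succ : set 'rV[R]_n.+1 -> \bar R :=
  pushforward ((@lebesgue_measure R) \x mu) (@rV_cons R n).

Let succ0 : lebesgue_rV_succ set0 = 0.
Proof. by rewrite /lebesgue_rV_succ /pushforward preimage_set0 measure0. Qed.

Let succ_ge0 A : 0 <= lebesgue_rV_succ A.
Proof. by rewrite /lebesgue_rV_succ /pushforward measure_ge0. Qed.

Let mpre A : measurable A -> measurable (@rV_cons R n @^-1` A).
Proof.
by move=> mA; rewrite -[X in measurable X]setTI; exact: measurable_rV_cons.
Qed.

Let succ_sigma_additive : semi_sigma_additive lebesgue_rV_succ.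
Proof.
move=> F mF tF mUF; rewrite /lebesgue_rV_succ /pushforward preimage_bigcup.
apply: measure_semi_sigma_additive.
- by move=> k; exact: mpre.
- apply/trivIsetP => /= i j _ _ ij; rewrite -preimage_setI.
  by move/trivIsetP : tF => /(_ _ _ _ _ ij) ->//; rewrite preimage_set0.
- by rewrite -preimage_bigcup; exact: mpre.
Qed.

HB.instance Definition _ := isMeasure.Build _ _ _ lebesgue_rV_succ
  succ0 succ_ge0 succ_sigma_additive.

Let succ_sigma_finite : sigma_finite setT lebesgue_rV_succ.
Proof.
have /sigma_finiteP[F [TF ndF Foo]] := sigma_finiteT (@lebesgue_measure R).
have /sigma_finiteP[G [TG ndG Goo]] := sigma_finiteT mu.
pose split (v : 'rV[R]_n.+1) : measurableTypeR R * 'rV[R]_n :=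
  (v ord0 ord0, \row_j v ord0 (lift ord0 j)).
have splitK : cancel (@rV_cons R n) split.
  move=> [x v]; rewrite /split /rV_cons mxE unlift_none; congr pair.
  by apply/rowP => j; rewrite !mxE liftK.
have msplit : measurable_fun setT split.
  apply: measurable_fun_pair; first exact: measurable_rV_coord.
  exact: measurable_rV_behead.
exists (fun k => split @^-1` (F k `*` G k)).
  rewrite -preimage_bigcup -[LHS](preimage_setT split); congr preimage.
  rewrite -setXTT TF TG; apply/seteqP; split => -[x y] /=.
    move=> [[i _ Fix] [j _ Gjy]]; exists (maxn i j) => //; split.
    - by move: x Fix; exact/subsetPset/ndF/leq_maxl.
    - by move: y Gjy; exact/subsetPset/ndG/leq_maxr.
  by move=> [i _ []/= ? ?]; split; exists i.
move=> k; have [mF Fk] := Foo k; have [mG Gk] := Goo k; split.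
  by rewrite -[X in measurable X]setTI; apply: msplit => //; exact: measurableX.
rewrite /lebesgue_rV_succ /pushforward -comp_preimage.
rewrite (_ : split \o _ = id); last by apply/funext => x /=; exact: splitK.
by rewrite preimage_id product_measure1E// lte_mul_pinfty// ge0_fin_numE.
Qed.

HB.instance Definition _ := Measure_isSigmaFinite.Build _ _ _ lebesgue_rV_succ
  succ_sigma_finite.

End lebesgue_rV_succ.

Fixpoint lebesgue_rV (R : realType) (n : nat) :
    {sigma_finite_measure set 'rV[R]_n -> \bar R} :=
  if n is m.+1 then lebesgue_rV_succ (lebesgue_rV R m)
  else \d_ (0 : 'rV[R]_0).

Section sobolev.
Context {R : realType} {n : nat}.
Local Notation ReC := (@complex.Re R).
Local Notation ImC := (@complex.Im R).
Local Notation normC := (@ComplexField.Normc.normc R).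
Implicit Types (D : set 'rV[R]_n) (p q : R) (s : \bar R).
Implicit Types (u psi : 'rV[R]_n -> R[i]) (g : 'rV[R]_n -> 'rV[R[i]]_n).

Definition LnormD D s (f : 'rV[R]_n -> R) : \bar R :=
  'N[lebesgue_rV R n]_s[EFin \o (f \_ D)]%E.

Definition LpD D s (f : 'rV[R]_n -> R) : Prop :=
  measurable_fun D f /\ (LnormD D s f < +oo)%E.

Definition cmeasurable D u : Prop :=
  measurable_fun D (ReC \o u) /\ measurable_fun D (ImC \o u).

Definition cintegrable D u : Prop :=
  (lebesgue_rV R n).-integrable D (EFin \o (ReC \o u)) /\
  (lebesgue_rV R n).-integrable D (EFin \o (ImC \o u)).

Definition cintegral D u : R[i] :=
  (\int[lebesgue_rV R n]_(x in D) ReC (u x)) +i*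
  (\int[lebesgue_rV R n]_(x in D) ImC (u x)).

Definition cLnormD D s u : \bar R := LnormD D s (normC \o u).

(* The norm that ['rV[R[i]]_n] gets from the library is the sup norm. *)
Definition enorm (z : 'rV[R[i]]_n) : R :=
  Num.sqrt (\sum_i normC (z ord0 i) ^+ 2).

Definition partial (i : 'I_n) (f : 'rV[R]_n -> R) : 'rV[R]_n -> R :=
  'D_(delta_mx ord0 i) f.

Definition smooth (f : 'rV[R]_n -> R) : Prop :=
  forall l : seq 'I_n,
    continuous (foldr partial f l) /\
    forall (i : 'I_n) x, derivable (foldr partial f l) x (delta_mx ord0 i).

Definition cpartial (i : 'I_n) psi : 'rV[R]_n -> R[i] := fun x =>
  partial i (ReC \o psi) x +i* partial i (ImC \o psi) x.

Definition cgradient psi : 'rV[R]_n -> 'rV[R[i]]_n :=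
  fun x => \row_i cpartial i psi x.

Definition test_function D psi : Prop :=
  [/\ smooth (ReC \o psi), smooth (ImC \o psi),
      compact (closure [set x | psi x != 0]) &
      closure [set x | psi x != 0] `<=` D].

Definition weak_gradient D u g : Prop :=
  forall psi, test_function D psi -> forall i : 'I_n,
    cintegral D (fun x => u x * cpartial i psi x) =
    - cintegral D (fun x => g x ord0 i * psi x).

(* Elements of the Sobolev spaces come with a version [g] of their gradient,
   which is unique up to a negligible set. *)
Definition W1p D p u g : Prop :=
  [/\ cmeasurable D u, (cLnormD D p%:E u < +oo)%E,
      forall i, cmeasurable D (fun x => g x ord0 i),
      (LnormD D p%:E (enorm \o g) < +oo)%E &
      weak_gradient D u g].

(* [W01p D p] is the closure of the test functions in W^{1,p}(D). *)
Definition W01p D p u g : Prop :=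
  W1p D p u g /\
  exists2 phi : ('rV[R]_n -> R[i])^nat, (forall k, test_function D (phi k)) &
    cLnormD D p%:E (u \- phi k) @[k --> \oo] --> 0%E /\
    LnormD D p%:E (enorm \o (g \- cgradient (phi k))) @[k --> \oo] --> 0%E.

Definition nontrivial D u : Prop :=
  ~ {ae lebesgue_rV R n, forall x, D x -> u x = 0}.

(* K_{q,p}, an element of [\bar R]: its finiteness is not presupposed. *)
Definition sobolev_constant D q p : \bar R :=
  ereal_sup [set k | exists u g,
    [/\ W01p D p u g, nontrivial D u &
        k = (cLnormD D q%:E u / LnormD D p%:E (enorm \o g))%E]].

(* [g] is the gradient of [u]. The library gives [0 `^ (p - 2)] the value 0 or
   1, so the products below vanish where [u], respectively [g], vanishes.
   Integrability is required because the library integral of a non-integrable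
   function is a default value; test functions are complex-valued and there is
   no conjugation. *)
Definition weak_solution D p (V : 'rV[R]_n -> R) u g : Prop :=
  forall psi, test_function D psi ->
    let lhs := fun x => (enorm (g x) `^ (p - 2))%:C *
                        \sum_i g x ord0 i * cgradient psi x ord0 i in
    let rhs := fun x => (V x)%:C * (normC (u x) `^ (p - 2))%:C *
                        u x * psi x in
    [/\ cintegrable D lhs, cintegrable D rhs &
        cintegral D lhs = cintegral D rhs].

End sobolev.

(* Main.v *)
Require Import Defs.
From mathcomp Require Import all_boot all_order all_algebra.
From mathcomp Require Import all_classical all_reals all_analysis.
From mathcomp Require Import measurable_realfun ess_sup_inf complex ring lra.

Set Implicit Arguments.
Unset Strict Implicit.
Unset Printing Implicit Defensive.

Import Order.TTheory GRing.Theory Num.Theory.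
Import numFieldNormedType.Exports.

Local Open Scope classical_set_scope.
Local Open Scope ring_scope.
Local Open Scope complex_scope.

(* Lower bound: testing the equation against the conjugates of test functions
   converging to [u] gives [int |grad u|^p = int V |u|^p <= int V_+ |u|^p]. By
   Hoelder's inequality and the definition of [K], the right-hand side is at
   most [||V_+||_r ||u||_q^p <= ||V_+||_r K^p ||grad u||_p^p], and [grad u] is
   not null. The Sobolev inequality, which also gives [u] in [L^q] and [K]
   finite, comes from the Gagliardo-Nirenberg inequality for integrals along
   coordinate lines, by induction on the dimension; it passes from test
   functions to [W_0^{1,p}] by truncation.

   Extremal: let [eta] be a test function and [t > 0]. In
   [||u + t eta||_q <= K ||grad u + t grad eta||_p], convexity of [|.|^q] bounds
   the left-hand side below by its tangent at [0], and convexity of [|.|^p]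
   bounds the right-hand side above by its tangent at [t]. As [t] tends to [0]
   this gives an inequality between the two first variations at [u], which is an
   equality because [eta] can be replaced with [- eta]; taking [- 'i * eta]
   gives the imaginary parts. The value of [||V||_r] follows from
   [(q - p) r = q]. *)

(** * Integrals of powers *)

(** Nothing is known about the boundary of [D]: [W01p] is reached only through approximating test
    functions, and a weak solution may be tested against nothing else. So [u] itself never enters
    the equation. Pointwise inequalities compare both sides, at a test function [phi], with the
    wanted integrals, up to the errors [|grad u|^(p-1) |grad (u - phi)|] and
    [|V| |u|^(p-1) |u - phi|]. The second is measured in L^q, where no convergence is assumed; the
    Sobolev inequality for [u - phi] reduces it to the first. For [p < 2] the weight [|.|^(p-2)] is
    singular at zeros of the gradient. It is therefore always kept together with the vector it
    multiplies, and the energy is never differentiated: the tangent inequalities follow from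
    Cauchy-Schwarz and Young, and only one limit, by dominated convergence, remains. The extremal is
    normalized through its gradient, whereas the supremum [K] ranges over nontrivial functions and
    is [-oo] over the empty set. Hence [K > 0] needs an argument: a test function whose gradient is
    close to a non-null one is itself nontrivial. *)

Section ereal_power_integrals.
Context d (T : measurableType d) (R : realType).
Variable mu : {measure set T -> \bar R}.
Variables (D : set T) (mD : measurable D).
Local Open Scope ereal_scope.
Implicit Types f g : T -> \bar R.

Lemma le_poweR (x y : \bar R) (a : R) :
  (0 <= a)%R -> 0 <= x -> x <= y -> x `^ a <= y `^ a.
Proof.
move=> a0 x0 xy; apply: gt0_ler_poweR => //; rewrite in_itv/= ?x0 ?leey//.
by rewrite (le_trans x0 xy).
Qed.

Lemma measurable_fun_poweR (a : R) f :
  measurable_fun D f -> measurable_fun D (fun x => f x `^ a).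
Proof. by move=> mf; exact: (measurableT_comp (measurable_poweR a)). Qed.

Lemma young_poweR (x y : \bar R) (a b : R) :
  (0 < a)%R -> (0 < b)%R -> (a + b = 1)%R -> 0 <= x -> 0 <= y ->
  x `^ a * y `^ b <= a%:E * x + b%:E * y.
Proof.
move=> a0 b0 ab x0 y0.
have [xoo|] := eqVneq x +oo.
  by rewrite xoo gt0_muley ?lte_fin// addye ?leey// -ltNye (lt_le_trans (ltNyr 0%R))// mule_ge0// lee_fin ltW.
have [yoo _|] := eqVneq y +oo.
  by rewrite yoo [b%:E * _]gt0_muley ?lte_fin// addey ?leey// -ltNye (lt_le_trans (ltNyr 0%R))// mule_ge0// lee_fin ltW.
case: x x0 => [x x0|//|//]; case: y y0 => [y + _ _|//|//].
rewrite !poweR_EFin -!EFinM -EFinD lee_fin => y0; move: x0; rewrite !lee_fin => x0.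
have := @conjugate_powR R (x `^ a)%R (y `^ b)%R a^-1%R b^-1%R
  (powR_ge0 _ _) (powR_ge0 _ _).
rewrite !invr_gt0 !invrK => /(_ a0 b0 ab).
by rewrite -!powRrM !mulfV ?gt_eqF// !powRr1// [(a * x)%R]mulrC [(b * y)%R]mulrC.
Qed.

(** Divide [f] and [g] by their integrals and integrate [young_poweR]. Weights with [a + b = 1]
    replace conjugate exponents: every later use already has its integrands as powers. *)
Lemma geometric_hoelder f g (a b : R) :
  (0 < a)%R -> (0 < b)%R -> (a + b = 1)%R ->
  measurable_fun D f -> measurable_fun D g ->
  (forall x, D x -> 0 <= f x) -> (forall x, D x -> 0 <= g x) ->
  \int[mu]_(x in D) (f x `^ a * g x `^ b) <=
  (\int[mu]_(x in D) f x) `^ a * (\int[mu]_(x in D) g x) `^ b.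
Proof.
move=> a0 b0 ab mf mg f0 g0.
have mfa := measurable_fun_poweR a mf; have mgb := measurable_fun_poweR b mg.
(* A function with zero integral is null, and then so is the product, even where [k] is infinite,
   since [0 * +oo] is [0]. *)
have zero h k (mh : measurable_fun D h) (mk : measurable_fun D k) (c : R) : (0 < c)%R ->
    (forall x, D x -> 0 <= h x) -> \int[mu]_(x in D) h x = 0 ->
    \int[mu]_(x in D) (h x `^ c * k x) = 0.
  move=> c0 h0 ih.
  have : \int[mu]_(x in D) `|h x| = 0.
    by rewrite -[RHS]ih; apply: eq_integral => x; rewrite inE => /h0/gee0_abs.
  move/(ae_eq_integral_abs mu mD mh) => hae.
  rewrite (ae_eq_integral (cst 0)) ?integral0//.
    by apply: emeasurable_funM => //; exact: measurable_fun_poweR.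
  by apply: filterS hae => x hx /hx /= ->; rewrite poweR0r ?gt_eqF// mul0e.
have If0 : 0 <= \int[mu]_(x in D) f x by exact: integral_ge0.
have Ig0 : 0 <= \int[mu]_(x in D) g x by exact: integral_ge0.
have [f00|f00] := eqVneq (\int[mu]_(x in D) f x) 0.
  by rewrite zero// mule_ge0// poweR_ge0.
have [g00|g00] := eqVneq (\int[mu]_(x in D) g x) 0.
  under eq_integral do rewrite muleC.
  by rewrite zero// mule_ge0// poweR_ge0.
have Ifp : 0 < \int[mu]_(x in D) f x by rewrite lt0e f00.
have Igp : 0 < \int[mu]_(x in D) g x by rewrite lt0e g00.
have [->|foo] := eqVneq (\int[mu]_(x in D) f x) +oo.
  by rewrite poweRyr ?gt_eqF// gt0_mulye ?leey// poweR_gt0.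
have [->|goo] := eqVneq (\int[mu]_(x in D) g x) +oo.
  by rewrite poweRyr ?gt_eqF// gt0_muley ?leey// poweR_gt0.
set F := \int[mu]_(x in D) f x in If0 Ifp foo f00 *.
set G := \int[mu]_(x in D) g x in Ig0 Igp goo g00 *.
have : F \is a fin_num by rewrite ge0_fin_numE// ltey.
have : G \is a fin_num by rewrite ge0_fin_numE// ltey.
move=> /fineK GE /fineK FE.
set u := fine F in FE; set v := fine G in GE.
have u0 : (0 < u)%R by rewrite -lte_fin FE.
have v0 : (0 < v)%R by rewrite -lte_fin GE.
(* The constant [F^a G^b] comes out; the remaining integral is at most [a + b = 1]. *)
have split x : D x -> f x `^ a * g x `^ b =
    (F `^ a * G `^ b) * ((u^-1%:E * f x) `^ a * (v^-1%:E * g x) `^ b).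
  move=> Dx; rewrite !poweRM ?f0 ?g0 ?lee_fin ?invr_ge0 ?ltW//.
  rewrite muleACA !muleA -FE -GE !poweR_EFin -EFinM.
  rewrite -powRM ?invr_ge0 ?ltW// mulfV ?gt_eqF// powR1 mul1e.
  rewrite -[_ * _ * (v^-1 `^ b)%:E]muleA -EFinM -powRM ?invr_ge0 ?ltW//.
  by rewrite mulfV ?gt_eqF// powR1 mule1.
under eq_integral => x xD do rewrite (split _ (set_mem xD)).
have mfu : measurable_fun D (fun x => u^-1%:E * f x) by exact: measurable_funeM.
have mgv : measurable_fun D (fun x => v^-1%:E * g x) by exact: measurable_funeM.
have pos0 h (c : R) : (0 < c)%R -> (forall x, D x -> 0 <= h x) -> forall x, D x -> 0 <= c^-1%:E * h x.
  by move=> c0 h0 x Dx; rewrite mule_ge0 ?h0// lee_fin invr_ge0 ltW.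
rewrite ge0_integralZl//; last 3 first.
- by apply: emeasurable_funM; exact: measurable_fun_poweR.
- by move=> x _; rewrite mule_ge0 ?poweR_ge0.
- by rewrite mule_ge0 ?poweR_ge0.
rewrite -[leRHS]mule1; apply: lee_wpmul2l; first by rewrite mule_ge0 ?poweR_ge0.
apply: (@le_trans _ _ (\int[mu]_(x in D) (a%:E * (u^-1%:E * f x) + b%:E * (v^-1%:E * g x)))).
  apply: ge0_le_integral => //.
  - by move=> x Dx; rewrite mule_ge0 ?poweR_ge0.
  - by apply: emeasurable_funM; exact: measurable_fun_poweR.
  - by apply: emeasurable_funD; apply: measurable_funeM.
  - by move=> x Dx; apply: young_poweR => //; exact: pos0.
rewrite ge0_integralD//; last 4 first.
- by move=> x Dx; rewrite mule_ge0 ?lee_fin ?(ltW a0) ?pos0.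
- exact: measurable_funeM.
- by move=> x Dx; rewrite mule_ge0 ?lee_fin ?(ltW b0) ?pos0.
- exact: measurable_funeM.
rewrite !ge0_integralZl ?lee_fin ?invr_ge0 ?(ltW a0) ?(ltW b0) ?(ltW u0) ?(ltW v0)//; last 2 first.
- exact: pos0.
- exact: pos0.
by rewrite -/F -/G -FE -GE -!EFinM !mulVf ?gt_eqF// !mulr1 -EFinD ab.
Qed.

Lemma prode_ge0 (I : Type) (s : seq I) (F : I -> \bar R) :
  (forall i, 0 <= F i) -> 0 <= \prod_(i <- s) F i.
Proof. by move=> F0; elim/big_ind : _ => // *; exact: mule_ge0. Qed.

Lemma emeasurable_prod (I : Type) (s : seq I) (F : I -> T -> \bar R) :
  (forall i, measurable_fun D (F i)) ->
  measurable_fun D (fun x => \prod_(i <- s) F i x).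
Proof.
move=> mF; elim: s => [|i s IH].
  by under eq_fun do rewrite big_nil; exact: measurable_cst.
by under eq_fun do rewrite big_cons; exact: emeasurable_funM.
Qed.

(** Induction: [h ord0] is split off with weight [1/(n+2)], and the geometric mean of the other
    factors carries the weight [(n+1)/(n+2)]. *)
Lemma geometric_hoelder_prod n (h : 'I_n.+1 -> T -> \bar R) :
  (forall i, measurable_fun D (h i)) -> (forall i x, 0 <= h i x) ->
  \int[mu]_(x in D) (\prod_i h i x) `^ n.+1%:R^-1 <=
  (\prod_i \int[mu]_(x in D) h i x) `^ n.+1%:R^-1.
Proof.
elim: n h => [|n IH] h mh h0.
  rewrite invr1 big_ord_recl big_ord0 mule1 poweRe1 ?integral_ge0//.
  by under eq_integral do rewrite big_ord_recl big_ord0 mule1 poweRe1//.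
pose a : R := n.+2%:R^-1%R; pose b : R := (n.+1%:R / n.+2%:R)%R.
have a0 : (0 < a)%R by rewrite invr_gt0 ltr0n.
have b0 : (0 < b)%R by rewrite divr_gt0 ?ltr0n.
have ab : (a + b = 1)%R.
  by rewrite /a /b -[X in (X + _)%R]mul1r -mulrDl nat1r mulfV// pnatr_eq0.
have aE : a = (n.+1%:R^-1 * b)%R by rewrite /b mulKf// pnatr_eq0.
pose k x := (\prod_(i < n.+1) h (lift ord0 i) x) `^ n.+1%:R^-1.
have hp x : (\prod_i h i x) `^ a = h ord0 x `^ a * k x `^ b.
  by rewrite big_ord_recl poweRM ?prode_ge0// /k -poweRrM -aE.
rewrite -/a; under eq_integral do rewrite hp.
apply: le_trans (geometric_hoelder a0 b0 ab _ _ _ _) _ => //.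
- by apply: measurable_fun_poweR; exact: emeasurable_prod.
- by move=> x _; exact: poweR_ge0.
have i0 j : 0 <= \int[mu]_(x in D) h j x by exact: integral_ge0.
rewrite big_ord_recl poweRM ?prode_ge0//.
apply: lee_wpmul2l; first exact: poweR_ge0.
rewrite [in leRHS]aE (poweRrM _ _ b); apply: le_poweR.
- exact: ltW.
- by apply: integral_ge0 => x _; exact: poweR_ge0.
- exact: IH.
Qed.

End ereal_power_integrals.

(** * Lebesgue measure on R^n *)

Section borel_rV.
Context {R : realType} {n : nat}.

Lemma measurable_rV_box (P : 'I_n -> set R) :
  (forall i, measurable (P i : set (measurableTypeR R))) ->
  measurable [set x : 'rV[R]_n | forall i, P i (x ord0 i)].
Proof.
move=> mP; pose F i := (fun x : 'rV[R]_n => x ord0 i : measurableTypeR R) @^-1` P i.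
rewrite (_ : [set x | _] = \bigcap_(i in [set: 'I_n]) F i); last first.
  by apply/seteqP; split => [x Px i _|x Px i]; exact: Px.
apply: fin_bigcap_measurable => // i _.
by rewrite -[X in measurable X]setTI; exact: measurable_rV_coord.
Qed.

Let box (c : 'rV[R]_n) (e : R) := [set x : 'rV[R]_n | forall i, ball (c ord0 i) e (x ord0 i)].

(** The sigma-algebra is generated by the coordinates, so it contains boxes; an open set is the
    countable union of the cubes with rational centre and radius that it contains. *)
Lemma measurable_open_rV (A : set 'rV[R]_n) : open A -> measurable A.
Proof.
move=> oA.
pose F (q : 'rV[rat]_n * rat) : set 'rV[R]_n :=
  let B := box (map_mx ratr q.1) (ratr q.2) in if `[< B `<=` A >] then B else set0.
rewrite (_ : A = \bigcup_q F q).
  apply: countable_bigcupT_measurable => //.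
  move=> q; rewrite /F; case: ifP => _; last exact: measurable0.
  rewrite /box; set c := map_mx _ _; apply: (@measurable_rV_box (fun i => ball (c ord0 i) (ratr q.2))) => i.
  exact: measurable_ball.
apply/seteqP; split => [x Ax|x [q _]]; last first.
  by rewrite /F; case: ifPn => // /asboolP BA /BA.
move: oA; rewrite openE => /(_ _ Ax); rewrite /interior => /nbhs_ballP[e /= e0 eA].
have [q] : exists q : rat, ratr q \in `](0 : R), e / 2[ by apply: rat_in_itvoo; exact: divr_gt0.
rewrite in_itv/= => /andP[q0 qe].
have xq i : {c : rat | `|ratr c - x ord0 i| < ratr q}.
  apply: cid; have [c] : exists c : rat, ratr c \in `](x ord0 i - ratr q), (x ord0 i + ratr q)[.
    by apply: rat_in_itvoo; lra.
  by rewrite in_itv/= => /andP[? ?]; exists c; rewrite ltr_distl; lra.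
(* The centre is within [q < e / 2] of [x], so the whole cube is within [e] of [x]. *)
exists (\row_i (sval (xq i)), q) => //; rewrite /F /=.
have xB : box (map_mx ratr (\row_i sval (xq i))) (ratr q) x.
  by move=> i; rewrite !mxE; exact: (svalP (xq i)).
case: ifPn => // /asboolPn; apply: contra_notP => _ y By; apply: eA; split => // i j.
rewrite ord1 /ball/=; have := By j; have := xB j; rewrite !mxE /ball/=.
set c := ratr _ => xc yc.
have -> : x ord0 j - y ord0 j = (x ord0 j - c) + (c - y ord0 j) by lra.
by rewrite (le_lt_trans (ler_normD _ _))// [`|x _ _ - c|]distrC; lra.
Qed.

Lemma continuous_measurable_rV (f : 'rV[R]_n -> R) :
  continuous f -> measurable_fun setT f.
Proof.
move=> /continuousP cf; apply: (measurability _ (RGenOpens.measurableE R)).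
move=> _ [_ [a [b ->] <-]]; rewrite setTI; apply: measurable_open_rV.
exact/cf/interval_open.
Qed.

End borel_rV.

(** * Fubini's theorem on R^(n+1), seen as the product of R and R^n *)

Section fubini_rV.
Context {R : realType} {n : nat}.
Local Notation mu := (lebesgue_rV R).
Local Notation leb := (@lebesgue_measure R).
Local Open Scope ereal_scope.
Implicit Types f : 'rV[R]_n.+1 -> \bar R.

Let mcons f : measurable_fun setT f ->
  measurable_fun setT (fun z : measurableTypeR R * 'rV[R]_n => f (rV_cons z)).
Proof. by move=> mf; exact: (measurableT_comp mf (@measurable_rV_cons R n)). Qed.

Lemma measurable_rV_cons_slice f (s : R) : measurable_fun setT f ->
  measurable_fun setT (fun y : 'rV[R]_n => f (rV_cons (s, y))).
Proof.
by move=> mf; apply: (measurableT_comp (mcons mf)); exact: measurable_pair1.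
Qed.

Lemma ge0_integral_rV1 f : measurable_fun setT f -> (forall x, 0 <= f x) ->
  \int[mu n.+1]_x f x = \int[leb]_s \int[mu n]_y f (rV_cons (s, y)).
Proof.
move=> mf f0 /=; rewrite ge0_integral_pushforward//=; last exact: measurable_rV_cons.
by rewrite preimage_setT fubini_tonelli1//; exact: mcons.
Qed.

Lemma ge0_integral_rV2 f : measurable_fun setT f -> (forall x, 0 <= f x) ->
  \int[mu n.+1]_x f x = \int[mu n]_y \int[leb]_s f (rV_cons (s, y)).
Proof.
move=> mf f0 /=; rewrite ge0_integral_pushforward//=; last exact: measurable_rV_cons.
by rewrite preimage_setT fubini_tonelli2//; exact: mcons.
Qed.

Lemma measurable_integral_rV1 f : measurable_fun setT f -> (forall x, 0 <= f x) ->
  measurable_fun setT (fun s : measurableTypeR R => \int[mu n]_y f (rV_cons (s, y))).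
Proof.
move=> mf f0; exact: (@measurable_fun_fubini_tonelli_F _ _ _ _ _ (mu n) _ (mcons mf)).
Qed.

Lemma measurable_integral_rV2 f : measurable_fun setT f -> (forall x, 0 <= f x) ->
  measurable_fun setT (fun y : 'rV[R]_n => \int[leb]_s f (rV_cons (s, y))).
Proof.
move=> mf f0; exact: (@measurable_fun_fubini_tonelli_G _ _ _ _ _ leb _ (mcons mf)).
Qed.

Lemma integral_rV1 f : (mu n.+1).-integrable setT f ->
  \int[mu n.+1]_x f x = \int[leb]_s \int[mu n]_y f (rV_cons (s, y)).
Proof.
move=> /integrableP[mf foo] /=.
have int : (leb \x mu n).-integrable setT (f \o (@rV_cons R n)).
  apply/integrableP; split; first exact: mcons.
  move: foo; rewrite ge0_integral_pushforward//=; first exact: measurable_rV_cons.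
  exact: measurableT_comp.
rewrite integral_pushforward//; last exact: measurable_rV_cons.
by rewrite preimage_setT -integral12_prod_meas1.
Qed.

Lemma integral_rV2 f : (mu n.+1).-integrable setT f ->
  \int[mu n.+1]_x f x = \int[mu n]_y \int[leb]_s f (rV_cons (s, y)).
Proof.
move=> /integrableP[mf foo] /=.
have int : (leb \x mu n).-integrable setT (f \o (@rV_cons R n)).
  apply/integrableP; split; first exact: mcons.
  move: foo; rewrite ge0_integral_pushforward//=; first exact: measurable_rV_cons.
  exact: measurableT_comp.
rewrite integral_pushforward//; last exact: measurable_rV_cons.
by rewrite preimage_setT -integral21_prod_meas1.
Qed.

End fubini_rV.

Section bounded_rV.
Context {R : realType}.
Local Notation mu := (lebesgue_rV R).

Lemma lebesgue_rV_cube_lty n (M : R) :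
  (mu n [set x : 'rV[R]_n | forall i : 'I_n, (`|x ord0 i| <= M)%R] < +oo)%E.
Proof.
elim: n => [|n IH]; first by rewrite /= diracE; case: (_ \in _); rewrite ?ltry.
rewrite /= /lebesgue_rV_succ /pushforward.
rewrite (_ : _ @^-1` _ = `[- M, M]%classic `*` [set x : 'rV[R]_n | forall i : 'I_n, (`|x ord0 i| <= M)%R]).
  rewrite product_measure1E//; last first.
    apply: (@measurable_rV_box _ _ (fun=> [set t | `|t| <= M])) => i.
    rewrite (_ : [set t | _] = `[- M, M]%classic)//.
    by apply/seteqP; split => t /=; rewrite in_itv/= ler_norml.
  rewrite lte_mul_pinfty//; last first.
    by have /= -> := lebesgue_measure_itv `[- M, M]; case: ifP => // _; rewrite -EFinD.
apply/seteqP; split => [[s y] /= H|[s y] /= [H1 H2] i].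
- split; first by have := H ord0; rewrite mxE unlift_none/= in_itv/= ler_norml.
  by move=> i; have := H (lift ord0 i); rewrite mxE liftK.
- rewrite mxE; case: unliftP => [j _|_]//=.
  by move: H1; rewrite in_itv/= ler_norml.
Qed.

Lemma lebesgue_rV_bounded_lty n (D : set 'rV[R]_n) :
  measurable D -> bounded_set D -> (mu n D < +oo)%E.
Proof.
move=> mD [M [_ /(_ (M + 1))]]; rewrite ltrDl ltr01 => /(_ isT) DM.
apply: le_lt_trans (lebesgue_rV_cube_lty n (M + 1)).
apply: le_measure; rewrite ?inE//.
  apply: (@measurable_rV_box _ _ (fun=> [set t | `|t| <= M + 1])) => i.
  rewrite (_ : [set t | _] = `[- (M + 1), M + 1]%classic)//.
  by apply/seteqP; split => t /=; rewrite in_itv/= ler_norml.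
move=> x /DM /= xM i; apply: le_trans xM.
rewrite [leRHS]/Num.norm/= mx_normrE.
exact: (le_bigmax _ (fun ij : 'I_1 * 'I_n => `|x ij.1 ij.2|) (ord0, i)).
Qed.

End bounded_rV.

(** The coordinate line is parametrized by the value of the coordinate and not by the displacement
    from [x], so an integral over [t] does not depend on the [i]-th coordinate of [x]. *)
Definition rV_set (R : Type) n (x : 'rV[R]_n) (i : 'I_n) (t : R) : 'rV[R]_n :=
  \row_j if j == i then t else x ord0 j.

Lemma rV_set_cons0 (R : realType) n s t (y : 'rV[R]_n) :
  rV_set (rV_cons (s, y)) ord0 t = rV_cons (t, y).
Proof.
apply/rowP => j; rewrite !mxE/=; case: unliftP => [k ->|->]; last by rewrite eqxx.
by rewrite eq_sym (negbTE (neq_lift _ _)).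
Qed.

Lemma rV_set_consS (R : realType) n s t (y : 'rV[R]_n) j :
  rV_set (rV_cons (s, y)) (lift ord0 j) t = rV_cons (s, rV_set y j t).
Proof.
apply/rowP => k; rewrite !mxE/=; case: unliftP => [l ->|->].
  by rewrite (inj_eq lift_inj) mxE.
by rewrite (negbTE (neq_lift _ _)).
Qed.

(** * The Gagliardo-Nirenberg-Sobolev inequality *)

Section gagliardo_nirenberg.
Context {R : realType}.
Local Notation mu := (lebesgue_rV R).
Local Notation leb := (@lebesgue_measure R).
Local Open Scope ereal_scope.

(** All that is kept of the fundamental theorem of calculus. It mentions no derivative and passes to
    the slices of [f], which is what the induction needs. *)
Let line_bound n (f : 'rV[R]_n -> \bar R) (g : 'I_n -> 'rV[R]_n -> \bar R) :=
  [/\ measurable_fun setT f, forall x, 0 <= f x,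
      forall i, measurable_fun setT (g i), forall i x, 0 <= g i x &
      forall i x, f x <= \int[leb]_t g i (rV_set x i t)].

Let duality m := forall (f G : 'rV[R]_m.+1 -> \bar R) g,
  measurable_fun setT G -> (forall x, 0 <= G x) -> line_bound f g ->
  \int[mu m.+1]_x (G x `^ m.+1%:R^-1 * f x) <=
  ((\int[mu m.+1]_x G x) * \prod_i \int[mu m.+1]_x g i x) `^ m.+1%:R^-1.

Let gns m := forall (f : 'rV[R]_m.+2 -> \bar R) g, line_bound f g ->
  \int[mu m.+2]_x (f x `^ (1 + m.+1%:R^-1)) <=
  (\prod_i \int[mu m.+2]_x g i x) `^ m.+1%:R^-1.

Let inv_gt0 m : (0 < m.+1%:R^-1 :> R)%R.
Proof. by rewrite invr_gt0 ltr0n. Qed.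

(** In dimension one the line integral of [g ord0] is the constant total integral, which bounds [f]
    pointwise. *)
Let duality0 : duality 0.
Proof.
move=> f G g mG G0 [mf f0 mg g0 fg].
have gE : \int[mu 1]_x g ord0 x = \int[leb]_t g ord0 (rV_cons (t, 0%R)).
  rewrite ge0_integral_rV1//; apply: eq_integral => s _ /=.
  rewrite integral_dirac//; last exact: measurable_rV_cons_slice.
  by rewrite diracE in_setT mul1e.
have fc x : f x <= \int[mu 1]_x g ord0 x.
  rewrite gE; apply: le_trans (fg ord0 x) _.
  rewrite le_eqVlt; apply/orP; left; apply/eqP; apply: eq_integral => t _; congr g.
  by apply/rowP => j; rewrite !mxE (ord1 j)/= unlift_none.
rewrite invr1 big_ord_recl big_ord0 mule1 poweRe1; last first.
  by rewrite mule_ge0// integral_ge0.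
rewrite -ge0_integralZr//; last by rewrite integral_ge0.
apply: ge0_le_integral => //.
- by move=> x _; rewrite mule_ge0// poweR_ge0.
- by apply: emeasurable_funM => //; exact: measurable_fun_poweR.
- exact: emeasurable_funM.
- by move=> x _; rewrite poweRe1//; apply: lee_wpmul2l.
Qed.

(** Write [f^(1+a)] as [f^a f]. The line in the first direction bounds [f^a] by [G^a], with [G]
    independent of the first coordinate; the dual form treats each slice; integrating the product of
    the [h j] over [s] is Hoelder's inequality with [m+1] equal weights. *)
Let duality_gns m : duality m -> gns m.
Proof.
move=> dm f g [mf f0 mg g0 fg].
set a : R := m.+1%:R^-1%R; have a0 : (0 < a)%R := inv_gt0 m.
pose G y := \int[leb]_t g ord0 (rV_cons (t, y)).
pose h j s := \int[mu m.+1]_y g (lift ord0 j) (rV_cons (s, y)).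
have mG : measurable_fun setT G by exact: measurable_integral_rV2.
have G0 y : 0 <= G y by exact: integral_ge0.
have mh j : measurable_fun setT (h j : measurableTypeR R -> _) by exact: measurable_integral_rV1.
have h0 j s : 0 <= h j s by exact: integral_ge0.
have fE x : f x `^ (1 + a) = f x `^ a * f x.
  by rewrite addrC poweRD ?poweRe1// add_neq0_poweRD_def// gt_eqF// addr_gt0.
have mfa : measurable_fun setT (fun x => f x `^ (1 + a)) by exact: measurable_fun_poweR.
rewrite ge0_integral_rV1//; last by move=> x; exact: poweR_ge0.
apply: (@le_trans _ _ (\int[leb]_s ((\int[mu m.+1]_y G y) `^ a * (\prod_j h j s) `^ a))).
  apply: ge0_le_integral => //.
  - by move=> s _; apply: integral_ge0 => y _; exact: poweR_ge0.
  - by apply: (measurable_integral_rV1 mfa) => x; exact: poweR_ge0.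
  - apply: emeasurable_funM => //; apply: measurable_fun_poweR.
    exact: emeasurable_prod.
  move=> s _; rewrite -poweRM ?integral_ge0 ?prode_ge0//.
  have mfs := measurable_rV_cons_slice s mf.
  apply: le_trans (dm (fun y => f (rV_cons (s, y))) G
    (fun j y => g (lift ord0 j) (rV_cons (s, y))) _ _ _) => //; last first.
    split => //.
    - by move=> i; exact: measurable_rV_cons_slice.
    - by move=> j y; apply: le_trans (fg (lift ord0 j) _) _; under eq_integral do rewrite rV_set_consS.
  apply: ge0_le_integral => //.
  - by move=> y _; exact: poweR_ge0.
  - exact: measurable_fun_poweR.
  - by apply: emeasurable_funM => //; exact: measurable_fun_poweR.
  move=> y _; rewrite fE; apply: lee_wpmul2r => //; apply: le_poweR => //; first exact: ltW.
  by apply: le_trans (fg ord0 _) _; under eq_integral do rewrite rV_set_cons0.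
rewrite ge0_integralZl//; last 3 first.
- by apply: measurable_fun_poweR; exact: emeasurable_prod.
- by move=> s _; exact: poweR_ge0.
- exact: poweR_ge0.
rewrite big_ord_recl poweRM ?prode_ge0 ?integral_ge0//; last first.
  by move=> i; exact: integral_ge0.
rewrite -ge0_integral_rV2//; apply: lee_wpmul2l; first exact: poweR_ge0.
apply: le_trans (geometric_hoelder_prod _ _ _ _) _ => //.
apply: le_poweR; [exact: ltW|by apply: prode_ge0 => i; exact: integral_ge0|].
by under [leRHS]eq_bigr do rewrite ge0_integral_rV1//.
Qed.

(** Hoelder's inequality with weight [b] on [G] and [1 - b] on [f^(1+a)]; the identities [ab1] and
    [ab2] say that the exponents match. *)
Let gns_duality m : gns m -> duality m.+1.
Proof.
move=> gm f G g mG G0 fg; have [mf f0 mg g0 _] := fg.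
set b : R := m.+2%:R^-1%R; have b0 : (0 < b)%R := inv_gt0 m.+1.
set a : R := m.+1%:R^-1%R; have a0 : (0 < a)%R := inv_gt0 m.
have m0 : (0 <= m%:R :> R)%R by [].
have ab1 : (a * (1 - b) = b)%R.
  by rewrite /a /b -!natr1; field; lra.
have ab2 : ((1 + a) * (1 - b) = 1)%R.
  by rewrite /a /b -!natr1; field; lra.
have b1 : (0 < 1 - b)%R by rewrite -(pmulr_rgt0 _ a0) ab1.
have fE x : f x = (f x `^ (1 + a)) `^ (1 - b) by rewrite -poweRrM ab2 poweRe1.
under eq_integral do rewrite [f _]fE.
have mfa : measurable_fun setT (fun x => f x `^ (1 + a)) by exact: measurable_fun_poweR.
have bb : (b + (1 - b) = 1)%R by rewrite addrC subrK.
have fa0 x : [set: 'rV[R]_m.+2] x -> 0 <= f x `^ (1 + a) by move=> _; exact: poweR_ge0.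
apply: le_trans (geometric_hoelder (mu m.+2) measurableT b0 b1 bb mG mfa (fun x _ => G0 x) fa0) _.
have p0 : 0 <= \prod_i \int[mu m.+2]_x g i x.
  by apply: prode_ge0 => i; exact: integral_ge0.
rewrite poweRM ?integral_ge0//; apply: lee_wpmul2l; first exact: poweR_ge0.
rewrite -[in leRHS]ab1 (poweRrM _ a); apply: le_poweR; first exact: ltW.
  by apply: integral_ge0 => x _; exact: poweR_ge0.
exact: gm.
Qed.

(* The inequality in dimension [m.+2] is proved together with the dual form
   obtained by testing [f] against [G `^ m.+1%:R^-1], which is the form that
   the slices of a function in one more dimension require. *)
Lemma gagliardo_nirenberg m (f : 'rV[R]_m.+2 -> \bar R)
    (g : 'I_m.+2 -> 'rV[R]_m.+2 -> \bar R) :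
  measurable_fun setT f -> (forall x, 0 <= f x) ->
  (forall i, measurable_fun setT (g i)) -> (forall i x, 0 <= g i x) ->
  (forall i x, f x <= \int[leb]_t g i (rV_set x i t)) ->
  \int[mu m.+2]_x (f x `^ (1 + m.+1%:R^-1)) <=
  (\prod_i \int[mu m.+2]_x g i x) `^ m.+1%:R^-1.
Proof.
move=> mf f0 mg g0 fg; apply: (_ : gns m) => //; apply: duality_gns.
by elim: m {f g mf f0 mg g0 fg} => [|m IH]; [exact: duality0|exact/gns_duality/duality_gns].
Qed.

End gagliardo_nirenberg.

(** * The function [|u|^c] and its derivative *)

Section normr_powR.
Context {R : realType}.
Implicit Types (c s u : R).

Lemma continuous_normr_powR_neq0 c u : u != 0 -> {for u, continuous (fun v : R => `|v| `^ c)}.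
Proof.
move=> u0; apply: (@continuous_comp _ _ _ (fun v : R => `|v|) (fun v => v `^ c)).
  exact: norm_continuous.
apply: differentiable_continuous; apply/derivable1_diffP/derivable_powR.
by rewrite in_itv/= andbT normr_gt0.
Qed.

Lemma continuous_normr_powR c : 0 < c -> continuous (fun v : R => `|v| `^ c).
Proof.
move=> c0 u; have [->|] := eqVneq u 0; last exact: continuous_normr_powR_neq0.
rewrite /continuous_at normr0 powR0 ?gt_eqF//; apply/cvgrPdist_lt => e e0.
near=> v; rewrite sub0r normrN ger0_norm ?powR_ge0//.
have -> : e = (e `^ c^-1) `^ c by rewrite -powRrM mulVf ?gt_eqF// powRr1 ?ltW.
apply: gt0_ltr_powR; rewrite ?nnegrE ?powR_ge0//.
near: v; have := @nbhs0_lt R R (e `^ c^-1) (powR_gt0 _ e0).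
exact.
Unshelve. all: by end_near. Qed.

(* The derivative of [`|u| `^ c], written so that it vanishes at [0]. *)
Definition dnormr_powR c u : R := c * (u * `|u| `^ (c - 2)).

Lemma norm_dnormr_powR c u : 1 < c -> `|dnormr_powR c u| = c * `|u| `^ (c - 1).
Proof.
move=> c1; have c0 : 0 < c by lra.
rewrite /dnormr_powR !normrM (gtr0_norm c0) (ger0_norm (powR_ge0 _ _)).
congr (_ * _); have [->|u0] := eqVneq u 0.
  by rewrite normr0 mul0r powR0// gt_eqF// subr_gt0.
rewrite -[X in X * _]powRr1// -powRD; first by congr powR; lra.
by rewrite normr_eq0 u0 implybT.
Qed.

Lemma continuous_dnormr_powR c : 1 < c -> continuous (dnormr_powR c).
Proof.
move=> c1 u; have [->|u0] := eqVneq u 0; last first.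
  apply: cvgM; first exact: cvg_cst.
  by apply: cvgM; [exact: cvg_id|exact: continuous_normr_powR_neq0].
rewrite /continuous_at {2}/dnormr_powR mul0r mulr0.
apply: norm_cvg0; under eq_fun do rewrite norm_dnormr_powR//.
suff : c * `|x| `^ (c - 1) @[x --> (0 : R)] --> c * 0 by rewrite mulr0.
apply: cvgM; first exact: cvg_cst.
have := @continuous_normr_powR (c - 1) _ 0; rewrite subr_gt0 => /(_ c1).
by rewrite /continuous_at normr0 powR0// gt_eqF// subr_gt0.
Qed.

Lemma is_derive_normr_powR c u : 1 < c ->
  is_derive u 1 (fun v => `|v| `^ c) (dnormr_powR c u).
Proof.
move=> c1; case: (ltgtP u 0) => [u0|u0|->].
- apply: (@near_eq_is_derive _ _ _ ((@powR R ^~ c) \o -%R)).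
    by near=> v; rewrite /= ltr0_norm//; near: v; exact: lt_nbhsl.
  have -> : dnormr_powR c u = (c * (- u) `^ (c - 1)) * -1.
    rewrite /dnormr_powR ltr0_norm// mulrN1 -mulrN; congr (_ * _).
    rewrite -(@mulr_powRB1 _ (- u) (c - 1)) ?oppr_ge0 ?(ltW u0) ?subr_gt0//.
    by rewrite mulNr opprK; congr (_ * _ `^ _); lra.
  have dN : is_derive u 1 (-%R : R -> R) (-1) by exact: is_deriveNid.
  have dp : is_derive (- u) 1 (@powR R ^~ c) (c * (- u) `^ (c - 1)).
    by apply: is_derive1_powR; rewrite oppr_gt0.
  exact: (is_derive1_comp dp dN).
- apply: (@near_eq_is_derive _ _ _ (@powR R ^~ c)).
    by near=> v; rewrite /= gtr0_norm//; near: v; exact: lt_nbhsr.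
  have -> : dnormr_powR c u = c * u `^ (c - 1).
    rewrite /dnormr_powR gtr0_norm//; congr (_ * _).
    rewrite -(@mulr_powRB1 _ u (c - 1)) ?(ltW u0) ?subr_gt0//.
    by congr (_ * _ `^ _); lra.
  exact: is_derive1_powR.
(* At [0] the difference quotient has absolute value [|h|^(c-1)], which tends to [0] because
   [c > 1]. *)
have key : h^-1 *: (`|h| `^ c) @[h --> (0 : R)^'] --> (0 : R).
  apply: norm_cvg0.
  have := @continuous_normr_powR (c - 1) _ 0; rewrite subr_gt0 => /(_ c1).
  rewrite /continuous_at normr0 powR0 ?gt_eqF ?subr_gt0// => h0.
  apply: (@cvg_trans _ (`|h| `^ (c - 1) @[h --> (0 : R)^'])); last first.
    exact: cvg_within_filter h0.
  apply: near_eq_cvg; near=> h.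
  have hn0 : `|h| != 0 by rewrite normr_eq0; near: h; exact: nbhs_dnbhs_neq.
  rewrite /= normrM normfV (ger0_norm (powR_ge0 _ _)).
  by rewrite -(@mulr_powRB1 _ `|h| c) ?mulKf//; lra.
have e : (fun h : R => h^-1 *: (((fun v : R => `|v| `^ c) \o shift (0 : R)) (h *: (1 : R)) - `|0 : R| `^ c)) = (fun h => h^-1 *: (`|h| `^ c)).
  apply/funext => h /=; rewrite addr0 normr0 powR0 ?gt_eqF// ?subr0; last lra.
  by rewrite [h *: 1]mulr1.
have d0 : derivable (fun v : R => `|v| `^ c) 0 1.
  by apply/cvg_ex; exists 0; rewrite e.
split=> //; rewrite /derive e /dnormr_powR mul0r mulr0.
exact: cvg_lim.
Unshelve. all: by end_near. Qed.

End normr_powR.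

(** * Compactly supported functions on the line *)

Section compact_support_line.
Context {R : realType}.
Local Notation leb := (@lebesgue_measure R).
Variables (h h' : R -> R) (M : R).
Hypotheses (dh : forall t : R, is_derive t 1 h (h' t)) (ch' : continuous h')
  (h0 : forall t : R, M < `|t| -> h t = 0).

Let FTC a b : a < b -> (\int[leb]_(t in `[a, b]) (h' t)%:E = (h b - h a)%:E)%E.
Proof.
move=> ab; have ch : continuous h.
  by move=> t; apply: differentiable_continuous; apply/derivable1_diffP; have [] := dh t.
rewrite (@continuous_FTC2 _ h' h)//.
- exact: continuous_subspaceT.
- split.
  + by move=> t _; have [] := dh t.
  + by apply: cvg_at_right_filter; exact: ch.
  + by apply: cvg_at_left_filter; exact: ch.
- by move=> t _; rewrite derive1E; have [_ ->] := dh t.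
Qed.

Let mh' : measurable_fun setT h'.
Proof. exact: continuous_measurable_fun. Qed.

Lemma norm_le_integral_derive t0 : (`|h t0|%:E <= \int[leb]_t `|h' t|%:E)%E.
Proof.
(* A point to the left of [t0] where [h] vanishes, so that [h t0] is the integral of [h'] from [a]
   to [t0]. *)
pose a : R := - `|M| - `|t0| - 1.
have at0 : a < t0 by rewrite /a; have := ler_norm (- t0); rewrite normrN; have := normr_ge0 M; lra.
have ha : h a = 0.
  apply: h0; rewrite /a -!opprD normrN ger0_norm; last by rewrite !addr_ge0.
  by have := ler_norm M; have := normr_ge0 t0; lra.
have := FTC at0; rewrite ha subr0 => /(congr1 abse) /= <-.
apply: le_trans (le_abse_integral _ _ _) _ => //.
  by apply/measurable_EFinP; exact: measurable_funTS.
under eq_integral do rewrite abse_EFin.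
apply: ge0_subset_integral => //.
by apply/measurable_EFinP; exact: measurableT_comp.
Qed.

Lemma integral_derive_eq0 : (\int[leb]_t (h' t)%:E = 0)%E.
Proof.
pose b : R := `|M| + 1.
have bM (t : R) : b <= `|t| -> M < `|t| by rewrite /b; have := ler_norm M; lra.
have b0 : 0 < b by rewrite /b; have := normr_ge0 M; lra.
transitivity (\int[leb]_(t in `[(- b)%R, b]) (h' t)%:E)%E; last first.
  rewrite FTC; last by rewrite gtrN.
  rewrite !h0 ?subrr//.
  - by apply: bM; rewrite normrN ger0_norm// ltW.
  - by apply: bM; rewrite ger0_norm// ltW.
rewrite [RHS]integral_mkcond; apply: eq_integral => t _; rewrite patchE.
case: ifPn => //; rewrite notin_setE/= in_itv/= -ler_norml => /negP; rewrite -ltNge => bt.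
(* Nothing is assumed on the support of [h']: it vanishes here because [h] is zero in a
   neighbourhood of [t]. *)
have [_ <-] := dh t; rewrite (@near_eq_derive _ _ _ h (cst 0)) ?derive_cst ?oner_eq0//.
near=> s; apply: h0; apply: bM; apply: ltW; near: s.
exact: (cvgr_gt _ (@norm_continuous _ _ t)).
Unshelve. all: by end_near. Qed.

End compact_support_line.

(** * Coordinate lines in R^n *)

Section rV_lines.
Context {R : realType}.
Local Notation mu := (lebesgue_rV R).
Local Notation leb := (@lebesgue_measure R).

Lemma rV_setE n (x : 'rV[R]_n) i t : rV_set x i t = (t - x ord0 i) *: delta_mx ord0 i + x.
Proof.
apply/rowP => j; rewrite !mxE eqxx/= eq_sym; case: eqVneq => [->|_].
  by rewrite mulr1 subrK.
by rewrite mulr0 add0r.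
Qed.

Lemma rV_set_shift n (x : 'rV[R]_n) i s t :
  s *: delta_mx ord0 i + rV_set x i t = rV_set x i (s + t).
Proof. by rewrite !rV_setE addrA -scalerDl addrA. Qed.

Lemma continuous_rV_set n (x : 'rV[R]_n) i : continuous (rV_set x i).
Proof.
rewrite (_ : rV_set x i = fun t => (t - x ord0 i) *: delta_mx ord0 i + x); last first.
  by apply/funext => t; exact: rV_setE.
move=> t; apply: cvgD; last exact: cvg_cst.
apply: cvgZr_tmp; apply: cvgB; [exact: cvg_id|exact: cvg_cst].
Qed.

Lemma is_derive_rV_set n (f : 'rV[R]_n -> R) x i t :
  derivable f (rV_set x i t) (delta_mx ord0 i) ->
  is_derive t 1 (fun s => f (rV_set x i s)) (partial i f (rV_set x i t)).
Proof.
move=> df.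
have e : (fun h : R => h^-1 *: (((fun s => f (rV_set x i s)) \o shift t) (h *: (1 : R)) - f (rV_set x i t))) =
    (fun h => h^-1 *: ((f \o shift (rV_set x i t)) (h *: delta_mx ord0 i) - f (rV_set x i t))).
  by apply/funext => h /=; rewrite rV_set_shift [h *: (1 : R)]mulr1.
by split; [rewrite /derivable e|rewrite /partial /derive e].
Qed.

Lemma integrable_bounded_cube n (F : 'rV[R]_n -> R) (B M : R) :
  measurable_fun setT F -> (forall x, `|F x| <= B) ->
  (forall (x : 'rV[R]_n) (i : 'I_n), M < `|x ord0 i| -> F x = 0) ->
  (mu n).-integrable setT (EFin \o F).
Proof.
move=> mF FB F0; apply/integrableP; split; first exact/measurable_EFinP.
pose C := [set x : 'rV[R]_n | forall i : 'I_n, `|x ord0 i| <= M].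
have mC : measurable C.
  apply: (@measurable_rV_box _ _ (fun=> [set t | `|t| <= M])) => i.
  rewrite (_ : [set t | _] = `[- M, M]%classic)//.
  by apply/seteqP; split => t /=; rewrite in_itv/= ler_norml.
have B0 : 0 <= B by apply: le_trans (FB 0).
apply: (@le_lt_trans _ _ (\int[mu n]_x (B%:E * (\1_C x)%:E))%E).
  apply: ge0_le_integral => //.
  - by apply: measurableT_comp => //; exact/measurable_EFinP.
  - by apply: measurable_funeM; exact/measurable_EFinP/measurable_indic.
  - move=> x _ /=; rewrite -EFinM lee_fin indicE; case: (boolP (x \in C)) => [_|].
      by rewrite mulr1.
    rewrite notin_setE => /existsNP[i /negP]; rewrite -ltNge => /F0 ->.
    by rewrite normr0 mulr0.
rewrite ge0_integralZl//; last exact/measurable_EFinP/measurable_indic.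
rewrite integral_indic// setIT lte_mul_pinfty//.
exact: lebesgue_rV_cube_lty.
Qed.

(** Fubini with the [i]-th variable innermost, reached by induction: either it is the first
    variable, or the slices at a fixed first coordinate satisfy the same hypotheses. The bound and
    the cube give the integrability and also pass to slices. *)
Lemma integral_rV_lines_eq0 n (F : 'rV[R]_n -> R) i (B M : R) :
  measurable_fun setT F -> (forall x, `|F x| <= B) ->
  (forall (x : 'rV[R]_n) (i : 'I_n), M < `|x ord0 i| -> F x = 0) ->
  (forall x, \int[leb]_t (F (rV_set x i t))%:E = 0)%E ->
  (\int[mu n]_x (F x)%:E = 0)%E.
Proof.
elim: n F i => [F []//|n IH F i mF FB F0 Fi].
have intF := integrable_bounded_cube mF FB F0.
case: (unliftP ord0 i) Fi => [j ->|->] Fi.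
  rewrite integral_rV1// integral0_eq// => s _.
  apply: (IH (fun y => F (rV_cons (s, y))) j) => //.
  - apply/measurable_EFinP; apply: (@measurable_rV_cons_slice _ _ (EFin \o F)).
    exact/measurable_EFinP.
  - move=> y k yk; apply: (F0 _ (lift ord0 k)).
    by rewrite mxE liftK.
  - by move=> y; rewrite -(Fi (rV_cons (s, y))); under [RHS]eq_integral do rewrite rV_set_consS.
rewrite integral_rV2// integral0_eq// => y _.
by rewrite -(Fi (rV_cons (0, y))); under [RHS]eq_integral do rewrite rV_set_cons0.
Qed.

End rV_lines.

(** * L^s norms on [D] *)

Section lnormD.
Context {R : realType} {n : nat}.
Variables (D : set 'rV[R]_n) (mD : measurable D).
Local Notation mu := (lebesgue_rV R n).
Implicit Types (f g h : 'rV[R]_n -> R) (s : R).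

Lemma LnormDE s f : s != 0 ->
  LnormD D s%:E f = ((\int[mu]_(x in D) (`|f x| `^ s)%:E) `^ s^-1)%E.
Proof.
move=> s0; rewrite /LnormD unlock /= [in RHS]integral_mkcond; congr (poweR _ _).
apply: eq_integral => x _ /=.
by rewrite !patchE; case: ifPn => // _; rewrite normr0 powR0.
Qed.

Lemma poweR_LnormD s f : s != 0 ->
  (LnormD D s%:E f `^ s = \int[mu]_(x in D) (`|f x| `^ s)%:E)%E.
Proof.
move=> s0; rewrite LnormDE// -poweRrM mulVf// poweRe1//.
by apply: integral_ge0 => x _; rewrite lee_fin powR_ge0.
Qed.

Lemma LnormD_ge0 (s : \bar R) f : (0 <= LnormD D s f)%E.
Proof. exact: Lnorm_ge0. Qed.

Lemma measurable_normr_powR s f : measurable_fun D f ->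
  measurable_fun D (fun x => (`|f x| `^ s)%:E).
Proof.
move=> mf; apply/measurable_EFinP; apply: (measurableT_comp (measurable_powR s)).
by apply: measurableT_comp => //; exact: normr_measurable.
Qed.

Lemma integral_normr_powR_ge0 s f : (0 <= \int[mu]_(x in D) (`|f x| `^ s)%:E)%E.
Proof. by apply: integral_ge0 => x _; rewrite lee_fin powR_ge0. Qed.

Lemma le_LnormD s f g : 0 < s -> measurable_fun D f -> measurable_fun D g ->
  (forall x, D x -> `|f x| <= `|g x|) -> (LnormD D s%:E f <= LnormD D s%:E g)%E.
Proof.
move=> s0 mf mg fg; have sn0 : s != 0 by rewrite gt_eqF.
rewrite (LnormDE f sn0) (LnormDE g sn0); apply: le_poweR.
- by rewrite invr_ge0 ltW.
- exact: integral_normr_powR_ge0.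
apply: ge0_le_integral => //.
- exact: measurable_normr_powR.
- exact: measurable_normr_powR.
by move=> x Dx; rewrite lee_fin ge0_ler_powR ?nnegrE ?(ltW s0)//; exact: fg.
Qed.

(** Minkowski's inequality for a dominated function: complex moduli, Euclidean norms and truncations
    are all instances. *)
Lemma LnormD_triangle s f g h : 1 <= s ->
  measurable_fun D f -> measurable_fun D g -> measurable_fun D h ->
  (forall x, D x -> `|f x| <= `|g x| + `|h x|) ->
  (LnormD D s%:E f <= LnormD D s%:E g + LnormD D s%:E h)%E.
Proof.
move=> s1 mf mg mh fgh; have s0 : 0 < s by lra.
have mn (k : 'rV[R]_n -> R) : measurable_fun D k -> measurable_fun D (fun x => `|k x|).
  by move=> mk; apply: measurableT_comp => //; exact: normr_measurable.
apply: (@le_trans _ _ (LnormD D s%:E (fun x => `|g x| + `|h x|))).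
  apply: le_LnormD => //; first by apply: measurable_funD; exact: mn.
  by move=> x Dx; rewrite [leRHS]ger0_norm ?addr_ge0//; exact: fgh.
rewrite /LnormD.
rewrite (_ : (fun x => `|g x| + `|h x|) \_ D =
  ((fun x => `|g x|) \_ D \+ (fun x => `|h x|) \_ D)%R); last first.
  by apply/funext => x /=; rewrite !patchE; case: ifP => // _; rewrite addr0.
apply: le_trans (minkowski_EFin _ _ _ _) _ => //.
- by apply/(measurable_restrictT _ mD); exact: mn.
- by apply/(measurable_restrictT _ mD); exact: mn.
rewrite (_ : (EFin \o _) = abse \o (EFin \o g \_ D)); last first.
  by apply/funext => x /=; rewrite !patchE; case: ifP => //; rewrite normr0.
rewrite (_ : (EFin \o (fun x => `|h x|) \_ D) = abse \o (EFin \o h \_ D)); last first.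
  by apply/funext => x /=; rewrite !patchE; case: ifP => //; rewrite normr0.
by rewrite !Lnorm_abse.
Qed.

End lnormD.

(** * The Sobolev inequality at the critical exponent *)

Section sobolev_real.
Context {R : realType} {m : nat}.
Local Notation n := m.+2.
Local Notation mu := (lebesgue_rV R n).
Local Notation leb := (@lebesgue_measure R).
Variables (p : R) (p1 : 1 < p) (pn : p < n%:R).

Lemma prode_const (k : nat) (x : \bar R) : (0 <= x)%E -> (\prod_(i < k) x = x `^ k%:R)%E.
Proof.
move=> x0; elim: k => [|k IH]; first by rewrite big_ord0 poweRe0.
rewrite big_ord_recl IH -natr1 addrC poweRD ?poweRe1//.
by apply: add_neq0_poweRD_def; rewrite addrC natr1 pnatr_eq0.
Qed.

Lemma lee_prode (I : Type) (s : seq I) (F G : I -> \bar R) :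
  (forall i, 0 <= F i)%E -> (forall i, F i <= G i)%E ->
  (\prod_(i <- s) F i <= \prod_(i <- s) G i)%E.
Proof.
move=> F0 FG; elim: s => [|i s IH]; first by rewrite !big_nil.
by rewrite !big_cons lee_pmul// prode_ge0.
Qed.

(** Cancel [X^((p-1)/p)], which requires [X] finite and nonzero: the exponent left is
    [M/N - (p-1)/p = 1/p - 1/N = 1/pstar]. Then raise to the power [p]. *)
Lemma absorb_power (N M gamma pstar : R) (X Y : \bar R) :
  0 < gamma -> p < N -> N = M + 1 -> 0 < M -> pstar * (N - p) = N * p ->
  (0 <= X)%E -> (X < +oo)%E -> X != 0%E -> (0 <= Y)%E -> Y != +oo%E ->
  (X `^ (M / N) <= gamma%:E * (X `^ ((p - 1) / p) * Y `^ p^-1))%E ->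
  (X `^ (p / pstar) <= (gamma `^ p)%:E * Y)%E.
Proof.
move=> g0 pN NE M0 pstarE; have p0 : 0 < p by exact: lt_trans p1.
case: X => [x|//|//]; case: Y => [y|//|//].
rewrite !poweR_EFin -!EFinM !lee_fin eqe => x0 _ xn0 y0 _ xy.
have xp : 0 < x by rewrite lt0r xn0.
have {}xy : x `^ pstar^-1 <= gamma * y `^ p^-1.
  rewrite -(ler_pM2l (powR_gt0 ((p - 1) / p) xp)) -powRD; last by rewrite xn0 implybT.
  rewrite [leRHS]mulrCA (_ : _ + _ = M / N)//.
  have np : N - p != 0 by rewrite gt_eqF// subr_gt0.
  have -> : pstar^-1 = (N - p) / (N * p).
    by rewrite -pstarE invfM mulrCA mulfV// mulr1.
  have N0 : N != 0 by rewrite gt_eqF// (lt_trans p0).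
  have -> : M = N - 1 by rewrite NE addrK.
  by field; rewrite N0 gt_eqF.
have -> : x `^ (p / pstar) = (x `^ pstar^-1) `^ p by rewrite -powRrM mulrC.
apply: (@le_trans _ _ ((gamma * y `^ p^-1) `^ p)).
  by rewrite ge0_ler_powR ?nnegrE ?powR_ge0 ?mulr_ge0 ?powR_ge0 ?(ltW p0) ?(ltW g0).
by rewrite powRM ?powR_ge0 ?(ltW g0)// -powRrM mulVf ?powRr1 ?gt_eqF.
Qed.

Section estimate.
Variables (f h : 'rV[R]_n -> R) (M B : R).
Hypotheses (cf : continuous f)
  (df : forall x i, derivable f x (delta_mx ord0 i))
  (cdf : forall i, continuous (partial i f))
  (f0 : forall (x : 'rV[R]_n) (i : 'I_n), M < `|x ord0 i| -> f x = 0)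
  (fB : forall x, `|f x| <= B)
  (mh : measurable_fun setT h)
  (dfh : forall i x, `|partial i f x| <= h x).

Variables (gamma pstar : R) (gammaE : gamma * (n%:R - p) = p * (n%:R - 1))
  (pstarE : pstar * (n%:R - p) = n%:R * p).

Let p0 : 0 < p. Proof. exact: lt_trans p1. Qed.

Let gamma1 : 1 < gamma.
Proof.
have np : 0 < n%:R - p by rewrite subr_gt0.
rewrite -(ltr_pM2r np) gammaE mul1r.
have : 0 < (p - 1) * n%:R by rewrite mulr_gt0 ?subr_gt0.
by lra.
Qed.

Let g0 : 0 < gamma. Proof. exact: lt_trans gamma1. Qed.

Let pstar0 : 0 < pstar.
Proof.
have np : 0 < n%:R - p by rewrite subr_gt0.
by rewrite -(pmulr_lgt0 _ np) pstarE mulr_gt0.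
Qed.

Let mf : measurable_fun setT f. Proof. exact: continuous_measurable_rV. Qed.

Let mdf i : measurable_fun setT (partial i f).
Proof. exact: continuous_measurable_rV. Qed.

(** The function [|f|^gamma] is differentiable along lines, also where [f] vanishes, because
    [gamma > 1]. *)
Let line_bound i x : ((`|f x| `^ gamma)%:E <=
  \int[leb]_t (gamma * `|f (rV_set x i t)| `^ (gamma - 1) * `|partial i f (rV_set x i t)|)%:E)%E.
Proof.
pose k t := `|f (rV_set x i t)| `^ gamma.
pose k' t := dnormr_powR gamma (f (rV_set x i t)) * partial i f (rV_set x i t).
have dk (t : R) : is_derive t 1 k (k' t).
  apply: (@is_derive1_comp _ (fun v => `|v| `^ gamma) (fun t => f (rV_set x i t))).
    exact: is_derive_normr_powR.
  exact: is_derive_rV_set.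
have cl (g : 'rV[R]_n -> R) : continuous g -> continuous (fun t => g (rV_set x i t)).
  by move=> cg t; apply: continuous_comp; [exact: continuous_rV_set|exact: cg].
have ck' : continuous k'.
  move=> t; have c1 := cl _ (@cdf i) t.
  have c2 := continuous_comp (cl _ cf t) (@continuous_dnormr_powR _ _ gamma1 (f (rV_set x i t))).
  exact: (continuousM c2 c1).
have k0 (t : R) : M < `|t| -> k t = 0.
  move=> Mt; rewrite /k (f0 (i := i)) ?mxE ?eqxx// normr0 powR0//.
  by rewrite gt_eqF.
have := norm_le_integral_derive dk ck' k0 (x ord0 i).
have -> : k (x ord0 i) = `|f x| `^ gamma.
  by congr (`|f _| `^ _); apply/rowP => j; rewrite mxE; case: eqP => // ->.
rewrite ger0_norm ?powR_ge0// => /le_trans; apply.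
rewrite le_eqVlt; apply/orP; left; apply/eqP; apply: eq_integral => t _.
by rewrite normrM norm_dnormr_powR// gamma1.
Qed.

Let X : \bar R := (\int[mu]_x (`|f x| `^ pstar)%:E)%E.
Let Y : \bar R := (\int[mu]_x (`|h x| `^ p)%:E)%E.

Let h0 x : 0 <= h x.
Proof. by apply: le_trans (dfh ord0 x). Qed.

Let X_lty : (X < +oo)%E.
Proof.
have := @integrable_bounded_cube R n (fun x => `|f x| `^ pstar) (B `^ pstar) M.
move=> /(_ _ _ _)/integrableP[| | |_].
- by apply/measurable_EFinP; apply: measurable_normr_powR.
- move=> x; rewrite ger0_norm ?powR_ge0// ge0_ler_powR ?nnegrE ?(ltW pstar0)//.
  exact: le_trans (fB x).
- by move=> x i Mx; rewrite (f0 Mx) normr0 powR0// gt_eqF.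
by under eq_integral do rewrite /= ger0_norm ?powR_ge0//.
Qed.

Let J_le : (\int[mu]_x (gamma * `|f x| `^ (gamma - 1) * h x)%:E <=
  gamma%:E * (X `^ ((p - 1) / p) * Y `^ p^-1))%E.
Proof.
have e x : ((gamma * `|f x| `^ (gamma - 1) * h x)%:E =
  gamma%:E * ((`|f x| `^ pstar)%:E `^ ((p - 1) / p) * (`|h x| `^ p)%:E `^ p^-1))%E.
  rewrite !poweR_EFin -!EFinM mulrA -!powRrM mulfV ?powRr1 ?gt_eqF//.
  rewrite (ger0_norm (h0 x)); congr (_ * _ `^ _ * _)%:E.
  have -> : gamma - 1 = pstar * ((p - 1) / p).
    have np : n%:R - p != 0 by rewrite gt_eqF// subr_gt0.
    apply: (mulIf np); rewrite mulrBl gammaE mulrAC pstarE mul1r.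
    by field; rewrite gt_eqF.
  by [].
under eq_integral do rewrite e.
have mX : measurable_fun setT (fun x => (`|f x| `^ pstar)%:E) by exact: measurable_normr_powR.
have mY : measurable_fun setT (fun x => (`|h x| `^ p)%:E) by exact: measurable_normr_powR.
rewrite ge0_integralZl//; last 3 first.
- by apply: emeasurable_funM; exact: measurable_fun_poweR.
- by move=> x _; rewrite mule_ge0 ?poweR_ge0.
- by rewrite lee_fin ltW.
apply: lee_wpmul2l; first by rewrite lee_fin ltW.
apply: geometric_hoelder => //.
- by rewrite divr_gt0// subr_gt0.
- by rewrite invr_gt0.
- by field; rewrite gt_eqF.
Qed.

(** Gagliardo-Nirenberg for [|f|^gamma]. The value of [gamma] makes both [gamma * n / (n - 1)],
    produced by that inequality, and [(gamma - 1) * p / (p - 1)], produced by Hoelder, equal to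
    [pstar]. Thus [X] occurs on both sides and can be absorbed. *)
Lemma sobolev_pstar : (X `^ (p / pstar) <= (gamma `^ p)%:E * Y)%E.
Proof.
have m1 : 0 < m.+1%:R :> R by rewrite ltr0n.
have nE : n%:R = m.+1%:R + 1 :> R by rewrite natr1.
have X0 : (0 <= X)%E by exact: integral_normr_powR_ge0.
have Y0 : (0 <= Y)%E by exact: integral_normr_powR_ge0.
have [->|Yoo] := eqVneq Y +oo%E.
  by rewrite gt0_muley ?leey// lte_fin powR_gt0.
have [X00|Xn0] := eqVneq X 0%E.
  by rewrite X00 poweR0r ?mule_ge0 ?lee_fin ?powR_ge0// gt_eqF// divr_gt0.
pose J := (\int[mu]_x (gamma * `|f x| `^ (gamma - 1) * h x)%:E)%E.
have J0 : (0 <= J)%E.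
  by apply: integral_ge0 => x _; rewrite lee_fin !mulr_ge0 ?powR_ge0 ?h0// ltW.
have mfg : measurable_fun setT (fun x => `|f x| `^ (gamma - 1)).
  by apply/measurable_EFinP; apply: measurable_normr_powR.
have mndf i : measurable_fun setT (fun x => `|partial i f x|).
  by apply: measurableT_comp => //; exact: normr_measurable.
(* Each of the [n] factors in the product is at most [J], since [h] dominates every partial
   derivative. *)
have XJ : (X <= J `^ (n%:R / m.+1%:R))%E.
  pose a : R := m.+1%:R^-1; have a0 : 0 < a by rewrite invr_gt0.
  have gi_ge0 i x : (0 <= (gamma * `|f x| `^ (gamma - 1) * `|partial i f x|)%:E)%E.
    by rewrite lee_fin !mulr_ge0 ?powR_ge0// ltW.
  have mgi i : measurable_fun setT (fun x => (gamma * `|f x| `^ (gamma - 1) * `|partial i f x|)%:E).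
    apply/measurable_EFinP; apply: measurable_funM => //.
    by apply: measurable_funM => //; exact: measurable_cst.
  have := gagliardo_nirenberg (measurable_normr_powR gamma mf) _ mgi gi_ge0 line_bound.
  move=> /(_ (fun x => lee_tofin (powR_ge0 _ _))).
  rewrite (_ : (\int[mu]_x _)%E = X); last first.
    apply: eq_integral => x _; rewrite poweR_EFin -powRrM; congr (_ `^ _)%:E.
    have np : n%:R - p != 0 by rewrite gt_eqF// subr_gt0.
    apply: (mulIf np); rewrite mulrAC gammaE pstarE nE.
    by field; rewrite gt_eqF.
  move=> /le_trans; apply.
  apply: (@le_trans _ _ ((\prod_(i < n) J) `^ m.+1%:R^-1)%E); last first.
    by rewrite prode_const// -poweRrM.
  apply: le_poweR; first exact: ltW.
    by apply: prode_ge0 => i; exact: integral_ge0.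
  apply: lee_prode => i; first exact: integral_ge0.
  apply: ge0_le_integral => //.
  - by apply/measurable_EFinP; apply: measurable_funM => //; apply: measurable_funM.
  - by move=> x _; rewrite lee_fin; apply: ler_wpM2l; rewrite ?mulr_ge0 ?powR_ge0// ltW.
have XgY : (X `^ (m.+1%:R / n%:R) <= gamma%:E * (X `^ ((p - 1) / p) * Y `^ p^-1))%E.
  apply: le_trans J_le; rewrite -/J.
  have e1 : n%:R / m.+1%:R * (m.+1%:R / n%:R) = 1 :> R.
    by rewrite mulrA divfK ?mulfV// pnatr_eq0.
  have -> : J = ((J `^ (n%:R / m.+1%:R)) `^ (m.+1%:R / n%:R))%E.
    by rewrite -poweRrM e1 poweRe1.
  by apply: (le_poweR _ X0 XJ); rewrite divr_ge0.
exact: (absorb_power g0 pn nE m1 pstarE X0 X_lty Xn0 Y0 Yoo XgY).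
Qed.

End estimate.

End sobolev_real.

(** * Complex vectors *)

Section complex_norm.
Context {R : realType}.
Local Notation ReC := (@complex.Re R).
Local Notation ImC := (@complex.Im R).
Local Notation normC := (@ComplexField.Normc.normc R).
Implicit Types (x y z : R[i]) (t : R).

Lemma ReCD x y : ReC (x + y) = ReC x + ReC y. Proof. by case: x y => [? ?] [? ?]. Qed.
Lemma ImCD x y : ImC (x + y) = ImC x + ImC y. Proof. by case: x y => [? ?] [? ?]. Qed.
Lemma ReCN x : ReC (- x) = - ReC x. Proof. by case: x. Qed.
Lemma ImCN x : ImC (- x) = - ImC x. Proof. by case: x. Qed.
Lemma ReCM x y : ReC (x * y) = ReC x * ReC y - ImC x * ImC y.
Proof. by case: x y => [? ?] [? ?]. Qed.
Lemma ImCM x y : ImC (x * y) = ReC x * ImC y + ImC x * ReC y.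
Proof. by case: x y => [? ?] [? ?]. Qed.
Lemma ReCJ x : ReC x^*%C = ReC x. Proof. by case: x. Qed.
Lemma ImCJ x : ImC x^*%C = - ImC x. Proof. by case: x. Qed.

Lemma ReC_sum (I : Type) (s : seq I) (F : I -> R[i]) :
  ReC (\sum_(i <- s) F i) = \sum_(i <- s) ReC (F i).
Proof.
elim: s => [|i s IH]; first by rewrite !big_nil.
by rewrite !big_cons ReCD IH.
Qed.

Lemma ImC_sum (I : Type) (s : seq I) (F : I -> R[i]) :
  ImC (\sum_(i <- s) F i) = \sum_(i <- s) ImC (F i).
Proof.
elim: s => [|i s IH]; first by rewrite !big_nil.
by rewrite !big_cons ImCD IH.
Qed.

Lemma normCE z : normC z = Num.sqrt (ReC z ^+ 2 + ImC z ^+ 2).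
Proof. by case: z. Qed.

Lemma normC_ge0 z : 0 <= normC z.
Proof. by rewrite normCE sqrtr_ge0. Qed.

Lemma sqr_normC z : normC z ^+ 2 = ReC z ^+ 2 + ImC z ^+ 2.
Proof. by rewrite normCE sqr_sqrtr// addr_ge0 ?sqr_ge0. Qed.

Lemma normC_triangle x y : normC (x + y) <= normC x + normC y.
Proof. exact: (@le_normcD R). Qed.

Lemma normCJ z : normC z^*%C = normC z.
Proof. by rewrite !normCE ReCJ ImCJ sqrrN. Qed.

Lemma normCN z : normC (- z) = normC z.
Proof. by rewrite !normCE ReCN ImCN !sqrrN. Qed.

Lemma normC_real t : normC t%:C = `|t|.
Proof. by rewrite normCE /= expr0n addr0 sqrtr_sqr. Qed.

Lemma normr_ReC_le z : `|ReC z| <= normC z.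
Proof. by rewrite normCE -sqrtr_sqr ler_sqrt ?lerDl ?addr_ge0 ?sqr_ge0. Qed.

Lemma normr_ImC_le z : `|ImC z| <= normC z.
Proof. by rewrite normCE -sqrtr_sqr ler_sqrt ?lerDr ?addr_ge0 ?sqr_ge0. Qed.

Lemma normC_le_ReIm z : normC z <= `|ReC z| + `|ImC z|.
Proof.
rewrite -ler_sqr ?nnegrE ?normC_ge0 ?addr_ge0// sqr_normC sqrrD !real_normK ?num_real//.
by rewrite addrAC lerDl mulrn_wge0// mulr_ge0.
Qed.

Lemma normC_sum (I : Type) (s : seq I) (F : I -> R[i]) :
  normC (\sum_(i <- s) F i) <= \sum_(i <- s) normC (F i).
Proof.
elim: s => [|i s IH]; first by rewrite !big_nil ComplexField.Normc.normc0.
by rewrite !big_cons; apply: le_trans (normC_triangle _ _) _; rewrite lerD2l.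
Qed.

Lemma normC_eq0 z : (normC z == 0) = (z == 0).
Proof.
apply/eqP/eqP => [/ComplexField.Normc.eq0_normc//|->].
exact: ComplexField.Normc.normc0.
Qed.

End complex_norm.

Section euclidean_norm.
Context {R : realType} {n : nat}.
Local Notation ReC := (@complex.Re R).
Local Notation normC := (@ComplexField.Normc.normc R).
Implicit Types (a b : 'rV[R[i]]_n).

Lemma cauchy_schwarz_sum (x y : 'I_n -> R) :
  \sum_i x i * y i <= Num.sqrt (\sum_i x i ^+ 2) * Num.sqrt (\sum_i y i ^+ 2).
Proof.
set A := \sum_i x i ^+ 2; set B := \sum_i y i ^+ 2.
have A0 : 0 <= A by apply: sumr_ge0 => i _; exact: sqr_ge0.
have B0 : 0 <= B by apply: sumr_ge0 => i _; exact: sqr_ge0.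
have zero (u v : 'I_n -> R) : \sum_i u i ^+ 2 = 0 -> \sum_i u i * v i = 0.
  move/eqP; rewrite psumr_eq0; last by move=> i _; exact: sqr_ge0.
  move=> /allP u0; apply: big1 => i _.
  by have := u0 i (mem_index_enum _); rewrite /= sqrf_eq0 => /eqP ->; rewrite mul0r.
have [A00|An0] := eqVneq A 0; first by rewrite zero// mulr_ge0 ?sqrtr_ge0.
have [B00|Bn0] := eqVneq B 0.
  under eq_bigr do rewrite mulrC.
  by rewrite zero// mulr_ge0 ?sqrtr_ge0.
set u := Num.sqrt A; set v := Num.sqrt B.
have u0 : 0 < u by rewrite sqrtr_gt0 lt0r An0.
have v0 : 0 < v by rewrite sqrtr_gt0 lt0r Bn0.
have uA : u ^+ 2 = A by rewrite sqr_sqrtr.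
have vB : v ^+ 2 = B by rewrite sqr_sqrtr.
(* Weights balanced so that each of the two sums equals [u * v / 2]. *)
apply: (@le_trans _ _ (\sum_i (v / u / 2 * x i ^+ 2 + u / v / 2 * y i ^+ 2))).
  apply: ler_sum => i _; rewrite -subr_ge0.
  rewrite (_ : _ - _ = (v * x i - u * y i) ^+ 2 / (2 * u * v)); last first.
    by field; rewrite !gt_eqF.
  by rewrite divr_ge0 ?sqr_ge0// !mulr_ge0// ltW.
rewrite big_split/= -!mulr_sumr -/A -/B -uA -vB le_eqVlt; apply/orP; left.
by apply/eqP; field; rewrite !gt_eqF.
Qed.

Lemma enorm_ge0 a : 0 <= enorm a.
Proof. exact: sqrtr_ge0. Qed.

Lemma sqr_enorm a : enorm a ^+ 2 = \sum_i normC (a ord0 i) ^+ 2.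
Proof. by rewrite sqr_sqrtr//; apply: sumr_ge0 => i _; exact: sqr_ge0. Qed.

Lemma normC_le_enorm a i : normC (a ord0 i) <= enorm a.
Proof.
rewrite -ler_sqr ?nnegrE ?normC_ge0 ?enorm_ge0// sqr_enorm (bigD1 i)//= lerDl.
by apply: sumr_ge0 => j _; exact: sqr_ge0.
Qed.

Lemma enorm_dot_le a b :
  normC (\sum_i a ord0 i * b ord0 i) <= enorm a * enorm b.
Proof.
apply: le_trans (normC_sum _ _) _.
under eq_bigr do rewrite ComplexField.Normc.normcM.
exact: cauchy_schwarz_sum.
Qed.

Lemma enorm_triangle a b : enorm (a + b) <= enorm a + enorm b.
Proof.
rewrite -ler_sqr ?nnegrE ?enorm_ge0 ?addr_ge0 ?enorm_ge0// sqrrD !sqr_enorm.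
apply: (@le_trans _ _ (\sum_i (normC (a ord0 i) + normC (b ord0 i)) ^+ 2)).
  apply: ler_sum => i _; rewrite ler_sqr ?nnegrE ?normC_ge0 ?addr_ge0 ?normC_ge0//.
  by rewrite mxE normC_triangle.
under eq_bigr do rewrite sqrrD.
rewrite !big_split/= lerD2r lerD2l mulr2n.
by apply: lerD; exact: cauchy_schwarz_sum.
Qed.

Lemma enorm_conj a : enorm (\row_i (a ord0 i)^*%C) = enorm a.
Proof. by congr Num.sqrt; apply: eq_bigr => i _; rewrite mxE normCJ. Qed.

Lemma enormN a : enorm (- a) = enorm a.
Proof. by congr Num.sqrt; apply: eq_bigr => i _; rewrite mxE normCN. Qed.

Lemma enorm0 : enorm (0 : 'rV[R[i]]_n) = 0.
Proof.
by rewrite /enorm big1 ?sqrtr0// => i _; rewrite mxE ComplexField.Normc.normc0 expr0n.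
Qed.

Lemma dot_conj a : \sum_i a ord0 i * (a ord0 i)^*%C = (enorm a ^+ 2)%:C.
Proof.
apply/eqP; rewrite eq_complex ReC_sum ImC_sum sqr_enorm/=; apply/andP; split; apply/eqP.
  by apply: eq_bigr => i _; rewrite ReCM ReCJ ImCJ sqr_normC; ring.
by apply: big1 => i _; rewrite ImCM ReCJ ImCJ; ring.
Qed.

(** True at [x = 0] whatever value [0]^ (p - 2)[has, because]0 [^ (p - 1)] is [0] for [p > 1]. *)
Lemma powR_sub2M (p x : R) : 1 < p -> 0 <= x -> x `^ (p - 2) * x = x `^ (p - 1).
Proof.
move=> p1 x0; rewrite mulrC -[RHS]mulr_powRB1 ?subr_gt0//.
by congr (_ * _ `^ _); lra.
Qed.

Lemma powR_sub2M2 (p x : R) : 1 < p -> 0 <= x -> x `^ (p - 2) * x ^+ 2 = x `^ p.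
Proof.
move=> p1 x0; rewrite mulrA powR_sub2M// mulrC mulr_powRB1//.
exact: lt_trans p1.
Qed.

(** The vector [a] absorbs the singularity of its weight when [p < 2]; every integrability claim
    about the pairing rests on this bound. *)
Lemma enorm_powR_dot_le (p : R) a b : 1 < p ->
  `|enorm a `^ (p - 2) * ReC (\sum_i a ord0 i * (b ord0 i)^*%C)| <= enorm a `^ (p - 1) * enorm b.
Proof.
move=> p1; rewrite normrM (ger0_norm (powR_ge0 _ _)) -(powR_sub2M p1 (enorm_ge0 a)) -mulrA.
rewrite ler_wpM2l ?powR_ge0//; apply: le_trans (normr_ReC_le _) _.
rewrite -(enorm_conj b).
by apply: le_trans (enorm_dot_le _ _); under [in leRHS]eq_bigr do rewrite mxE.
Qed.

Lemma normC_powR_dot_le (p : R) (x y : R[i]) : 1 < p ->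
  `|normC x `^ (p - 2) * ReC (x * y^*%C)| <= normC x `^ (p - 1) * normC y.
Proof.
move=> p1; rewrite normrM (ger0_norm (powR_ge0 _ _)) -(powR_sub2M p1 (normC_ge0 x)) -mulrA.
rewrite ler_wpM2l ?powR_ge0//; apply: le_trans (normr_ReC_le _) _.
by rewrite ComplexField.Normc.normcM normCJ.
Qed.

(** Convexity of [|.|^p] without derivatives: [|a|^(p-2) Re <a, a + b>] is at most
    [|a|^(p-1) |a + b|] by Cauchy-Schwarz, and Young's inequality bounds this by
    [(p-1)/p |a|^p + 1/p |a + b|^p]. *)
Lemma enorm_powR_tangent (p : R) a b : 1 < p ->
  enorm a `^ p + p * (enorm a `^ (p - 2) * ReC (\sum_i a ord0 i * (b ord0 i)^*%C)) <=
  enorm (a + b) `^ p.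
Proof.
move=> p1; have p0 : 0 < p by exact: lt_trans p1.
have a0 := enorm_ge0 a; have ab0 := enorm_ge0 (a + b).
set A := enorm a in a0 *; set B := enorm (a + b) in ab0 *.
set S := ReC _.
have SE : A ^+ 2 + S <= A * B.
  have -> : A ^+ 2 + S = ReC (\sum_i a ord0 i * ((a + b) ord0 i)^*%C).
    have -> : A ^+ 2 = ReC (A ^+ 2)%:C by [].
    rewrite -dot_conj -ReCD -big_split/=; congr ReC; apply: eq_bigr => i _.
    by rewrite mxE -mulrDr; congr (_ * _); case: (a _ _) (b _ _) => [? ?] [? ?] /=; congr Complex; lra.
  apply: le_trans (ler_norm _) _; apply: le_trans (normr_ReC_le _) _.
  rewrite -/B /B -(enorm_conj (a + b)).
  apply: le_trans (enorm_dot_le a _); under [in leRHS]eq_bigr do rewrite mxE.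
  exact: lexx.
have young : A `^ (p - 1) * B <= (p - 1) / p * A `^ p + p^-1 * B `^ p.
  have := @conjugate_powR _ (A `^ (p - 1)) B (p / (p - 1)) p (powR_ge0 _ _) ab0.
  rewrite divr_gt0 ?subr_gt0// => /(_ isT p0).
  have p10 : p - 1 != 0 by rewrite gt_eqF// subr_gt0.
  have -> : (p / (p - 1))^-1 + p^-1 = 1 by field; rewrite p10 gt_eqF.
  move=> /(_ erefl) /le_trans; apply; rewrite -powRrM.
  have -> : (p - 1) * (p / (p - 1)) = p by field.
  by rewrite invf_div mulrC [B `^ p / p]mulrC.
have pA : A `^ (p - 2) * (A ^+ 2 + S) <= A `^ (p - 1) * B.
  by rewrite -(@powR_sub2M p)// -mulrA ler_wpM2l ?powR_ge0.
have {young pA} := le_trans pA young.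
rewrite mulrDr powR_sub2M2// -(ler_pM2l p0) !mulrDr !mulrA mulfV ?gt_eqF// mul1r.
by rewrite (_ : p * (p - 1) / p = p - 1); [lra|field; rewrite gt_eqF].
Qed.

End euclidean_norm.

(** * Test functions *)

Section smooth_functions.
Context {R : realType} {n : nat}.
Implicit Types (f g : 'rV[R]_n -> R) (C : set 'rV[R]_n).

Lemma smooth_continuous f : smooth f -> continuous f.
Proof. by move=> /(_ [::])[]. Qed.

Lemma smooth_derivable f x i : smooth f -> derivable f x (delta_mx ord0 i).
Proof. by move=> /(_ [::])[_]; exact. Qed.

Lemma smooth_partial f i : smooth f -> smooth (partial i f).
Proof.
move=> sf l; have := sf (rcons l i).
by rewrite foldr_rcons.
Qed.

Lemma smooth_continuous_partial f i : smooth f -> continuous (partial i f).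
Proof. by move=> sf; apply: smooth_continuous; exact: smooth_partial. Qed.

Lemma smoothD f g : smooth f -> smooth g -> smooth (f + g).
Proof.
move=> sf sg l; have -> : foldr partial (f + g) l = foldr partial f l + foldr partial g l.
  elim: l => // i l IH; rewrite [LHS]/= IH; apply/funext => x; rewrite /partial deriveD//.
    by have [_] := sf l; exact.
  by have [_] := sg l; exact.
have [cf df] := sf l; have [cg dg] := sg l; split; last by move=> i x; exact: derivableD.
by move=> x; apply: continuousD; [exact: cf|exact: cg].
Qed.

Lemma smoothZ f (c : R) : smooth f -> smooth (c *: f).
Proof.
move=> sf l; have -> : foldr partial (c *: f) l = c *: foldr partial f l.
  elim: l => // i l IH; rewrite [LHS]/= IH; apply/funext => x; rewrite /partial deriveZ//.
  by have [_] := sf l; exact.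
have [cf df] := sf l; split; last by move=> i x; exact: derivableZ.
by move=> x; apply: continuousM; [exact: cst_continuous|exact: cf].
Qed.

Lemma partialD f g i x : smooth f -> smooth g ->
  partial i (f + g) x = partial i f x + partial i g x.
Proof. by move=> sf sg; rewrite /partial deriveD//; exact: smooth_derivable. Qed.

Lemma partialZ f (c : R) i x : smooth f -> partial i (c *: f) x = c * partial i f x.
Proof. by move=> sf; rewrite /partial deriveZ//; exact: smooth_derivable. Qed.

Lemma partial_eq0_out f i C x : closed C -> (forall x, ~ C x -> f x = 0) ->
  ~ C x -> partial i f x = 0.
Proof.
move=> cC f0 Cx; rewrite /partial (@near_eq_derive _ _ _ f (cst 0)) ?derive_cst//.
  have oC : open (~` C) by exact: closed_openC.
  by near=> y; apply: f0; near: y; exact: open_nbhs_nbhs.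
Unshelve. all: by end_near. Qed.

Lemma continuous_compact_support_bounded f C : continuous f -> compact C ->
  (forall x, ~ C x -> f x = 0) -> exists B, forall x, `|f x| <= B.
Proof.
move=> cf cC f0.
have : compact (f @` C) by apply: continuous_compact => //; exact: continuous_subspaceT.
move=> /compact_bounded [M [_ /(_ (`|M| + 1))]].
rewrite (le_lt_trans (ler_norm M)) ?ltrDl// => /(_ isT) fM.
exists (`|M| + 1) => x; have [Cx|/f0 ->] := pselect (C x); first by apply: fM; exists x.
by rewrite normr0 addr_ge0.
Qed.

Lemma compact_cube C : compact C -> exists M, forall (x : 'rV[R]_n) (i : 'I_n), M < `|x ord0 i| -> ~ C x.
Proof.
move=> /compact_bounded [M [_ /(_ (`|M| + 1))]].
rewrite (le_lt_trans (ler_norm M)) ?ltrDl// => /(_ isT) CM.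
exists (`|M| + 1) => x i Mx /CM /= xM.
have : `|x ord0 i| <= `|x|.
  rewrite [leRHS]/Num.norm/= mx_normrE.
  exact: (le_bigmax _ (fun ij : 'I_1 * 'I_n => `|x ij.1 ij.2|) (ord0, i)).
by move=> /le_trans => /(_ _ xM); rewrite leNgt Mx.
Qed.

End smooth_functions.

Section test_functions.
Context {R : realType} {n : nat}.
Variable D : set 'rV[R]_n.
Local Notation ReC := (@complex.Re R).
Local Notation ImC := (@complex.Im R).
Local Notation supp psi := (closure [set x | psi x != 0]).
Implicit Types (psi phi : 'rV[R]_n -> R[i]).

Lemma supp_out psi x : ~ supp psi x -> psi x = 0.
Proof. by move=> sx; apply: contra_notP sx => /eqP p0; exact: (@subset_closure _ [set x | psi x != 0] x p0). Qed.

Lemma cpartial_out psi x i : ~ supp psi x -> cpartial i psi x = 0.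
Proof.
move=> sx; rewrite /cpartial !(@partial_eq0_out _ _ _ _ (supp psi)) //.
- exact: closed_closure.
- by move=> y /supp_out /= ->.
- exact: closed_closure.
- by move=> y /supp_out /= ->.
Qed.

(** The last hypothesis places the support of [chi] in the union of the two supports. Taking
    [phi = psi] covers the operations on a single test function. *)
Lemma test_function_comb psi phi chi :
  test_function D psi -> test_function D phi ->
  smooth (ReC \o chi) -> smooth (ImC \o chi) ->
  (forall x, psi x = 0 -> phi x = 0 -> chi x = 0) -> test_function D chi.
Proof.
move=> [_ _ c1 s1] [_ _ c2 s2] sR sI chi0.
have sub : supp chi `<=` supp psi `|` supp phi.
  rewrite -closureU; apply: closure_subset => x /= cx.
  by apply: contra_notP (negP cx) => /not_orP[/negP/negPn/eqP p0 /negP/negPn/eqP q0]; rewrite chi0.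
split => //.
- apply: (subclosed_compact _ (compactU c1 c2)) => //; exact: closed_closure.
- by move=> x /sub [/s1|/s2].
Qed.

Lemma test_functionD psi phi : test_function D psi -> test_function D phi ->
  test_function D (fun x => psi x + phi x).
Proof.
move=> tp tq; have [sp1 sp2 _ _] := tp; have [sq1 sq2 _ _] := tq.
apply: (test_function_comb tp tq).
- by rewrite (_ : _ \o _ = (ReC \o psi) + (ReC \o phi)); [exact: smoothD|apply/funext => x; exact: ReCD].
- by rewrite (_ : _ \o _ = (ImC \o psi) + (ImC \o phi)); [exact: smoothD|apply/funext => x; exact: ImCD].
- by move=> x -> ->; rewrite addr0.
Qed.

Lemma cpartialD psi phi i x : test_function D psi -> test_function D phi ->
  cpartial i (fun x => psi x + phi x) x = cpartial i psi x + cpartial i phi x.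
Proof.
move=> [sp1 sp2 _ _] [sq1 sq2 _ _]; rewrite /cpartial.
rewrite (_ : ReC \o _ = (ReC \o psi) + (ReC \o phi)); last by apply/funext => y; exact: ReCD.
rewrite (_ : ImC \o _ = (ImC \o psi) + (ImC \o phi)); last by apply/funext => y; exact: ImCD.
by rewrite !partialD.
Qed.

Lemma test_functionZ psi (c : R) : test_function D psi ->
  test_function D (fun x => c%:C * psi x).
Proof.
move=> tp; have [sp1 sp2 _ _] := tp; apply: (test_function_comb tp tp).
- rewrite (_ : _ \o _ = c *: (ReC \o psi)); first exact: smoothZ.
  by apply/funext => x; rewrite /= ReCM/= mul0r subr0.
- rewrite (_ : _ \o _ = c *: (ImC \o psi)); first exact: smoothZ.
  by apply/funext => x; rewrite /= ImCM/= mul0r addr0.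
- by move=> x -> _; rewrite mulr0.
Qed.

Lemma cpartialZ psi (c : R) i x : test_function D psi ->
  cpartial i (fun x => c%:C * psi x) x = c%:C * cpartial i psi x.
Proof.
move=> [sp1 sp2 _ _]; rewrite /cpartial.
rewrite (_ : ReC \o _ = c *: (ReC \o psi)); last first.
  by apply/funext => y; rewrite /= ReCM/= mul0r subr0.
rewrite (_ : ImC \o _ = c *: (ImC \o psi)); last first.
  by apply/funext => y; rewrite /= ImCM/= mul0r addr0.
by rewrite !partialZ//; apply/eqP; rewrite eq_complex ReCM ImCM/= !mul0r subr0 addr0 !eqxx.
Qed.

Lemma smoothN (f : 'rV[R]_n -> R) : smooth f -> smooth (- f).
Proof. by move=> sf; rewrite -scaleN1r; exact: smoothZ. Qed.

Lemma partialN (f : 'rV[R]_n -> R) i x : smooth f -> partial i (- f) x = - partial i f x.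
Proof. by move=> sf; rewrite -scaleN1r partialZ// mulN1r. Qed.

Lemma test_function_conj psi : test_function D psi ->
  test_function D (fun x => (psi x)^*%C).
Proof.
move=> tp; have [sp1 sp2 _ _] := tp; apply: (test_function_comb tp tp).
- by rewrite (_ : _ \o _ = ReC \o psi)//; apply/funext => x; exact: ReCJ.
- by rewrite (_ : _ \o _ = - (ImC \o psi)); [exact: smoothN|apply/funext => x; exact: ImCJ].
- by move=> x -> _; rewrite rmorph0.
Qed.

Lemma cpartial_conj psi i x : test_function D psi ->
  cpartial i (fun x => (psi x)^*%C) x = (cpartial i psi x)^*%C.
Proof.
move=> [sp1 sp2 _ _]; rewrite /cpartial.
rewrite (_ : ReC \o _ = (ReC \o psi)); last by apply/funext => y; exact: ReCJ.
rewrite (_ : ImC \o _ = - (ImC \o psi)); last by apply/funext => y; exact: ImCJ.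
by rewrite partialN.
Qed.

Lemma test_function_mulNi psi : test_function D psi ->
  test_function D (fun x => - 'i%C * psi x).
Proof.
move=> tp; have [sp1 sp2 _ _] := tp; apply: (test_function_comb tp tp).
- rewrite (_ : _ \o _ = ImC \o psi)//; apply/funext => x /=.
  by rewrite ReCM/= oppr0 mul0r sub0r mulN1r opprK.
- rewrite (_ : _ \o _ = - (ReC \o psi)); first exact: smoothN.
  by apply/funext => x /=; rewrite ImCM/= oppr0 mul0r add0r mulN1r.
- by move=> x -> _; rewrite mulr0.
Qed.

Lemma cpartial_mulNi psi i x : test_function D psi ->
  cpartial i (fun x => - 'i%C * psi x) x = - 'i%C * cpartial i psi x.
Proof.
move=> [sp1 sp2 _ _]; rewrite /cpartial.
rewrite (_ : ReC \o _ = (ImC \o psi)); last first.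
  by apply/funext => y; rewrite /= ReCM/= oppr0 mul0r sub0r mulN1r opprK.
rewrite (_ : ImC \o (fun x => - 'i%C * psi x) = - (ReC \o psi)); last first.
  by apply/funext => y; rewrite /= ImCM/= oppr0 mul0r add0r mulN1r.
rewrite partialN//; apply/eqP; rewrite eq_complex ReCM ImCM/= oppr0 !mul0r sub0r add0r !mulN1r opprK.
by rewrite !eqxx.
Qed.

Lemma test_function_cpartial psi i : test_function D psi -> test_function D (cpartial i psi).
Proof.
move=> tp; have [sp1 sp2 cs sD] := tp.
have sub : supp (cpartial i psi) `<=` supp psi.
  rewrite closureE; apply: smallest_sub; first exact: closed_closure.
  by move=> x /= /eqP; apply: contra_notP => /cpartial_out; exact.
split; [exact: (smooth_partial i sp1)|exact: (smooth_partial i sp2)| |].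
- exact: (subclosed_compact (@closed_closure _ _) cs sub).
- by move=> x /sub /sD.
Qed.

End test_functions.

(** * Measurability of complex functions *)

Section complex_measurability.
Context {R : realType} {n : nat}.
Variables (D : set 'rV[R]_n).
Local Notation ReC := (@complex.Re R).
Local Notation ImC := (@complex.Im R).
Local Notation normC := (@ComplexField.Normc.normc R).
Implicit Types (u v psi : 'rV[R]_n -> R[i]) (f : 'rV[R]_n -> R).

Lemma measurable_sqrt_fun f : measurable_fun D f ->
  measurable_fun D (fun x => Num.sqrt (f x)).
Proof.
move=> mf; apply: (measurableT_comp _ mf); apply: continuous_measurable_fun.
exact: sqrt_continuous.
Qed.

Lemma measurable_normC u : cmeasurable D u -> measurable_fun D (normC \o u).
Proof.
move=> [m1 m2]; rewrite (_ : normC \o u = fun x => Num.sqrt (ReC (u x) ^+ 2 + ImC (u x) ^+ 2)); last first.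
  by apply/funext => x /=; rewrite normCE.
by apply: measurable_sqrt_fun; apply: measurable_funD; exact: measurable_funX.
Qed.

Lemma measurable_enorm (g : 'rV[R]_n -> 'rV[R[i]]_n) :
  (forall i, cmeasurable D (fun x => g x ord0 i)) -> measurable_fun D (enorm \o g).
Proof.
move=> mg; apply: (measurable_sqrt_fun (f := fun x => \sum_i normC (g x ord0 i) ^+ 2)).
apply: measurable_sum => i; apply: measurable_funX; exact: (measurable_normC (mg i)).
Qed.

Lemma cmeasurableD u v : cmeasurable D u -> cmeasurable D v ->
  cmeasurable D (fun x => u x + v x).
Proof.
move=> [u1 u2] [v1 v2]; split.
- rewrite (_ : _ \o _ = (ReC \o u) \+ (ReC \o v)); first exact: measurable_funD.
  by apply/funext => x; exact: ReCD.
- rewrite (_ : _ \o _ = (ImC \o u) \+ (ImC \o v)); first exact: measurable_funD.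
  by apply/funext => x; exact: ImCD.
Qed.

Lemma cmeasurableM u v : cmeasurable D u -> cmeasurable D v ->
  cmeasurable D (fun x => u x * v x).
Proof.
move=> [u1 u2] [v1 v2]; split.
- rewrite (_ : _ \o _ = (ReC \o u) \* (ReC \o v) \- (ImC \o u) \* (ImC \o v)).
    by apply: measurable_funB; exact: measurable_funM.
  by apply/funext => x; exact: ReCM.
- rewrite (_ : _ \o _ = (ReC \o u) \* (ImC \o v) \+ (ImC \o u) \* (ReC \o v)).
    by apply: measurable_funD; exact: measurable_funM.
  by apply/funext => x; exact: ImCM.
Qed.

Lemma cmeasurable_real f : measurable_fun D f -> cmeasurable D (fun x => (f x)%:C).
Proof. by move=> mf; split => //; exact: measurable_cst. Qed.

Lemma cmeasurable_conj u : cmeasurable D u -> cmeasurable D (fun x => (u x)^*%C).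
Proof.
move=> [u1 u2]; split.
- by rewrite (_ : _ \o _ = ReC \o u)//; apply/funext => x; exact: ReCJ.
- rewrite (_ : _ \o _ = \- (ImC \o u)); first exact: measurable_funN.
  by apply/funext => x; exact: ImCJ.
Qed.

Lemma cmeasurable_sum (I : Type) (s : seq I) (F : I -> 'rV[R]_n -> R[i]) :
  (forall i, cmeasurable D (F i)) -> cmeasurable D (fun x => \sum_(i <- s) F i x).
Proof.
move=> mF; elim: s => [|i s IH].
  have -> : (fun x => \sum_(i <- [::]) F i x) = fun=> (0 : R)%:C.
    by apply/funext => x; rewrite big_nil.
  by apply: cmeasurable_real; exact: measurable_cst.
have -> : (fun x => \sum_(j <- i :: s) F j x) = fun x => F i x + \sum_(j <- s) F j x.
  by apply/funext => x; rewrite big_cons.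
exact: cmeasurableD.
Qed.

Lemma cmeasurable_test psi E : test_function E psi -> measurable D -> cmeasurable D psi.
Proof.
move=> [s1 s2 _ _] mD; split; apply: (measurable_funS _ (@subsetT _ D)) => //;
  by apply: continuous_measurable_rV; exact: smooth_continuous.
Qed.

Lemma cmeasurable_cpartial psi E i : test_function E psi -> measurable D -> cmeasurable D (cpartial i psi).
Proof. by move=> /(test_function_cpartial i)/cmeasurable_test; exact. Qed.

Lemma cmeasurable_cgradient psi E i : test_function E psi -> measurable D ->
  cmeasurable D (fun x => cgradient psi x ord0 i).
Proof.
move=> tp mD; rewrite (_ : (fun x => _) = cpartial i psi); first exact: cmeasurable_cpartial tp mD.
by apply/funext => x; rewrite mxE.
Qed.

End complex_measurability.

(** * The Sobolev inequality below the critical exponent *)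

Section sobolev_subcritical.
Context {R : realType} {m : nat}.
Local Notation n := m.+2.
Local Notation mu := (lebesgue_rV R n).
Local Notation ReC := (@complex.Re R).
Local Notation ImC := (@complex.Im R).
Local Notation normC := (@ComplexField.Normc.normc R).
Variables (p q : R) (p1 : 1 < p) (pn : p < n%:R) (q1 : 1 <= q).
Hypothesis qpn : q * (n%:R - p) < n%:R * p.
Variables (D : set 'rV[R]_n) (mD : measurable D) (Doo : (mu D < +oo)%E).

Let pstar := n%:R * p / (n%:R - p).
Let gamma := p * (n%:R - 1) / (n%:R - p).

Let p0 : 0 < p. Proof. exact: lt_trans p1. Qed.
Let q0 : 0 < q. Proof. exact: lt_le_trans q1. Qed.
Let np : 0 < n%:R - p. Proof. by rewrite subr_gt0. Qed.

Let qpstar : q < pstar. Proof. by rewrite /pstar ltr_pdivlMr. Qed.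
Let pstar0 : 0 < pstar. Proof. exact: lt_trans qpstar. Qed.

Let gamma0 : 0 <= gamma.
Proof. by rewrite divr_ge0 ?(ltW np)// mulr_ge0 ?(ltW p0)// subr_ge0 ler1n. Qed.

(** The factor [gamma] comes from the critical inequality; the power of the measure of [D], with
    exponent [1/q - 1/pstar], from Hoelder's inequality between L^q and L^pstar on [D]. *)
Let Cst : R := gamma * fine (mu D) `^ ((1 - q / pstar) / q).

Lemma sobolev_test_real (f h : 'rV[R]_n -> R) C :
  smooth f -> compact C -> C `<=` D -> (forall x, ~ C x -> f x = 0) ->
  measurable_fun D h -> (forall i x, D x -> `|partial i f x| <= h x) ->
  (LnormD D q%:E f <= Cst%:E * LnormD D p%:E h)%E.
Proof.
move=> sf cC CD f0 mh dfh.
have cf := smooth_continuous sf.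
have mf : measurable_fun setT f by exact: continuous_measurable_rV.
have mfD : measurable_fun D f by exact: measurable_funTS.
have [B fB] := continuous_compact_support_bounded cf cC f0.
have [M CM] := compact_cube cC.
have closC : closed C by apply: compact_closed => //; exact: norm_hausdorff.
have mhD : measurable_fun setT (h \_ D) by apply/(measurable_restrictT _ mD).
(* The critical inequality lives on all of R^n: [h] is extended by [0], which still dominates
   because the derivatives vanish outside the support. *)
have dfhD i x : `|partial i f x| <= (h \_ D) x.
  rewrite patchE; case: ifPn => [/set_mem/(dfh i)//|/negP Dx].
  by rewrite (partial_eq0_out i closC f0) ?normr0// => /CD /mem_set.
have := @sobolev_pstar R m p p1 pn f (h \_ D) M B cf
  (fun x i => @smooth_derivable _ _ _ x i sf) (fun i => @smooth_continuous_partial _ _ _ i sf)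
  (fun x i Mx => f0 x (CM x i Mx)) fB mhD dfhD gamma pstar.
rewrite /gamma /pstar !divfK ?gt_eqF// => /(_ erefl erefl).
rewrite -/gamma -/pstar.
set X := (\int[mu]_x (`|f x| `^ pstar)%:E)%E.
have X0 : (0 <= X)%E by exact: integral_normr_powR_ge0.
rewrite (_ : (\int[mu]_x _)%E = LnormD D p%:E h `^ p)%E; last first.
  rewrite (poweR_LnormD D h (lt0r_neq0 p0)) [RHS]integral_mkcond; apply: eq_integral => x _.
  by rewrite !patchE; case: ifP => // _; rewrite normr0 powR0 ?gt_eqF.
move=> XY.
have XD : (\int[mu]_(x in D) (`|f x| `^ pstar)%:E <= X)%E.
  by apply: ge0_subset_integral => //; exact: measurable_normr_powR.
pose a := q / pstar; have a0 : 0 < a by rewrite divr_gt0.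
pose b := 1 - a; have b0 : 0 < b by rewrite subr_gt0 /a ltr_pdivrMr// mul1r.
have ab : a + b = 1 by rewrite /b addrC subrK.
have H : (\int[mu]_(x in D) (`|f x| `^ q)%:E <= X `^ a * (mu D) `^ b)%E.
  rewrite (_ : (\int[mu]_(x in D) _)%E = (\int[mu]_(x in D) ((`|f x| `^ pstar)%:E `^ a * 1 `^ b))%E); last first.
    apply: eq_integral => x _; rewrite poweR1r mule1 poweR_EFin -powRrM /a.
    by rewrite mulrC divfK// gt_eqF.
  apply: le_trans (geometric_hoelder mu mD a0 b0 ab (measurable_normr_powR _ mfD) _ _ _) _ => //.
  rewrite integral_cst// mul1e; apply: lee_wpmul2r; first exact: poweR_ge0.
  by apply: le_poweR (ltW a0) _ XD; exact: integral_normr_powR_ge0.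
rewrite LnormDE ?gt_eqF//.
apply: (@le_trans _ _ ((X `^ a * mu D `^ b) `^ q^-1)%E).
  apply: (le_poweR _ _ H); first by rewrite invr_ge0 ltW.
  exact: integral_normr_powR_ge0.
have -> : ((X `^ a * mu D `^ b) `^ q^-1 = (X `^ (p / pstar)) `^ p^-1 * ((fine (mu D)) `^ (b / q))%:E)%E.
  rewrite poweRM ?poweR_ge0// -!poweRrM -[in LHS](@fineK _ (mu D)); last first.
    by rewrite ge0_fin_numE.
  rewrite poweR_EFin; congr (_ `^ _ * _)%E.
  by rewrite /a; field; rewrite !gt_eqF.
rewrite /Cst EFinM muleAC; apply: lee_wpmul2r; first by rewrite lee_fin powR_ge0.
apply: (@le_trans _ _ (((gamma `^ p)%:E * LnormD D p%:E h `^ p) `^ p^-1)%E).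
  by apply: le_poweR XY; rewrite ?invr_ge0 ?(ltW p0)// poweR_ge0.
rewrite poweRM ?poweR_ge0 ?lee_fin ?powR_ge0// -poweR_EFin -!poweRrM mulfV ?gt_eqF//.
by rewrite !poweRe1// ?LnormD_ge0// lee_fin.
Qed.

(** The real and imaginary parts are each estimated against the full gradient, hence the factor
    [2]. *)
Lemma sobolev_test psi : test_function D psi ->
  (cLnormD D q%:E psi <= (2 * Cst)%:E * LnormD D p%:E (enorm \o cgradient psi))%E.
Proof.
move=> tp; have [s1 s2 cC CD] := tp.
have mpsi := cmeasurable_test tp mD.
have mg := measurable_enorm (fun i => cmeasurable_cgradient i tp mD).
have part i x : normC (cpartial i psi x) <= enorm (cgradient psi x).
  by have := normC_le_enorm (cgradient psi x) i; rewrite mxE.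
apply: (@le_trans _ _ (LnormD D q%:E (ReC \o psi) + LnormD D q%:E (ImC \o psi))%E).
  apply: LnormD_triangle => //; first exact: measurable_normC.
  - by case: mpsi.
  - by case: mpsi.
  - by move=> x _; rewrite ger0_norm ?normC_ge0// normC_le_ReIm.
have Cst0 : (0 <= Cst%:E)%E by rewrite lee_fin mulr_ge0// powR_ge0.
rewrite mulr_natl mulr2n EFinD ge0_muleDl//.
apply: leeD.
- apply: (sobolev_test_real s1 cC CD _ mg).
    by move=> x /supp_out /= ->.
  by move=> i x _; apply: le_trans (part i x); exact: (normr_ReC_le (cpartial i psi x)).
- apply: (sobolev_test_real s2 cC CD _ mg).
    by move=> x /supp_out /= ->.
  by move=> i x _; apply: le_trans (part i x); exact: (normr_ImC_le (cpartial i psi x)).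
Qed.

End sobolev_subcritical.

(** * The space W_0^{1,p} and the Sobolev constant *)

Section limits.
Context {R : realType}.
Implicit Types (a b : (\bar R)^nat).

Lemma near_lt_cvg0 a (e : R) : 0 < e -> a k @[k --> \oo] --> 0%E ->
  \forall k \near \oo, (a k < e%:E)%E.
Proof. by move=> e0 a0; exact: (a0 _ (open_ereal_lt' (_ : (0 < e%:E)%E))). Qed.

(** The error has the two shapes needed later: linear in the gradient error, and a power of the L^p
    error, as truncation produces. *)
Lemma le_of_cvg0 (L L0 : \bar R) a b (c d s : R) : 0 <= c -> 0 <= d -> 0 < s ->
  (forall k, 0 <= b k)%E -> a k @[k --> \oo] --> 0%E -> b k @[k --> \oo] --> 0%E ->
  (forall k, L <= L0 + (c%:E * a k + d%:E * b k `^ s))%E -> (L <= L0)%E.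
Proof.
move=> c0 d0 s0 bge0 a0 b0 H; apply/lee_addgt0Pr => e e0.
(* Dividing by [c + 1] and [d + 1] allows zero coefficients. *)
pose e1 := e / 2 / (c + 1); have e10 : 0 < e1 by rewrite !divr_gt0// ltr_wpDl.
pose e2 := (e / 2 / (d + 1)) `^ s^-1.
have e20 : 0 < e2 by rewrite powR_gt0// !divr_gt0// ltr_wpDl.
have near_k : \forall k \near \oo, (a k < e1%:E)%E /\ (b k < e2%:E)%E.
  by apply: filterI; exact: near_lt_cvg0.
have [k [ak bk]] := @filter_ex _ _ _ _ near_k.
apply: le_trans (H k) _; rewrite leeD2l//.
rewrite [e]splitr EFinD; apply: leeD.
  apply: (@le_trans _ _ (c%:E * e1%:E)%E); first by rewrite lee_wpmul2l ?lee_fin// ltW.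
  rewrite -EFinM lee_fin /e1 mulrCA ler_piMr ?divr_ge0 ?(ltW e0)//.
  by rewrite ler_pdivrMr ?mul1r ?lerDl// ltr_wpDl.
apply: (@le_trans _ _ (d%:E * (e2%:E `^ s))%E).
  by rewrite lee_wpmul2l ?lee_fin//; apply: le_poweR (bge0 k) (ltW bk); exact: ltW.
rewrite poweR_EFin -EFinM lee_fin /e2 -powRrM mulVf ?gt_eqF// powRr1; last first.
  by rewrite !divr_ge0 ?(ltW e0)// addr_ge0.
rewrite mulrCA ler_piMr ?divr_ge0 ?(ltW e0)//.
by rewrite ler_pdivrMr ?mul1r ?lerDl// ltr_wpDl.
Qed.

End limits.

(** * Passing to the limit by truncation *)

Section truncation.
Context {R : realType} {n : nat}.
Local Notation mu := (lebesgue_rV R n).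
Variables (D : set 'rV[R]_n) (mD : measurable D).
Variables (p q : R) (p1 : 1 < p) (pq : p <= q).
Local Notation normC := (@ComplexField.Normc.normc R).
Implicit Types (f : 'rV[R]_n -> R).

Let p0 : 0 < p. Proof. exact: lt_trans p1. Qed.
Let q0 : 0 < q. Proof. exact: lt_le_trans pq. Qed.

(** Pointwise, [min(f, T)^q <= T^(q-p) f^p]: smallness in L^p gives smallness in L^q of a function
    truncated at a fixed level. *)
Lemma LnormD_min_le f (T : R) : 0 < T -> measurable_fun D f -> (forall x, 0 <= f x) ->
  (LnormD D q%:E (fun x => Num.min (f x) T)%R <= (T `^ ((q - p) / q))%:E * LnormD D p%:E f `^ (p / q))%E.
Proof.
move=> T0 mf f0.
have mT : measurable_fun D (fun x => Num.min (f x) T).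
  by apply: measurable_minr => //; exact: measurable_cst.
rewrite (LnormDE D _ (lt0r_neq0 q0)) [in leRHS]poweRrM (poweR_LnormD D f (lt0r_neq0 p0)).
have -> : (T `^ ((q - p) / q))%:E = ((T `^ (q - p))%:E `^ q^-1)%E by rewrite poweR_EFin -powRrM.
rewrite -poweRM ?lee_fin ?powR_ge0 ?integral_normr_powR_ge0//.
apply: le_poweR; [by rewrite invr_ge0 ltW|exact: integral_normr_powR_ge0|].
rewrite -ge0_integralZl ?lee_fin ?powR_ge0//; last exact: measurable_normr_powR.
apply: ge0_le_integral => //.
- exact: measurable_normr_powR.
- by apply: measurable_funeM; exact: measurable_normr_powR.
move=> x _; rewrite -EFinM lee_fin ger0_norm ?le_min ?f0 ?(ltW T0)// ger0_norm//.
have [fT|Tf] := leP (f x) T.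
  have -> : q = (q - p) + p by rewrite subrK.
  have [->|fx0] := eqVneq (f x) 0.
    by rewrite powR0 ?mulr_ge0 ?powR_ge0// subrK gt_eqF.
  rewrite powRD ?fx0 ?implybT// addrK ler_wpM2r ?powR_ge0// ge0_ler_powR ?nnegrE ?subr_ge0 ?(ltW T0)//.
have -> : T `^ q = T `^ (q - p) * T `^ p.
  by rewrite -powRD ?subrK// (gt_eqF T0) implybT.
rewrite ler_wpM2l ?powR_ge0//.
by rewrite ge0_ler_powR ?nnegrE ?(ltW p0) ?(ltW T0) ?(ltW Tf).
Qed.

(** Monotone convergence along the levels [T = k + 1]. *)
Lemma LnormD_le_min f (L : \bar R) : measurable_fun D f -> (forall x, 0 <= f x) ->
  (forall T : R, (0 < T)%R -> LnormD D q%:E (fun x => Num.min (f x) T)%R <= L)%E ->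
  (LnormD D q%:E f <= L)%E.
Proof.
move=> mf f0 H.
have L0 : (0 <= L)%E by apply: le_trans (H 1 ltr01); exact: LnormD_ge0.
pose F k x : \bar R := (`|Num.min (f x) k.+1%:R| `^ q)%:E.
have mF k : measurable_fun D (F k).
  by apply: measurable_normr_powR; apply: measurable_minr => //; exact: measurable_cst.
have F0 k x : D x -> (0 <= F k x)%E by rewrite lee_fin powR_ge0.
have ndF x : D x -> {homo F ^~ x : k l / (k <= l)%N >-> (k <= l)%E}.
  move=> _ k l kl; rewrite lee_fin ge0_ler_powR ?nnegrE ?(ltW q0)//.
  rewrite !ger0_norm ?le_min ?f0 ?ler0n//.
  by rewrite ge_min lexx/= ge_min orbC ler_nat ltnS kl.
have cvF := cvg_monotone_convergence (mu := mu) mD mF F0 ndF.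
rewrite (LnormDE D _ (lt0r_neq0 q0)).
have -> : (L = (L `^ q) `^ q^-1)%E by rewrite -poweRrM mulfV ?poweRe1 ?gt_eqF.
apply: le_poweR; [by rewrite invr_ge0 ltW|exact: integral_normr_powR_ge0|].
have -> : (\int[mu]_(x in D) (`|f x| `^ q)%:E = \int[mu]_(x in D) limn (F ^~ x))%E.
  apply: eq_integral => x _; apply/esym/cvg_lim => //.
  apply: cvg_near_cst; near=> k; rewrite /F (min_idPl _)//.
  near: k; exists (Num.bound (f x)) => // k /= bk.
  apply: ltW; apply: lt_le_trans (archi_boundP (f0 x)) _.
  by rewrite ler_nat (leq_trans bk).
rewrite -(cvg_lim _ cvF)//; apply: lime_le; first by apply/cvg_ex; eexists; exact: cvF.
apply: nearW => k; rewrite -(poweR_LnormD D _ (lt0r_neq0 q0)).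
by apply: le_poweR; [exact: ltW|exact: LnormD_ge0|exact: H].
Unshelve. all: by end_near. Qed.

(* A bound [‖phi‖_q <= C ‖grad phi‖_p] on test functions passes to their limits
   in W^{1,p}: the truncations [min |u| T] are controlled in L^q by the
   convergence in L^p. *)
Lemma LnormD_limit_bound (C : R) u (g : 'rV[R]_n -> 'rV[R[i]]_n) (phi : nat -> 'rV[R]_n -> R[i]) :
  0 <= C -> cmeasurable D u -> (forall i, cmeasurable D (fun x => g x ord0 i)) ->
  (forall k, cmeasurable D (phi k)) ->
  (forall k i, cmeasurable D (fun x => cgradient (phi k) x ord0 i)) ->
  (forall k, cLnormD D q%:E (phi k) <= C%:E * LnormD D p%:E (enorm \o cgradient (phi k)))%E ->
  cLnormD D p%:E (u \- phi k) @[k --> \oo] --> 0%E ->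
  LnormD D p%:E (enorm \o (g \- cgradient (phi k))) @[k --> \oo] --> 0%E ->
  (cLnormD D q%:E u <= C%:E * LnormD D p%:E (enorm \o g))%E.
Proof.
move=> C0 mu_ mg mphi mgphi sob cu cg.
have q1 : 1 <= q by apply: le_trans pq; exact: ltW.
have mB v w : cmeasurable D v -> cmeasurable D w -> cmeasurable D (v \- w).
  move=> mv mw; rewrite (_ : v \- w = fun x => v x + (-1)%:C * w x); last first.
    by apply/funext => x /=; rewrite rmorphN1 mulN1r.
  apply: cmeasurableD => //; apply: cmeasurableM => //.
  by apply: cmeasurable_real; exact: measurable_cst.
have md k : measurable_fun D (normC \o (u \- phi k)) by apply: measurable_normC; exact: mB.
have mgd k : measurable_fun D (enorm \o (g \- cgradient (phi k))).
  apply: measurable_enorm => i; rewrite (_ : (fun x => _) = (fun x => g x ord0 i) \- (fun x => cgradient (phi k) x ord0 i)).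
    exact: mB.
  by apply/funext => x /=; rewrite !mxE.
have mmin f T : measurable_fun D f -> measurable_fun D (fun x => Num.min (f x) T).
  by move=> mf; apply: measurable_minr => //; exact: measurable_cst.
apply: LnormD_le_min => [||T T0]; [exact: measurable_normC|by move=> x; exact: normC_ge0|].
apply: (@le_of_cvg0 _ _ _ _ _ C (T `^ ((q - p) / q)) (p / q) C0 (powR_ge0 _ _) _ _ cg cu).
- by rewrite divr_gt0.
- by move=> k; exact: LnormD_ge0.
(* Uses [min |u| T <= |phi k| + min |u - phi k| T]. The difference is truncated too, because it is
   not yet known to lie in L^q. *)
move=> k; apply: (@le_trans _ _ (cLnormD D q%:E (phi k) +
    LnormD D q%:E (fun x => Num.min (normC (u x - phi k x)) T)%R)%E).
  apply: LnormD_triangle => //; [by apply: mmin; exact: measurable_normC|exact: measurable_normC|exact: (mmin _ _ (md k))|].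
  move=> x _; rewrite !ger0_norm ?le_min ?normC_ge0 ?(ltW T0)//.
  have [_|_] := leP (normC (u x - phi k x)) T.
    apply: (@le_trans _ _ (normC (u x))); first by rewrite ge_min lexx.
    by rewrite -{1}(subrK (phi k x) (u x)) addrC normC_triangle.
  by rewrite ge_min; apply/orP; right; rewrite lerDr normC_ge0.
rewrite addeA; apply: leeD; last first.
  exact: (LnormD_min_le T0 (md k) (fun x => normC_ge0 _)).
apply: le_trans (sob k) _; rewrite -ge0_muleDr ?LnormD_ge0//.
apply: lee_wpmul2l; first by rewrite lee_fin.
apply: LnormD_triangle => //; [exact: ltW|exact: measurable_enorm|exact: measurable_enorm|].
move=> x _; rewrite /= !ger0_norm ?enorm_ge0//.
rewrite -(enormN (g x - _)) opprB -{1}(subrK (g x) (cgradient (phi k) x)) addrC.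
exact: enorm_triangle.
Qed.

End truncation.

(** * Integrals of complex functions *)

Section complex_integral.
Context {R : realType} {n : nat}.
Variables (D : set 'rV[R]_n) (mD : measurable D).
Local Notation mu := (lebesgue_rV R n).
Local Notation normC := (@ComplexField.Normc.normc R).
Implicit Types (u v : 'rV[R]_n -> R[i]) (f h : 'rV[R]_n -> R).

Lemma eq_cintegral u v : (forall x, D x -> u x = v x) -> cintegral D u = cintegral D v.
Proof.
by move=> uv; congr Complex; apply: eq_Rintegral => x /set_mem/uv; rewrite /= => ->.
Qed.

Lemma integrable_le f h : measurable_fun D f -> mu.-integrable D (EFin \o h) ->
  (forall x, D x -> `|f x| <= h x) -> mu.-integrable D (EFin \o f).
Proof.
move=> mf ih fh; apply: le_integrable ih => //; first exact/measurable_EFinP.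
move=> x Dx; rewrite /= lee_fin; apply: le_trans (fh x Dx) _; exact: ler_norm.
Qed.

Lemma cintegrable_le u h : cmeasurable D u -> mu.-integrable D (EFin \o h) ->
  (forall x, D x -> normC (u x) <= h x) -> cintegrable D u.
Proof.
move=> [m1 m2] ih uh; split.
- by apply: (integrable_le m1 ih) => x Dx; apply: le_trans (uh x Dx); exact: normr_ReC_le.
- by apply: (integrable_le m2 ih) => x Dx; apply: le_trans (uh x Dx); exact: normr_ImC_le.
Qed.

Lemma cintegralD u v : cintegrable D u -> cintegrable D v ->
  cintegral D (fun x => u x + v x) = cintegral D u + cintegral D v.
Proof.
move=> [u1 u2] [v1 v2]; apply/eqP; rewrite eq_complex/=; apply/andP; split; apply/eqP.
- by rewrite -RintegralD//; apply: eq_Rintegral => x _; exact: ReCD.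
- by rewrite -RintegralD//; apply: eq_Rintegral => x _; exact: ImCD.
Qed.

Lemma cintegralZ u (t : R) : cintegrable D u ->
  cintegral D (fun x => t%:C * u x) = t%:C * cintegral D u.
Proof.
move=> [u1 u2]; apply/eqP; rewrite eq_complex/= !mul0r subr0 addr0; apply/andP; split; apply/eqP.
- by rewrite -RintegralZl//; apply: eq_Rintegral => x _; rewrite ReCM/= mul0r subr0.
- by rewrite -RintegralZl//; apply: eq_Rintegral => x _; rewrite ImCM/= mul0r addr0.
Qed.

Lemma LnormD_fin_integrable_powR f (p : R) : 0 < p -> measurable_fun D f ->
  (LnormD D p%:E f < +oo)%E -> mu.-integrable D (EFin \o (fun x => `|f x| `^ p)).
Proof.
move=> p0 mf foo; apply/integrableP; split; first exact: measurable_normr_powR.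
under eq_integral do rewrite /= ger0_norm ?powR_ge0//.
rewrite -(poweR_LnormD D f (lt0r_neq0 p0)); exact: poweR_lty.
Qed.

Lemma le_1powR (p x : R) : 1 <= p -> 0 <= x -> x <= 1 + x `^ p.
Proof.
move=> p1 x0; have [x1|x1] := leP x 1; first by rewrite (le_trans x1)// lerDl powR_ge0.
by rewrite (le_trans (le1r_powR (ltW x1) p1))// lerDr.
Qed.

Lemma LnormD_fin_integrable f (p : R) : (mu D < +oo)%E -> 1 <= p -> measurable_fun D f ->
  (LnormD D p%:E f < +oo)%E -> mu.-integrable D (EFin \o f).
Proof.
move=> Doo p1 mf foo; have p0 : 0 < p by exact: lt_le_trans p1.
have i1 := LnormD_fin_integrable_powR p0 mf foo.
have i0 : mu.-integrable D (EFin \o (cst (1 : R))).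
  apply/integrableP; split; first by apply/measurable_EFinP; exact: measurable_cst.
  by under eq_integral do rewrite /= normr1; rewrite integral_cst// mul1e.
apply: (integrable_le (h := fun x => 1 + `|f x| `^ p) mf).
  by apply: eq_integrable (integrableD mD i0 i1).
by move=> x _; exact: le_1powR.
Qed.

End complex_integral.

(** * Integration by parts on R^n *)

Section integration_by_parts.
Context {R : realType} {n : nat}.
Variables (D : set 'rV[R]_n) (mD : measurable D).
Local Notation mu := (lebesgue_rV R n).
Local Notation ReC := (@complex.Re R).
Local Notation ImC := (@complex.Im R).

Lemma integrable_compact_support (F : 'rV[R]_n -> R) C (E : set 'rV[R]_n) : measurable E ->
  continuous F -> compact C -> (forall x, ~ C x -> F x = 0) ->
  mu.-integrable E (EFin \o F).
Proof.
move=> mE cF cC F0; apply: (integrableS (@measurableT _ _) mE) => //.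
have [B FB] := continuous_compact_support_bounded cF cC F0.
have [M CM] := compact_cube cC.
apply: (integrable_bounded_cube (continuous_measurable_rV cF) FB (M := M)) => x i /CM.
exact: F0.
Qed.

Section real.
Variables (f g : 'rV[R]_n -> R) (C : set 'rV[R]_n) (i : 'I_n).
Hypotheses (sf : smooth f) (sg : smooth g) (cC : compact C) (CD : C `<=` D)
  (f0 : forall x, ~ C x -> f x = 0).

Let closC : closed C.
Proof. by apply: compact_closed cC; exact: norm_hausdorff. Qed.

Lemma ibp_integrable1 : mu.-integrable D (EFin \o (f \* partial i g)).
Proof.
apply: (integrable_compact_support mD _ cC).
  move=> x; have := @smooth_continuous_partial _ _ _ i sg x.
  by move=> c2; exact: (continuousM (@smooth_continuous _ _ _ sf x) c2).
by move=> x /f0 /= ->; rewrite mul0r.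
Qed.

Lemma ibp_integrable2 : mu.-integrable D (EFin \o (partial i f \* g)).
Proof.
apply: (integrable_compact_support mD _ cC).
  move=> x; have := @smooth_continuous_partial _ _ _ i sf x.
  by move=> c2; exact: (continuousM c2 (@smooth_continuous _ _ _ sg x)).
by move=> x Cx /=; rewrite (partial_eq0_out i closC f0 Cx) mul0r.
Qed.

(** On each line in direction [i] the sum [F] of the two integrands is the derivative of the
    compactly supported [f g], so its line integrals vanish. *)
Lemma integration_by_parts_rV :
  \int[mu]_(x in D) (f x * partial i g x) = - \int[mu]_(x in D) (partial i f x * g x).
Proof.
pose F x := f x * partial i g x + partial i f x * g x.
have F0 x : ~ C x -> F x = 0.
  by move=> Cx; rewrite /F (f0 Cx) (partial_eq0_out i closC f0 Cx) !mul0r addr0.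
have cF : continuous F.
  move=> x; have c1 := continuousM (@smooth_continuous _ _ _ sf x) (@smooth_continuous_partial _ _ _ i sg x).
  have c2 := continuousM (@smooth_continuous_partial _ _ _ i sf x) (@smooth_continuous _ _ _ sg x).
  exact: (continuousD c1 c2).
have [B FB] := continuous_compact_support_bounded cF cC F0.
have [M CM] := compact_cube cC.
have FM (x : 'rV[R]_n) (j : 'I_n) : M < `|x ord0 j| -> F x = 0 by move=> /CM/F0.
apply/eqP; rewrite -addr_eq0 -RintegralD//; [|exact: ibp_integrable1|exact: ibp_integrable2].
apply/eqP; rewrite Rintegral_mkcond.
have -> : (fun x => f x * partial i g x + partial i f x * g x) \_ D = F.
  apply/funext => x; rewrite patchE; case: ifPn => // /negP Dx.
  by rewrite F0// => /CD/mem_set.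
rewrite /Rintegral (_ : (\int[mu]_x _)%E = 0%E)//.
apply: (integral_rV_lines_eq0 (i := i) (continuous_measurable_rV cF) FB FM) => x.
pose h t := f (rV_set x i t) * g (rV_set x i t).
have dh (t : R) : is_derive t 1 h (F (rV_set x i t)).
  have d1 := is_derive_rV_set (@smooth_derivable _ _ _ (rV_set x i t) i sf).
  have d2 := is_derive_rV_set (@smooth_derivable _ _ _ (rV_set x i t) i sg).
  have := is_deriveM d1 d2; rewrite /F [partial i f _ * _]mulrC; exact.
apply: (integral_derive_eq0 dh (M := M)).
  by move=> t; apply: continuous_comp; [exact: continuous_rV_set|exact: cF].
move=> t Mt; rewrite /h f0 ?mul0r//; apply: (CM _ i).
by rewrite mxE eqxx.
Qed.

End real.

Lemma test_function_weak_gradient psi : test_function D psi ->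
  weak_gradient D psi (cgradient psi).
Proof.
move=> tp eta te i; have [f1 f2 cC CD] := tp; have [g1 g2 _ _] := te.
have z1 x : ~ closure [set x | psi x != 0] x -> (ReC \o psi) x = 0 by move=> /supp_out /= ->.
have z2 x : ~ closure [set x | psi x != 0] x -> (ImC \o psi) x = 0 by move=> /supp_out /= ->.
have I f g := @ibp_integrable1 f g _ i.
have J f g := @ibp_integrable2 f g _ i.
have P f g := @integration_by_parts_rV f g _ i.
rewrite /cintegral; apply/eqP; rewrite eq_complex/=; apply/andP; split; apply/eqP.
  under eq_Rintegral do rewrite ReCM/=.
  under [in RHS]eq_Rintegral do rewrite mxE ReCM/=.
  rewrite (RintegralB mD (I _ _ _ f1 g1 cC z1) (I _ _ _ f2 g2 cC z2)).
  rewrite (RintegralB mD (J _ _ _ f1 g1 cC z1) (J _ _ _ f2 g2 cC z2)).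
  by rewrite (P _ _ _ f1 g1 cC CD z1) (P _ _ _ f2 g2 cC CD z2) opprB opprK addrC.
under eq_Rintegral do rewrite ImCM/=.
under [in RHS]eq_Rintegral do rewrite mxE ImCM/=.
rewrite (RintegralD mD (I _ _ _ f1 g2 cC z1) (I _ _ _ f2 g1 cC z2)).
rewrite (RintegralD mD (J _ _ _ f1 g2 cC z1) (J _ _ _ f2 g1 cC z2)).
by rewrite (P _ _ _ f1 g2 cC CD z1) (P _ _ _ f2 g1 cC CD z2) opprD.
Qed.

End integration_by_parts.

(** * The exponents and Hoelder's inequality for the potential *)

Section potential.
Context {R : realType} {n : nat}.
Variables (D : set 'rV[R]_n) (mD : measurable D).
Local Notation mu := (lebesgue_rV R n).
Local Notation normC := (@ComplexField.Normc.normc R).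

(** Resolves [1/r + p/q = 1] once and for all into the case [r = +oo], where [1/r] is [0], and the
    case of a real [r]. *)
Definition conjugate_exponents (p q : R) (r : \bar R) : Prop :=
  (r = +oo%E /\ q = p) \/ exists2 s : R, 0 < s & r = s%:E /\ s^-1 + p / q = 1.

(** From [r > n/p] one gets [1/r < p/n], hence [p/q > 1 - p/n]. The last conclusion is
    [q < np/(n-p)] without a division. *)
Lemma conjugate_exponentsP (p q : R) (r : \bar R) :
  1 < p -> p < n%:R -> ((n%:R / p)%:E < r)%E -> (r^-1 + (p / q)%:E = 1)%E ->
  [/\ conjugate_exponents p q r, p <= q & q * (n%:R - p) < n%:R * p].
Proof.
move=> p1 pn nr rpq; have p0 : 0 < p by exact: lt_trans p1.
have n0 : 0 < n%:R :> R by exact: lt_trans pn.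
case: r nr rpq => [s| |//].
- rewrite lte_fin => ns; have s0 : 0 < s by apply: lt_trans ns; exact: divr_gt0.
  rewrite inver gt_eqF// => -[sq].
  have sn : s^-1 < p / n%:R by rewrite -invf_div ltf_pV2// posrE// divr_gt0.
  have pn1 : p / n%:R < 1 by rewrite ltr_pdivrMr// mul1r.
  have pq1 : p / q < 1 by have := invr_gt0 s; rewrite s0; lra.
  have pqn : 1 - p / n%:R < p / q by lra.
  have pq0 : 0 < p / q by lra.
  have q0 : 0 < q by move: pq0; rewrite pmulr_rgt0// invr_gt0.
  split; first by right; exists s.
    by move: pq1; rewrite ltr_pdivrMr// mul1r => /ltW.
  move: pqn; rewrite ltr_pdivlMr// -(ltr_pM2r n0) [ltRHS]mulrC.
  by rewrite (_ : (1 - p / n%:R) * q * n%:R = q * (n%:R - p))//; field; rewrite gt_eqF.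
- move=> _; rewrite invey add0e => -[pq1].
  (* The inverse of [0] is [0], so [p / q = 1] excludes [q = 0]. *)
  have q0 : q != 0 by apply: contra_eq_neq pq1 => ->; rewrite invr0 mulr0 eq_sym oner_neq0.
  have -> : q = p by rewrite -[q]mul1r -pq1 divfK.
  split => //; first by left.
  by rewrite mulrC ltr_pM2r// ltrBlDr ltrDl.
Qed.

Lemma ae_le_LnormDy (V : 'rV[R]_n -> R) :
  {ae mu, forall x, D x -> (`|V x|%:E <= LnormD D +oo V)%E}.
Proof.
rewrite /LnormD unlock /=; case: ifPn => [_|].
  have := ess_sup_ge mu (abse \o (EFin \o V \_ D)).
  by apply: filterS => x /= + Dx; rewrite patchE mem_set.
(* The norm is an essential supremum only if the whole space has positive measure; otherwise every
   property holds almost everywhere. *)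
rewrite -leNgt => muT; exists setT; split => //.
by apply/eqP; rewrite eq_le muT measure_ge0.
Qed.

(** For [r = +oo] the almost everywhere bound on [V] suffices; for [r = s] real, [geometric_hoelder]
    applies with weights [1/s] and [p/q]. *)
Lemma hoelder_potential (p q : R) (r : \bar R) (V w : 'rV[R]_n -> R) :
  0 < p -> 0 < q -> conjugate_exponents p q r ->
  measurable_fun D V -> measurable_fun D w -> (forall x, D x -> 0 <= w x) ->
  (\int[mu]_(x in D) (`|V x| * w x)%:E <=
   LnormD D r V * (\int[mu]_(x in D) (w x `^ (q / p))%:E) `^ (p / q))%E.
Proof.
move=> p0 q0 cpq mV mw w0.
have mnV : measurable_fun D (fun x => `|V x|).
  by apply: measurableT_comp => //; exact: normr_measurable.
case: cpq => [[-> ->]|[s s0 [-> spq]]].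
  rewrite mulfV ?gt_eqF// poweRe1; last first.
    by apply: integral_ge0 => x _; rewrite lee_fin powR_ge0.
  rewrite [X in (_ <= _ * X)%E](_ : _ = \int[mu]_(x in D) (w x)%:E)%E; last first.
    by apply: eq_integral => x /set_mem Dx; rewrite powRr1// w0.
  rewrite -ge0_integralZl//; last 2 first.
  - exact/measurable_EFinP.
  - exact: LnormD_ge0.
  apply: ae_ge0_le_integral => //.
  - by move=> x Dx; rewrite lee_fin mulr_ge0// w0.
  - by apply/measurable_EFinP; exact: measurable_funM.
  - by move=> x Dx; rewrite mule_ge0 ?LnormD_ge0// lee_fin w0.
  - by apply: measurable_funeM; exact/measurable_EFinP.
  apply: filterS (ae_le_LnormDy V) => x H Dx; rewrite EFinM.
  by apply: lee_wpmul2r; [rewrite lee_fin w0|exact: H].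
have b0 : 0 < p / q by rewrite divr_gt0.
have a0 : 0 < s^-1 by rewrite invr_gt0.
rewrite (LnormDE D V (lt0r_neq0 s0)).
rewrite [leLHS](_ : _ = (\int[mu]_(x in D) ((`|V x| `^ s)%:E `^ s^-1 * (w x `^ (q / p))%:E `^ (p / q)))%E); last first.
  apply: eq_integral => x /set_mem Dx; rewrite !poweR_EFin -EFinM -!powRrM mulfV ?gt_eqF//.
  rewrite (_ : q / p * (p / q) = 1) ?powRr1 ?w0//.
  by field; rewrite !gt_eqF.
apply: geometric_hoelder => //.
- exact: measurable_normr_powR.
- by apply/measurable_EFinP; exact: (measurableT_comp (measurable_powR _)).
- by move=> x _; rewrite lee_fin powR_ge0.
Qed.

Lemma cLnormD_gt0 (q : R) u : 0 < q -> cmeasurable D u -> nontrivial D u ->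
  (0 < cLnormD D q%:E u)%E.
Proof.
move=> q0 mu_ ntu; rewrite lt0e LnormD_ge0 andbT; apply/eqP => u0; apply: ntu.
have : measurable_fun setT (EFin \o ((normC \o u) \_ D)).
  apply/measurable_EFinP; apply/(measurable_restrictT _ mD); exact: measurable_normC.
move=> /Lnorm_eq0_eq0 => /(_ mu q%:E); rewrite lte_fin => /(_ q0 u0).
apply: filterS => x /(_ I) /= + Dx; rewrite patchE mem_set// => -[/eqP].
by rewrite normC_eq0 => /eqP.
Qed.

Lemma cLnormD_eq0 (q : R) u : 0 < q -> cmeasurable D u ->
  {ae mu, forall x, D x -> u x = 0} -> cLnormD D q%:E u = 0%E.
Proof.
move=> q0 mu_ u0; rewrite /cLnormD (LnormDE D _ (lt0r_neq0 q0)).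
rewrite (ae_eq_integral (cst 0%E)) ?integral0 ?poweR0r ?invr_neq0 ?gt_eqF//.
  by apply: measurable_normr_powR; exact: measurable_normC.
apply: filterS u0 => x H Dx /=; rewrite H// ComplexField.Normc.normc0 normr0.
by rewrite powR0// gt_eqF.
Qed.

End potential.

(** * The Sobolev inequality on W_0^{1,p} and the finiteness of [K] *)

Section sobolev_space.
Context {R : realType} {n : nat}.
Variables (p q : R) (p1 : 1 < p) (pn : p < n%:R) (pq : p <= q).
Hypothesis qpn : q * (n%:R - p) < n%:R * p.
Variables (D : set 'rV[R]_n) (mD : measurable D).
Local Notation mu := (lebesgue_rV R n).
Hypothesis Doo : (mu D < +oo)%E.

Let p0 : 0 < p. Proof. exact: lt_trans p1. Qed.
Let q0 : 0 < q. Proof. exact: lt_le_trans pq. Qed.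

Lemma sobolev_limit : exists2 C : R, 0 <= C &
  forall u (g : 'rV[R]_n -> 'rV[R[i]]_n) (phi : ('rV[R]_n -> R[i])^nat), cmeasurable D u ->
    (forall i, cmeasurable D (fun x => g x ord0 i)) ->
    (forall k, test_function D (phi k)) ->
    cLnormD D p%:E (u \- phi k) @[k --> \oo] --> 0%E ->
    LnormD D p%:E (enorm \o (g \- cgradient (phi k))) @[k --> \oo] --> 0%E ->
    (cLnormD D q%:E u <= C%:E * LnormD D p%:E (enorm \o g))%E.
Proof.
have q1 : 1 <= q by apply: le_trans pq; exact: ltW.
have [C C0 sob] : exists2 C : R, 0 <= C & forall psi, test_function D psi ->
    (cLnormD D q%:E psi <= C%:E * LnormD D p%:E (enorm \o cgradient psi))%E.
  (* Dimensions [0] and [1] contradict [1 < p < n]; the inequality for test functions is stated from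
     dimension [2] on. *)
  case: n D mD Doo pn qpn => [|[|m]] E mE Eoo pm qpm.
  - by have := lt_trans p0 pm; rewrite ltxx.
  - by have := lt_trans p1 pm; rewrite ltxx.
  pose ps := m.+2%:R * p / (m.+2%:R - p).
  exists (2 * (p * (m.+2%:R - 1) / (m.+2%:R - p) * fine (lebesgue_rV R m.+2 E) `^ ((1 - q / ps) / q))).
    rewrite !mulr_ge0 ?powR_ge0 ?invr_ge0 ?subr_ge0 ?(ltW p0) ?(ltW pm)//.
    by rewrite ler1n.
  by move=> psi; exact: sobolev_test.
exists C => // u g phi mu_ mg tphi; apply: LnormD_limit_bound => //.
- by move=> k; exact: cmeasurable_test (tphi k) mD.
- by move=> k i; exact: cmeasurable_cgradient (tphi k) mD.
- by move=> k; exact: sob.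
Qed.

Lemma sobolev_W01p : exists2 C : R, 0 <= C & forall u g, W01p D p u g ->
  (cLnormD D q%:E u <= C%:E * LnormD D p%:E (enorm \o g))%E.
Proof.
have [C C0 H] := sobolev_limit; exists C => // u g [[mu_ _ mg _ _] [phi tphi [cu cg]]].
exact: H cu cg.
Qed.

(** A null gradient would give [‖u‖_q = 0] by the Sobolev inequality. The quotients defining [K]
    thus have a positive denominator. *)
Lemma gradient_LnormD_gt0 u g : W01p D p u g -> nontrivial D u ->
  (0 < LnormD D p%:E (enorm \o g))%E.
Proof.
move=> W ntu; have [C C0 /(_ _ _ W) H] := sobolev_W01p.
rewrite lt0e LnormD_ge0 andbT; apply/eqP => g0; move: H; rewrite g0 mule0 leNgt.
by rewrite cLnormD_gt0//; case: W => -[].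
Qed.

Lemma sobolev_constant_lty : (sobolev_constant D q p < +oo)%E.
Proof.
have [C C0 H] := sobolev_W01p; apply: (@le_lt_trans _ _ C%:E); last exact: ltry.
apply: ge_ereal_sup => _ [u [g [W ntu ->]]].
have g0 := gradient_LnormD_gt0 W ntu.
have goo : (LnormD D p%:E (enorm \o g) < +oo)%E by case: W => -[].
have gfin : LnormD D p%:E (enorm \o g) \is a fin_num by rewrite ge0_fin_numE// ltW.
have := H _ _ W; rewrite -(fineK gfin) inver gt_eqF ?fine_gt0 ?g0//.
by rewrite lee_pdivrMr// fine_gt0 ?g0.
Qed.

Lemma le_sobolev_constant u g : W01p D p u g -> nontrivial D u ->
  (cLnormD D q%:E u <= sobolev_constant D q p * LnormD D p%:E (enorm \o g))%E.
Proof.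
move=> W ntu; have g0 := gradient_LnormD_gt0 W ntu.
have goo : (LnormD D p%:E (enorm \o g) < +oo)%E by case: W => -[].
have gfin : LnormD D p%:E (enorm \o g) \is a fin_num by rewrite ge0_fin_numE// ltW.
have : (cLnormD D q%:E u / LnormD D p%:E (enorm \o g) <= sobolev_constant D q p)%E.
  by apply: ereal_sup_ubound; exists u, g.
rewrite -(fineK gfin) inver gt_eqF ?fine_gt0 ?g0//.
by rewrite lee_pdivrMr// fine_gt0 ?g0.
Qed.

Lemma sobolev_constant_gt0 u g : W01p D p u g -> nontrivial D u ->
  (0 < sobolev_constant D q p)%E.
Proof.
move=> W ntu; rewrite ltNge; apply/negP => K0.
have := le_sobolev_constant W ntu; rewrite leNgt => /negP; apply.
apply: (@le_lt_trans _ _ 0%E); last by apply: cLnormD_gt0 => //; case: W => -[].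
by rewrite mule_le0_ge0// LnormD_ge0.
Qed.

End sobolev_space.

(** * Adding a test function to an element of W_0^{1,p} *)

Section perturbation.
Context {R : realType} {n : nat}.
Variables (D : set 'rV[R]_n) (mD : measurable D).
Local Notation mu := (lebesgue_rV R n).
Hypothesis Doo : (mu D < +oo)%E.
Local Notation ReC := (@complex.Re R).
Local Notation ImC := (@complex.Im R).
Local Notation normC := (@ComplexField.Normc.normc R).
Implicit Types (u v psi eta : 'rV[R]_n -> R[i]) (f : 'rV[R]_n -> R).

Lemma test_function_bounded psi : test_function D psi ->
  exists2 B : R, 0 <= B & forall x, normC (psi x) <= B.
Proof.
move=> [s1 s2 cC _].
have [B1 H1] := continuous_compact_support_bounded (@smooth_continuous _ _ _ s1) cC
  (fun x Cx => congr1 ReC (supp_out Cx)).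
have [B2 H2] := continuous_compact_support_bounded (@smooth_continuous _ _ _ s2) cC
  (fun x Cx => congr1 ImC (supp_out Cx)).
have H x : normC (psi x) <= B1 + B2 by exact: le_trans (normC_le_ReIm _) (lerD (H1 x) (H2 x)).
by exists (B1 + B2) => //; apply: le_trans (H 0); exact: normC_ge0.
Qed.

Lemma enorm_le_sum (a : 'rV[R[i]]_n) : enorm a <= \sum_i normC (a ord0 i).
Proof.
have s0 : 0 <= \sum_i normC (a ord0 i) by apply: sumr_ge0 => i _; exact: normC_ge0.
rewrite -ler_sqr ?nnegrE ?enorm_ge0// sqr_enorm expr2 mulr_suml; apply: ler_sum => i _.
rewrite expr2 ler_wpM2l ?normC_ge0// (bigD1 i)//= lerDl.
by apply: sumr_ge0 => j _; exact: normC_ge0.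
Qed.

Lemma cgradient_bounded psi : test_function D psi ->
  exists2 B : R, 0 <= B & forall x, enorm (cgradient psi x) <= B.
Proof.
move=> tp.
have /choice[B BH] : forall i, exists B, forall x, normC (cpartial i psi x) <= B.
  by move=> i; have [B _ H] := test_function_bounded (test_function_cpartial i tp); exists B.
have H x : enorm (cgradient psi x) <= \sum_i B i.
  by apply: le_trans (enorm_le_sum _) _; apply: ler_sum => i _; rewrite mxE.
by exists (\sum_i B i) => //; apply: le_trans (H 0); exact: enorm_ge0.
Qed.

Lemma integrable_cst_finite (c : R) : mu.-integrable D (EFin \o (fun=> c)).
Proof.
apply/integrableP; split; first by apply/measurable_EFinP; exact: measurable_cst.
under eq_integral do rewrite /=.
by rewrite integral_cst// lte_mul_pinfty// lee_fin.
Qed.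

Lemma LnormD_bounded_lty (s : R) f (B : R) : 0 < s -> measurable_fun D f ->
  (forall x, `|f x| <= B) -> (LnormD D s%:E f < +oo)%E.
Proof.
move=> s0 mf fB; rewrite (LnormDE D _ (lt0r_neq0 s0)); apply: poweR_lty.
apply: (@le_lt_trans _ _ (\int[mu]_(x in D) (B `^ s)%:E)%E); last first.
  by rewrite integral_cst// lte_mul_pinfty// lee_fin powR_ge0.
apply: ge0_le_integral => //.
- exact: measurable_normr_powR.
- by move=> x _; rewrite lee_fin ge0_ler_powR ?nnegrE ?(ltW s0)// (le_trans _ (fB x)).
Qed.

Lemma cintegrable_mul_bounded u v (s B : R) : 1 <= s -> cmeasurable D u -> cmeasurable D v ->
  (cLnormD D s%:E u < +oo)%E -> (forall x, normC (v x) <= B) -> cintegrable D (fun x => u x * v x).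
Proof.
move=> s1 mu_ mv uoo vB.
have iu := LnormD_fin_integrable mD Doo s1 (measurable_normC mu_) uoo.
apply: (@cintegrable_le _ _ D mD _ (fun x => B * normC (u x))); first exact: cmeasurableM.
  by apply: eq_integrable (integrableZl mD B iu).
by move=> x _; rewrite ComplexField.Normc.normcM mulrC ler_wpM2r ?normC_ge0.
Qed.

Lemma cLnormDD (s : R) u v : 1 <= s -> cmeasurable D u -> cmeasurable D v ->
  (cLnormD D s%:E (fun x => u x + v x)%R <= cLnormD D s%:E u + cLnormD D s%:E v)%E.
Proof.
move=> s1 mu_ mv; apply: LnormD_triangle => //.
- by apply: measurable_normC; exact: cmeasurableD.
- exact: measurable_normC.
- exact: measurable_normC.
- by move=> x _; rewrite /= !ger0_norm ?normC_ge0// normC_triangle.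
Qed.

Lemma enorm_LnormDD (s : R) (g h : 'rV[R]_n -> 'rV[R[i]]_n) : 1 <= s ->
  (forall i, cmeasurable D (fun x => g x ord0 i)) ->
  (forall i, cmeasurable D (fun x => h x ord0 i)) ->
  (LnormD D s%:E (enorm \o (fun x => g x + h x)%R) <=
   LnormD D s%:E (enorm \o g) + LnormD D s%:E (enorm \o h))%E.
Proof.
move=> s1 mg mh; apply: LnormD_triangle => //.
- apply: measurable_enorm => i; rewrite (_ : (fun x => _) = fun x => g x ord0 i + h x ord0 i).
    exact: cmeasurableD.
  by apply/funext => x; rewrite mxE.
- exact: measurable_enorm.
- exact: measurable_enorm.
- by move=> x _; rewrite /= !ger0_norm ?enorm_ge0// enorm_triangle.
Qed.

Section W01p.
Variables (p : R) (p1 : 1 < p).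

Let p0 : 0 < p. Proof. exact: lt_trans p1. Qed.

Lemma W1p_test eta : test_function D eta -> W1p D p eta (cgradient eta).
Proof.
move=> te; have [B _ HB] := test_function_bounded te; have [B' _ HB'] := cgradient_bounded te.
have mgrad i := cmeasurable_cgradient i te mD.
split => //.
- exact: cmeasurable_test te mD.
- apply: (LnormD_bounded_lty (B := B) p0).
    by apply: measurable_normC; exact: cmeasurable_test te mD.
  by move=> x; rewrite /= ger0_norm ?normC_ge0.
- apply: (LnormD_bounded_lty (B := B') p0); first exact: measurable_enorm.
  by move=> x; rewrite /= ger0_norm ?enorm_ge0.
- exact: test_function_weak_gradient.
Qed.

Lemma W1pD u v g h : W1p D p u g -> W1p D p v h ->
  W1p D p (fun x => u x + v x) (fun x => g x + h x).
Proof.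
move=> [mu_ uoo mg goo wu] [mv voo mh hoo wv].
have mgh i : cmeasurable D (fun x => (g x + h x) ord0 i).
  rewrite (_ : (fun x => _) = fun x => g x ord0 i + h x ord0 i); first exact: cmeasurableD.
  by apply/funext => x; rewrite mxE.
have ioo (k : 'rV[R]_n -> 'rV[R[i]]_n) i : (forall i, cmeasurable D (fun x => k x ord0 i)) ->
    (LnormD D p%:E (enorm \o k) < +oo)%E -> (cLnormD D p%:E (fun x => k x ord0 i) < +oo)%E.
  move=> mk; apply: le_lt_trans; apply: le_LnormD => //; [exact: measurable_normC|exact: measurable_enorm|].
  by move=> x _; rewrite /= !ger0_norm ?enorm_ge0 ?normC_ge0// normC_le_enorm.
split => //.
- exact: cmeasurableD.
- by apply: le_lt_trans (cLnormDD _ _ _) _; rewrite ?lte_add_pinfty ?(ltW p1).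
- by apply: le_lt_trans (enorm_LnormDD _ _ _) _; rewrite ?lte_add_pinfty ?(ltW p1).
move=> psi tp i; have tpi := test_function_cpartial i tp.
have mpsi := cmeasurable_test tp mD; have mpi := cmeasurable_test tpi mD.
have [B _ HB] := test_function_bounded tp; have [B' _ HB'] := test_function_bounded tpi.
have p1' := ltW p1.
rewrite (eq_cintegral (v := fun x => u x * cpartial i psi x + v x * cpartial i psi x)); last first.
  by move=> x _; rewrite mulrDl.
rewrite (cintegralD mD (cintegrable_mul_bounded p1' mu_ mpi uoo HB') (cintegrable_mul_bounded p1' mv mpi voo HB')).
rewrite [in RHS](eq_cintegral (v := fun x => g x ord0 i * psi x + h x ord0 i * psi x)); last first.
  by move=> x _; rewrite mxE mulrDl.
rewrite (cintegralD mD (cintegrable_mul_bounded p1' (mg i) mpsi (ioo _ i mg goo) HB)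
  (cintegrable_mul_bounded p1' (mh i) mpsi (ioo _ i mh hoo) HB)).
by rewrite (wu _ tp) (wv _ tp) opprD.
Qed.

Lemma W01pD_test u g eta : W01p D p u g -> test_function D eta ->
  W01p D p (fun x => u x + eta x) (fun x => g x + cgradient eta x).
Proof.
move=> [W [phi tphi [cu cg]]] te; split; first exact: W1pD (W1p_test te).
exists (fun k x => phi k x + eta x); first by move=> k; exact: test_functionD.
split.
- apply: cvg_trans cu; apply: near_eq_cvg; apply: nearW => k.
  congr cLnormD; apply/funext => x /=.
  by rewrite opprD addrACA subrr addr0.
- apply: cvg_trans cg; apply: near_eq_cvg; apply: nearW => k.
  apply: (congr1 (LnormD D p%:E)); apply/funext => x; apply: (congr1 enorm).
  by apply/rowP => i; rewrite !mxE (cpartialD i x (tphi k) te) opprD addrACA subrr addr0.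
Qed.

Lemma W01p_test eta : test_function D eta -> W01p D p eta (cgradient eta).
Proof.
move=> te; split; first exact: W1p_test.
have L0 f : (forall x, f x = 0) -> LnormD D p%:E f = 0%E.
  move=> f0; rewrite (LnormDE D _ (lt0r_neq0 p0)) integral0_eq ?poweR0r ?invr_neq0 ?(lt0r_neq0 p0)//.
  by move=> x _; rewrite f0 normr0 powR0 ?(lt0r_neq0 p0).
exists (fun=> eta) => //; split; apply: cvg_near_cst; apply: nearW => _; apply: L0 => x /=.
- by rewrite subrr ComplexField.Normc.normc0.
- by rewrite subrr enorm0.
Qed.

End W01p.

End perturbation.

(** * The lower bound *)

Section lower_bound.
Context {R : realType} {n : nat}.
Variables (p q : R) (r : \bar R) (p1 : 1 < p) (pn : p < n%:R) (pq : p <= q).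
Hypothesis qpn : q * (n%:R - p) < n%:R * p.
Hypothesis cpq : conjugate_exponents p q r.
Variables (D : set 'rV[R]_n) (mD : measurable D).
Local Notation mu := (lebesgue_rV R n).
Hypothesis Doo : (mu D < +oo)%E.
Local Notation ReC := (@complex.Re R).
Local Notation normC := (@ComplexField.Normc.normc R).

Let p0 : 0 < p. Proof. exact: lt_trans p1. Qed.
Let q0 : 0 < q. Proof. exact: lt_le_trans pq. Qed.

(** Write [b = a - (a - b)]. With [a] the gradient of [u] and [b] that of a test function, the
    equation's left-hand side differs from the energy by an error that Hoelder controls. *)
Lemma ReC_dot_conj_ge (a b : 'rV[R[i]]_n) :
  enorm a `^ p - enorm a `^ (p - 1) * enorm (a - b) <=
  enorm a `^ (p - 2) * ReC (\sum_i a ord0 i * (b ord0 i)^*%C).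
Proof.
have e : ReC (\sum_i a ord0 i * (b ord0 i)^*%C) =
    enorm a ^+ 2 - ReC (\sum_i a ord0 i * ((a - b) ord0 i)^*%C).
  have -> : enorm a ^+ 2 = ReC (\sum_i a ord0 i * (a ord0 i)^*%C) by rewrite dot_conj.
  rewrite !ReC_sum -sumrB; apply: eq_bigr => i _; rewrite -ReCN -ReCD !mxE.
  by congr ReC; rewrite rmorphB/= mulrBr opprB addrC subrK.
rewrite e mulrBr (powR_sub2M2 p1 (enorm_ge0 a)) lerD2l lerN2.
exact: le_trans (ler_norm _) (enorm_powR_dot_le a (a - b) p1).
Qed.

(** The same expansion on the right-hand side. [V] is replaced by its positive part in the main term
    only; the error keeps [|V|]. *)
Lemma ReC_potential_le (v : R) (a b : R[i]) :
  ReC (v%:C * (normC a `^ (p - 2))%:C * a * b^*%C) <=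
  Num.max v 0 * normC a `^ p + `|v| * (normC a `^ (p - 1) * normC (a - b)).
Proof.
have a0 := normC_ge0 a.
have -> : ReC (v%:C * (normC a `^ (p - 2))%:C * a * b^*%C) =
    v * normC a `^ p - v * (normC a `^ (p - 2) * ReC (a * (a - b)^*%C)).
  rewrite -(@powR_sub2M2 _ p)// sqr_normC.
  by case: a b {a0} => [a1 a2] [b1 b2] /=; ring.
apply: lerD; first by rewrite ler_wpM2r ?powR_ge0// le_max lexx.
apply: le_trans (ler_norm _) _; rewrite normrN normrM ler_wpM2l//.
exact: normC_powR_dot_le.
Qed.

(** Used with [s = p] for gradients, and with [s = q] for the second factor of [hoelder_potential]
    when [w] has the form [f^(p-1) h]. *)
Lemma hoelder_pm1 (s : R) (f h : 'rV[R]_n -> R) : 0 < s ->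
  measurable_fun D f -> measurable_fun D h -> (forall x, 0 <= f x) -> (forall x, 0 <= h x) ->
  ((\int[mu]_(x in D) ((f x `^ (p - 1) * h x) `^ (s / p))%:E) `^ (p / s) <=
   LnormD D s%:E f `^ (p - 1) * LnormD D s%:E h)%E.
Proof.
move=> s0 mf mh f0 h0.
have a0 : 0 < (p - 1) / p by rewrite divr_gt0// subr_gt0.
have b0 : 0 < p^-1 by rewrite invr_gt0.
have ab : (p - 1) / p + p^-1 = 1 by field; rewrite gt_eqF.
rewrite [X in (X `^ _ <= _)%E](_ : _ = (\int[mu]_(x in D)
    ((`|f x| `^ s)%:E `^ ((p - 1) / p) * (`|h x| `^ s)%:E `^ p^-1))%E); last first.
  apply: eq_integral => x _; rewrite !poweR_EFin -EFinM -!powRrM powRM ?powR_ge0//.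
  rewrite -powRrM !ger0_norm//; congr ((_ `^ _ * _)%:E).
  by field; rewrite gt_eqF.
have ps0 : 0 <= p / s by rewrite divr_ge0 ?(ltW p0) ?(ltW s0).
apply: le_trans (le_poweR ps0 _ (geometric_hoelder mu mD a0 b0 ab
  (measurable_normr_powR s mf) (measurable_normr_powR s mh) _ _)) _.
- by apply: integral_ge0 => x _; rewrite mule_ge0 ?poweR_ge0.
- by move=> x _; rewrite lee_fin powR_ge0.
- by move=> x _; rewrite lee_fin powR_ge0.
rewrite poweRM ?poweR_ge0// -!(poweR_LnormD D _ (lt0r_neq0 s0)) -!poweRrM.
have -> : s * ((p - 1) / p * (p / s)) = p - 1 by field; rewrite (gt_eqF p0) (gt_eqF s0).
have -> : s * (p^-1 * (p / s)) = 1 by field; rewrite (gt_eqF p0) (gt_eqF s0).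
by rewrite [X in (_ * X <= _)%E]poweRe1// LnormD_ge0.
Qed.

Lemma ge0_integrable_lty (f : 'rV[R]_n -> R) : measurable_fun D f -> (forall x, 0 <= f x) ->
  (\int[mu]_(x in D) (f x)%:E < +oo)%E -> mu.-integrable D (EFin \o f).
Proof.
move=> mf f0 foo; apply/integrableP; split; first exact/measurable_EFinP.
by under eq_integral do rewrite /= ger0_norm//.
Qed.

Lemma integral_pm1_le (f h : 'rV[R]_n -> R) :
  measurable_fun D f -> measurable_fun D h -> (forall x, 0 <= f x) -> (forall x, 0 <= h x) ->
  (\int[mu]_(x in D) (f x `^ (p - 1) * h x)%:E <=
   LnormD D p%:E f `^ (p - 1) * LnormD D p%:E h)%E.
Proof.
move=> mf mh f0 h0; have := hoelder_pm1 p0 mf mh f0 h0.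
rewrite divff ?(lt0r_neq0 p0)// poweRe1; last first.
  by apply: integral_ge0 => x _; rewrite lee_fin powR_ge0.
by under eq_integral do rewrite powRr1 ?mulr_ge0 ?powR_ge0//.
Qed.

Lemma measurable_pm1 (f h : 'rV[R]_n -> R) : measurable_fun D f -> measurable_fun D h ->
  measurable_fun D (fun x => f x `^ (p - 1) * h x).
Proof.
by move=> mf mh; apply: measurable_funM => //; exact: (measurableT_comp (measurable_powR _)).
Qed.

Section inequality.
Variables (V : 'rV[R]_n -> R) (u : 'rV[R]_n -> R[i]) (g : 'rV[R]_n -> 'rV[R[i]]_n).
Hypotheses (LV : LpD D r V) (W : W01p D p u g) (ntu : nontrivial D u)
  (sol : weak_solution D p V u g).

Let mV : measurable_fun D V. Proof. by case: LV. Qed.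
Let mu_ : cmeasurable D u. Proof. by case: W => -[]. Qed.
Let mg i : cmeasurable D (fun x => g x ord0 i). Proof. by case: W => -[]. Qed.
Let goo : (LnormD D p%:E (enorm \o g) < +oo)%E. Proof. by case: W => -[]. Qed.
Let uoo : (cLnormD D q%:E u < +oo)%E.
Proof.
have [C C0 /(_ _ _ W) H] := sobolev_W01p p1 pn pq qpn mD Doo.
by apply: le_lt_trans H _; rewrite lte_mul_pinfty.
Qed.

Let mnu : measurable_fun D (normC \o u). Proof. exact: measurable_normC. Qed.
Let mng : measurable_fun D (enorm \o g). Proof. exact: measurable_enorm. Qed.

Let mVp : measurable_fun D (V^\+)%R. Proof. exact: measurable_funrpos. Qed.

Let hoelderV (A : 'rV[R]_n -> R) (w h : 'rV[R]_n -> R) :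
  measurable_fun D A -> measurable_fun D w -> measurable_fun D h ->
  (forall x, 0 <= w x) -> (forall x, 0 <= h x) ->
  (\int[mu]_(x in D) (`|A x| * (w x `^ (p - 1) * h x))%:E <=
   LnormD D r A * (LnormD D q%:E w `^ (p - 1) * LnormD D q%:E h))%E.
Proof.
move=> mA mw mh w0 h0.
apply: le_trans (hoelder_potential mD p0 q0 cpq mA _ _) _.
- apply: measurable_funM => //; exact: (measurableT_comp (measurable_powR _)).
- by move=> x _; rewrite mulr_ge0 ?powR_ge0.
by apply: lee_wpmul2l; [exact: LnormD_ge0|exact: hoelder_pm1].
Qed.

(** Integrating the two pointwise bounds at the test function [phi k] leaves errors [‖dg k‖_p] and
    [‖du k‖_q]. The second is at most [C ‖dg k‖_p], because [u - phi k] again lies in W_0^{1,p}. The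
    integrand on the right has the shape that [hoelderV] takes. *)
Let energy_le : (\int[mu]_(x in D) (enorm (g x) `^ p)%:E <=
  \int[mu]_(x in D) (`|V^\+%R x| * (normC (u x) `^ (p - 1) * normC (u x)))%:E)%E.
Proof.
have [C C0 HC] := sobolev_W01p p1 pn pq qpn mD Doo.
have [_ [phi tphi [_ cg]]] := W.
have Goo : (LnormD D p%:E (enorm \o g) `^ (p - 1) < +oo)%E by exact: poweR_lty.
have Uoo : (LnormD D r V * cLnormD D q%:E u `^ (p - 1) < +oo)%E.
  by rewrite lte_mul_pinfty ?LnormD_ge0 ?poweR_lty ?ge0_fin_numE ?LnormD_ge0//; case: LV.
set c1 := (LnormD D p%:E (enorm \o g) `^ (p - 1))%E in Goo.
set c2 := (LnormD D r V * cLnormD D q%:E u `^ (p - 1))%E in Uoo.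
have c10 : (0 <= c1)%E by exact: poweR_ge0.
have c20 : (0 <= c2)%E by rewrite mule_ge0 ?LnormD_ge0 ?poweR_ge0.
have c1E : c1 = (fine c1)%:E by rewrite fineK// ge0_fin_numE.
have c2E : c2 = (fine c2)%:E by rewrite fineK// ge0_fin_numE.
pose dg k := enorm \o (g \- cgradient (phi k)).
pose du k := normC \o (u \- phi k).
apply: (@le_of_cvg0 _ _ _ _ (fun=> 0%E) (fine c1 + fine c2 * C) 0 1 _ _ _ _ cg) => //.
- by rewrite addr_ge0 ?mulr_ge0 ?fine_ge0.
- exact: cvg_cst.
move=> k; rewrite mul0e adde0.
have tN := test_functionZ (-1) (tphi k).
have duE : du k = normC \o (fun x => u x + (-1)%:C * phi k x).
  by apply/funext => x; rewrite /du /= rmorphN1 mulN1r.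
have dgE : dg k = enorm \o (fun x => g x + cgradient (fun x => (-1)%:C * phi k x) x).
  apply/funext => x; congr (enorm _); apply/rowP => i.
  by rewrite !mxE (cpartialZ _ i x (tphi k)) rmorphN1 mulN1r.
have Wk := W01pD_test mD Doo p1 W tN.
have duC : (LnormD D q%:E (du k) <= C%:E * LnormD D p%:E (dg k))%E.
  by rewrite duE dgE; exact: HC Wk.
have mdu : measurable_fun D (du k) by rewrite duE; apply: measurable_normC; case: Wk => -[].
have mdg : measurable_fun D (dg k) by rewrite dgE; apply: measurable_enorm; case: Wk => -[].
have dgoo : (LnormD D p%:E (dg k) < +oo)%E by rewrite dgE; case: Wk => -[].
have du0 x : 0 <= du k x by exact: normC_ge0.
have dg0 x : 0 <= dg k x by exact: enorm_ge0.
have nu0 x : 0 <= normC (u x) by exact: normC_ge0.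
have ng0 x : 0 <= enorm (g x) by exact: enorm_ge0.
pose E x := enorm (g x) `^ (p - 1) * dg k x.
pose F x := `|V x| * (normC (u x) `^ (p - 1) * du k x).
pose S x := `|V^\+%R x| * (normC (u x) `^ (p - 1) * normC (u x)).
have ES : (\int[mu]_(x in D) (E x)%:E <= (fine c1)%:E * LnormD D p%:E (dg k))%E.
  by rewrite -c1E; exact: integral_pm1_le.
have FS : (\int[mu]_(x in D) (F x)%:E <= (fine c2 * C)%:E * LnormD D p%:E (dg k))%E.
  apply: le_trans (hoelderV mV mnu mdu nu0 du0) _.
  rewrite muleA; apply: (@le_trans _ _ (c2 * (C%:E * LnormD D p%:E (dg k)))%E).
    exact: (lee_wpmul2l c20 duC).
  by rewrite EFinM {1}c2E muleA.
have mnV (f : 'rV[R]_n -> R) : measurable_fun D f -> measurable_fun D (fun x => `|f x|).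
  by move=> mf; apply: measurableT_comp => //; exact: normr_measurable.
have fin_lty (c : R) (x : \bar R) : (x <= c%:E * LnormD D p%:E (dg k))%E -> 0 <= c -> (x < +oo)%E.
  by move=> xc cc; apply: le_lt_trans xc _; rewrite lte_mul_pinfty.
have iE : mu.-integrable D (EFin \o E).
  apply: ge0_integrable_lty; [exact: measurable_pm1|by move=> x; rewrite mulr_ge0 ?powR_ge0|].
  by apply: fin_lty ES _; exact: fine_ge0.
have iF : mu.-integrable D (EFin \o F).
  apply: ge0_integrable_lty.
  - by apply: measurable_funM; [exact: mnV|exact: measurable_pm1].
  - by move=> x; rewrite !mulr_ge0 ?powR_ge0.
  - by apply: fin_lty FS _; rewrite mulr_ge0 ?fine_ge0.
have iS : mu.-integrable D (EFin \o S).
  apply: ge0_integrable_lty.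
  - by apply: measurable_funM; [exact: mnV|exact: measurable_pm1].
  - by move=> x; rewrite !mulr_ge0 ?powR_ge0.
  - apply: le_lt_trans (_ : _ < +oo)%E; last first.
      apply: (_ : (LnormD D r V * (cLnormD D q%:E u `^ (p - 1) * cLnormD D q%:E u) < +oo)%E).
      by rewrite muleA -[X in (X * _ < _)%E]/c2 c2E lte_mul_pinfty// lee_fin fine_ge0.
    apply: le_trans (hoelderV mV mnu mnu nu0 nu0).
    apply: ge0_le_integral => //.
    + by move=> x _; rewrite lee_fin !mulr_ge0 ?powR_ge0.
    + by apply/measurable_EFinP; apply: measurable_funM; [exact: mnV|exact: measurable_pm1].
    + by apply/measurable_EFinP; apply: measurable_funM; [exact: mnV|exact: measurable_pm1].
    move=> x _; rewrite lee_fin ler_wpM2r ?mulr_ge0 ?powR_ge0//.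
    rewrite ger0_norm ?funrpos_ge0// /funrpos ge_max normr_ge0 andbT; exact: ler_norm.
have iP : mu.-integrable D (EFin \o (fun x => enorm (g x) `^ p)).
  apply: eq_integrable (LnormD_fin_integrable_powR p0 mng goo) => // x _.
  by rewrite /= ger0_norm.
have [[iL _] [iR _] LR] := sol (test_function_conj (tphi k)).
have toR (f : 'rV[R]_n -> R) : mu.-integrable D (EFin \o f) ->
    (\int[mu]_(x in D) (f x)%:E)%E = (\int[mu]_(x in D) f x)%:E.
  by move=> i_f; rewrite /Rintegral fineK//; exact: integrable_fin_num i_f.
rewrite (toR _ iP) -/S (toR _ iS).
apply: (@le_trans _ _ ((\int[mu]_(x in D) S x)%:E +
    (\int[mu]_(x in D) (E x)%:E + \int[mu]_(x in D) (F x)%:E))%E); last first.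
  by apply: leeD2l; rewrite EFinD ge0_muleDl ?lee_fin ?mulr_ge0 ?fine_ge0//; exact: leeD.
rewrite (toR _ iE) (toR _ iF) -!EFinD lee_fin.
rewrite [X in _ + X]addrC addrA -(RintegralD mD iS iF) -lerBlDr -(RintegralB mD iP iE).
have iSF : mu.-integrable D (EFin \o (fun x => S x + F x)) by exact: (integrableD mD iS iF).
have iPE : mu.-integrable D (EFin \o (fun x => enorm (g x) `^ p - E x)).
  exact: (integrableB mD iP iE).
apply: (@le_trans _ _ (ReC (cintegral D (fun x => (enorm (g x) `^ (p - 2))%:C *
    (\sum_i g x ord0 i * cgradient (fun x0 => (phi k x0)^*%C) x ord0 i))))).
  apply: le_Rintegral => // x Dx; apply: le_trans (ReC_dot_conj_ge _ (cgradient (phi k) x)) _.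
  rewrite [leRHS]ReCM/= mul0r subr0 le_eqVlt; apply/orP; left; apply/eqP.
  congr (_ * ReC _); apply: eq_bigr => i _; congr (_ * _).
  by rewrite !mxE (cpartial_conj i x (tphi k)).
rewrite LR; apply: le_Rintegral => // x Dx.
apply: le_trans (ReC_potential_le _ _ _) _; rewrite lerD2r /S /funrpos.
rewrite ger0_norm ?le_max ?lexx ?orbT//.
by rewrite -[in leLHS](mulr_powRB1 (nu0 x) p0) [X in _ <= _ * X]mulrC.
Qed.

Lemma lower_bound_ineq : (1 <= sobolev_constant D q p `^ p * LnormD D r (V^\+)%R)%E.
Proof.
set K := sobolev_constant D q p; set G := LnormD D p%:E (enorm \o g).
have G0 : (0 < G)%E := gradient_LnormD_gt0 p1 pn pq qpn mD Doo W ntu.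
have K0 : (0 < K)%E := sobolev_constant_gt0 p1 pn pq qpn mD Doo W ntu.
have Gp0 : (0 < G `^ p)%E by exact: poweR_gt0.
have Gfin : (G `^ p)%E \is a fin_num by rewrite ge0_fin_numE ?poweR_lty// ltW.
(* The factor [G^p], the energy of [u], is positive because [u] is nontrivial, and finite; it may be
   cancelled from both sides. *)
rewrite -(@lee_pmul2r _ _ Gfin Gp0) mul1e.
have GE : (G `^ p = \int[mu]_(x in D) (enorm (g x) `^ p)%:E)%E.
  rewrite (poweR_LnormD D _ (lt0r_neq0 p0)); apply: eq_integral => x _.
  by rewrite /= ger0_norm// enorm_ge0.
rewrite [leLHS]GE; apply: le_trans energy_le _.
apply: le_trans (hoelderV mVp mnu mnu (fun x => normC_ge0 _) (fun x => normC_ge0 _)) _.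
have -> : (LnormD D q%:E (normC \o u) `^ (p - 1) * LnormD D q%:E (normC \o u) =
    cLnormD D q%:E u `^ p)%E.
  rewrite -[X in (_ * X)%E]poweRe1 ?LnormD_ge0// -poweRD ?subrK//.
  by apply: add_neq0_poweRD_def; rewrite subrK gt_eqF.
rewrite -muleA muleCA; apply: lee_wpmul2l; first exact: LnormD_ge0.
rewrite -poweRM ?(ltW K0) ?(ltW G0)//; apply: le_poweR; rewrite ?(ltW p0) ?LnormD_ge0//.
exact: (le_sobolev_constant p1 pn pq qpn mD Doo W ntu).
Qed.

End inequality.

End lower_bound.

(** * The extremal *)

Section first_variation.
Context {R : realType}.

(** The tangent to the convex function [v^s] at [y] lies below it at [1]. After expansion this is
    Young's inequality [s y^(s-1) <= (s-1) y^s + 1]. *)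
Lemma powR_tangent_le (s y : R) : 1 <= s -> 0 <= y -> y `^ s <= 1 + s * (y - 1) * y `^ (s - 1).
Proof.
move=> s1 y0; have s0 : 0 < s by lra.
suff H : s * y `^ (s - 1) <= (s - 1) * y `^ s + 1.
  by rewrite -mulrA mulrBl mul1r (mulr_powRB1 y0 s0); move: H; nra.
have [->|sn1] := eqVneq s 1; first by rewrite subrr powRr0 mul0r add0r mul1r.
have {}s1 : 1 < s by rewrite lt_def sn1.
have s10 : 0 < s - 1 by rewrite subr_gt0.
have := @conjugate_powR _ (y `^ (s - 1)) 1 (s / (s - 1)) s (powR_ge0 _ _) ler01 (divr_gt0 s0 s10) s0.
have -> : (s / (s - 1))^-1 + s^-1 = 1 by field; rewrite (lt0r_neq0 s10) (lt0r_neq0 s0).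
move=> /(_ erefl); rewrite mulr1 powR1 -powRrM.
have -> : (s - 1) * (s / (s - 1)) = s by field; rewrite (lt0r_neq0 s10).
rewrite -(ler_pM2l s0) => /le_trans; apply; rewrite mulrDr mul1r mulfV ?(lt0r_neq0 s0)// lerD2r.
rewrite le_eqVlt; apply/orP; left; apply/eqP.
by field; rewrite (lt0r_neq0 s10) (lt0r_neq0 s0).
Qed.

(** With [y = 1 + p t al], the tangent inequality gives [y^(q/p) <= 1 + q t al y^(q/p - 1)].
    Subtract [k], divide by [q t], and let [y] tend to [1]. *)
Lemma first_variation_le (p q k a b : R) (t al : nat -> R) :
  1 < p -> p <= q -> 0 < k -> (forall j, 0 < t j) -> t j @[j --> \oo] --> 0 ->
  al j @[j --> \oo] --> a ->
  (forall j, 0 <= 1 + p * (t j * al j)) ->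
  (forall j, k + q * (t j * b) <= k * (1 + p * (t j * al j)) `^ (q / p)) ->
  b <= k * a.
Proof.
move=> p1 pq k0 t0 tc alc y0 H; have p0 : 0 < p by lra.
have q0 : 0 < q by lra.
have s1 : 1 <= q / p by rewrite ler_pdivlMr// mul1r.
pose y j := 1 + p * (t j * al j).
have yc : y j @[j --> \oo] --> (1 : R).
  have -> : (1 : R) = 1 + p * (0 * a) by rewrite mul0r mulr0 addr0.
  by apply: cvgD; [exact: cvg_cst|apply: cvgM; [exact: cvg_cst|exact: cvgM]].
have ysc : `|y j| `^ (q / p - 1) @[j --> \oo] --> `|1 : R| `^ (q / p - 1).
  exact: (cvg_comp y (fun v : R => `|v| `^ (q / p - 1)) yc (@continuous_normr_powR_neq0 _ _ _ (oner_neq0 R))).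
rewrite normr1 powR1 in ysc.
have -> : k * a = k * (a * 1) by rewrite mulr1.
apply: (@ler_cvg_to _ \oo _ _ (fun=> b) (fun j => k * (al j * `|y j| `^ (q / p - 1)))).
- exact: cvg_cst.
- by apply: cvgM; [exact: cvg_cst|exact: cvgM].
apply: nearW => j; have qt : 0 < q * t j by rewrite mulr_gt0.
rewrite (ger0_norm (y0 j)) -(ler_pM2l qt) -(lerD2l k).
rewrite -{1}mulrA; apply: le_trans (H j) _.
apply: (@le_trans _ _ (k * (1 + q / p * (y j - 1) * y j `^ (q / p - 1)))).
  by rewrite ler_pM2l//; exact: powR_tangent_le s1 (y0 j).
rewrite /y le_eqVlt; apply/orP; left; apply/eqP.
set z := (_ `^ (q / p - 1)); have -> : 1 + p * (t j * al j) - 1 = p * (t j * al j) by ring.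
by field; rewrite (lt0r_neq0 p0).
Qed.

End first_variation.

Section enorm_derivative.
Context {R : realType} {n : nat}.
Local Notation ReC := (@complex.Re R).
Implicit Types (a b : 'rV[R[i]]_n).

Lemma enormZ (c : R) a : enorm (c%:C *: a) = `|c| * enorm a.
Proof.
apply/eqP; rewrite -(eqrXn2 (n := 2)) ?mulr_ge0 ?enorm_ge0//; apply/eqP.
rewrite exprMn !sqr_enorm mulr_sumr; apply: eq_bigr => i _.
by rewrite mxE ComplexField.Normc.normcM normC_real exprMn.
Qed.

Lemma ReC_dotDZ (c : R) a b :
  ReC (\sum_i (a + c%:C *: b) ord0 i * (b ord0 i)^*%C) =
  ReC (\sum_i a ord0 i * (b ord0 i)^*%C) + c * enorm b ^+ 2.
Proof.
have -> : c * enorm b ^+ 2 = ReC (c%:C * \sum_i b ord0 i * (b ord0 i)^*%C).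
  by rewrite dot_conj ReCM/= mul0r subr0.
rewrite mulr_sumr -ReCD -big_split/=; congr ReC; apply: eq_bigr => i _.
by rewrite !mxE mulrDl mulrA.
Qed.

(** Where [a] is nonzero both factors converge. Where [a = 0] the weight may blow up, but the
    product is at most [|z|^(p-1) |b|], which tends to [0]. *)
Lemma enorm_powR_dot_cvg (p : R) a b (t : nat -> R) : 1 < p -> t j @[j --> \oo] --> 0 ->
  enorm (a + (t j)%:C *: b) `^ (p - 2) *
    ReC (\sum_i (a + (t j)%:C *: b) ord0 i * (b ord0 i)^*%C) @[j --> \oo] -->
  enorm a `^ (p - 2) * ReC (\sum_i a ord0 i * (b ord0 i)^*%C).
Proof.
move=> p1 t0; pose z j := a + (t j)%:C *: b.
have tb : `|t j| * enorm b @[j --> \oo] --> 0.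
  rewrite -(mul0r (enorm b)) -(normr0 R).
  by apply: cvgM; [exact: cvg_norm|exact: cvg_cst].
have zc : enorm (z j) @[j --> \oo] --> enorm a.
  apply: (@squeeze_cvgr _ _ _ _ (fun j => enorm a - `|t j| * enorm b) (fun j => enorm a + `|t j| * enorm b)).
  - apply: nearW => j; rewrite -enormZ enorm_triangle andbT lerBlDr.
    by rewrite -(enormN ((t j)%:C *: b)) -{1}(addrK ((t j)%:C *: b) a) enorm_triangle.
  - by rewrite -[X in _ --> X]subr0; apply: cvgB => //; exact: cvg_cst.
  - by rewrite -[X in _ --> X]addr0; apply: cvgD => //; exact: cvg_cst.
have zpc c : 0 < c \/ enorm a != 0 -> enorm (z j) `^ c @[j --> \oo] --> enorm a `^ c.
  move=> ca; rewrite -(ger0_norm (enorm_ge0 a)).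
  have -> : (fun j => enorm (z j) `^ c) = fun j => `|enorm (z j)| `^ c.
    by apply/funext => j; rewrite ger0_norm ?enorm_ge0.
  apply: (cvg_comp (enorm \o z) (fun v : R => `|v| `^ c) zc).
  by case: ca => ?; [exact: continuous_normr_powR|exact: continuous_normr_powR_neq0].
have [a0|a0] := eqVneq (enorm a) 0; last first.
  apply: cvgM; first by apply: zpc; right.
  rewrite (_ : (fun j => ReC _) = fun j => ReC (\sum_i a ord0 i * (b ord0 i)^*%C) + t j * enorm b ^+ 2).
    rewrite -[X in _ --> X]addr0 -(mul0r (enorm b ^+ 2)).
    by apply: cvgD; [exact: cvg_cst|apply: cvgM => //; exact: cvg_cst].
  by apply/funext => j; exact: ReC_dotDZ.
have -> : enorm a `^ (p - 2) * ReC (\sum_i a ord0 i * (b ord0 i)^*%C) = 0.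
  apply/eqP; rewrite -normr_le0; apply: le_trans (enorm_powR_dot_le a b p1) _.
  by rewrite a0 powR0 ?mul0r// subr_eq0 gt_eqF.
have p10 : 0 < p - 1 by rewrite subr_gt0.
have bc : enorm (z j) `^ (p - 1) * enorm b @[j --> \oo] --> 0.
  rewrite -(mul0r (enorm b)) -(powR0 (lt0r_neq0 p10)) -[X in X `^ (p - 1)]a0.
  by apply: cvgM; [apply: zpc; left|exact: cvg_cst].
have bcN : - (enorm (z j) `^ (p - 1) * enorm b) @[j --> \oo] --> 0.
  by rewrite -[X in _ --> X]oppr0; exact: cvgN.
apply: (squeeze_cvgr _ bcN bc); apply: nearW => j.
by rewrite -ler_norml; exact: enorm_powR_dot_le.
Qed.

End enorm_derivative.

(** * Convergence of the first variation of the energy *)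

Section energy.
Context {R : realType} {n : nat}.
Variables (D : set 'rV[R]_n) (mD : measurable D) (p : R) (p1 : 1 < p).
Local Notation mu := (lebesgue_rV R n).
Local Notation ReC := (@complex.Re R).
Implicit Types (g h : 'rV[R]_n -> 'rV[R[i]]_n).
Local Notation pairing a b := (enorm a `^ (p - 2) * ReC (\sum_i a ord0 i * (b ord0 i)^*%C)).

Lemma integrable_pm1 (f k : 'rV[R]_n -> R) : measurable_fun D f -> measurable_fun D k ->
  (forall x, 0 <= f x) -> (forall x, 0 <= k x) ->
  (LnormD D p%:E f < +oo)%E -> (LnormD D p%:E k < +oo)%E ->
  mu.-integrable D (EFin \o (fun x => f x `^ (p - 1) * k x)).
Proof.
move=> mf mk f0 k0 foo koo; apply: ge0_integrable_lty; first exact: measurable_pm1.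
  by move=> x; rewrite mulr_ge0 ?powR_ge0.
apply: le_lt_trans (integral_pm1_le p1 mD mf mk f0 k0) _.
by rewrite lte_mul_pinfty ?poweR_ge0// ge0_fin_numE ?poweR_ge0 ?poweR_lty.
Qed.

Lemma measurable_pairing g h : (forall i, cmeasurable D (fun x => g x ord0 i)) ->
  (forall i, cmeasurable D (fun x => h x ord0 i)) ->
  measurable_fun D (fun x => pairing (g x) (h x)).
Proof.
move=> mg mh; apply: measurable_funM.
  exact: (measurableT_comp (measurable_powR _) (measurable_enorm mg)).
have [m _] := cmeasurable_sum (index_enum 'I_n) (fun i => cmeasurableM (mg i) (cmeasurable_conj (mh i))).
exact: m.
Qed.

Lemma integrable_pairing g h : (forall i, cmeasurable D (fun x => g x ord0 i)) ->
  (forall i, cmeasurable D (fun x => h x ord0 i)) ->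
  (LnormD D p%:E (enorm \o g) < +oo)%E -> (LnormD D p%:E (enorm \o h) < +oo)%E ->
  mu.-integrable D (EFin \o (fun x => pairing (g x) (h x))).
Proof.
move=> mg mh goo hoo.
apply: (integrable_le mD (measurable_pairing mg mh) (h := fun x => enorm (g x) `^ (p - 1) * enorm (h x))).
  apply: integrable_pm1 => //; try exact: measurable_enorm; by move=> x; exact: enorm_ge0.
by move=> x _; exact: enorm_powR_dot_le.
Qed.

Lemma cmeasurableDZ g h (c : R) i : (forall i, cmeasurable D (fun x => g x ord0 i)) ->
  (forall i, cmeasurable D (fun x => h x ord0 i)) ->
  cmeasurable D (fun x => (g x + c%:C *: h x) ord0 i).
Proof.
move=> mg mh; rewrite (_ : (fun x => _) = fun x => g x ord0 i + c%:C * h x ord0 i).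
  apply: cmeasurableD => //; apply: cmeasurableM => //.
  by apply: cmeasurable_real; exact: measurable_cst.
by apply/funext => x; rewrite !mxE.
Qed.

Lemma pairing_integral_cvg g h (t : nat -> R) :
  (forall i, cmeasurable D (fun x => g x ord0 i)) ->
  (forall i, cmeasurable D (fun x => h x ord0 i)) ->
  (LnormD D p%:E (enorm \o g) < +oo)%E -> (LnormD D p%:E (enorm \o h) < +oo)%E ->
  (forall j, `|t j| <= 1) -> t j @[j --> \oo] --> 0 ->
  \int[mu]_(x in D) pairing (g x + (t j)%:C *: h x) (h x) @[j --> \oo] -->
  \int[mu]_(x in D) pairing (g x) (h x).
Proof.
move=> mg mh goo hoo t1 t0.
pose f j x := (pairing (g x + (t j)%:C *: h x) (h x))%:E.
(* Dominates every [f j] because [|t j| <= 1], and is integrable by Hoelder's inequality. *)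
pose b x := (enorm (g x) + enorm (h x)) `^ (p - 1) * enorm (h x).
have mng := measurable_enorm mg; have mnh := measurable_enorm mh.
have mgh : measurable_fun D (fun x => enorm (g x) + enorm (h x)) by exact: measurable_funD.
have ib : mu.-integrable D (EFin \o b).
  apply: integrable_pm1 => //; try by move=> x; rewrite ?addr_ge0 ?enorm_ge0.
  apply: le_lt_trans (LnormD_triangle mD (ltW p1) mgh mng mnh _) _.
    by move=> x _; rewrite !ger0_norm ?addr_ge0 ?enorm_ge0.
  by rewrite lte_add_pinfty.
have mf j : measurable_fun D (f j).
  by apply/measurable_EFinP; apply: measurable_pairing => // i; exact: cmeasurableDZ.
have mf0 : measurable_fun D (fun x => (pairing (g x) (h x))%:E).
  by apply/measurable_EFinP; exact: measurable_pairing.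
have fc : \forall x \ae mu, D x -> f j x @[j --> \oo] --> (pairing (g x) (h x))%:E.
  apply: nearW => x _; apply: cvg_EFin; first exact: nearW.
  exact: (@enorm_powR_dot_cvg _ _ p (g x) (h x) t p1 t0).
have fb : \forall x \ae mu, forall j, D x -> (`|f j x| <= (EFin \o b) x)%E.
  apply: nearW => x j _; rewrite lee_fin; apply: le_trans (enorm_powR_dot_le _ _ p1) _.
  rewrite ler_wpM2r ?enorm_ge0//.
  apply: ge0_ler_powR; rewrite ?nnegrE ?enorm_ge0//.
  - by rewrite subr_ge0 ltW.
  - by rewrite addr_ge0 ?enorm_ge0.
  apply: le_trans (enorm_triangle _ _) _; rewrite lerD2l enormZ ler_piMl ?enorm_ge0//.
have [i0 _ C] := dominated_convergence mD mf mf0 fc ib fb.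
apply: fine_cvg; rewrite /Rintegral fineK; first exact: C.
exact: (integrable_fin_num mD i0).
Qed.

End energy.

(** * Positivity of [K] *)

Section sobolev_constant_pos.
Context {R : realType} {n : nat}.
Variables (p q : R) (p1 : 1 < p) (pn : p < n%:R) (pq : p <= q).
Hypothesis qpn : q * (n%:R - p) < n%:R * p.
Variables (D : set 'rV[R]_n) (mD : measurable D).
Local Notation mu := (lebesgue_rV R n).
Hypothesis Doo : (mu D < +oo)%E.
Local Notation ReC := (@complex.Re R).
Local Notation normC := (@ComplexField.Normc.normc R).

Let p0 : 0 < p. Proof. exact: lt_trans p1. Qed.

(* Integrate [phi] against the conjugate of [d_i d_i phi] by parts. *)
Lemma trivial_test_gradient phi : test_function D phi ->
  {ae mu, forall x, D x -> phi x = 0} -> LnormD D p%:E (enorm \o cgradient phi) = 0%E.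
Proof.
move=> tp phi0.
have mc i := cmeasurable_cpartial i tp mD.
have d0 i : {ae mu, forall x, D x -> cpartial i phi x = 0}.
  have tpi := test_function_cpartial i tp.
  have := test_function_weak_gradient mD tp (test_function_conj tpi) i.
  set E := fun x => _ * _; set F := fun x => _ * _ => EF.
  have mE : measurable_fun D (ReC \o E).
    have tpp := test_function_cpartial i (test_function_conj tpi).
    by have [] := cmeasurableM (cmeasurable_test tp mD) (cmeasurable_test tpp mD).
  have E0 : ReC (cintegral D E) = 0.
    rewrite /= /Rintegral (ae_eq_integral (cst 0%E)) ?integral0//; first exact/measurable_EFinP.
    by apply: filterS phi0 => x H Dx; rewrite /= /E H// mul0r.
  have FE x : ReC (F x) = normC (cpartial i phi x) ^+ 2.
    by rewrite /F mxE ReCM ReCJ ImCJ sqr_normC mulrN opprK !expr2.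
  have m2 : measurable_fun D (fun x => normC (cpartial i phi x) ^+ 2).
    by apply: measurable_funX; exact: measurable_normC (mc i).
  have i2 : mu.-integrable D (EFin \o (fun x => normC (cpartial i phi x) ^+ 2)).
    have [B _ HB] := test_function_bounded tpi.
    apply: (integrable_le mD m2 (integrable_cst_finite mD Doo (B ^+ 2))) => x _.
    by rewrite normrX ger0_norm ?normC_ge0// lerXn2r ?nnegrE ?normC_ge0// (le_trans (normC_ge0 _) (HB x)).
  have F0 : (\int[mu]_(x in D) (normC (cpartial i phi x) ^+ 2)%:E = 0)%E.
    rewrite -(fineK (integrable_fin_num mD i2)); congr EFin.
    move: E0; rewrite EF ReCN => /eqP; rewrite oppr_eq0 => /eqP <-.
    by apply: eq_Rintegral => x _; rewrite FE.
  apply: contrapT => nt; have := cLnormD_gt0 mD (ltr0n R 2) (mc i) nt.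
  rewrite /cLnormD (LnormDE D _ (lt0r_neq0 (ltr0n R 2))).
  under eq_integral do rewrite (ger0_norm (normC_ge0 _)) powR_mulrn ?normC_ge0//.
  by rewrite F0 poweR0r ?ltxx// invr_eq0 pnatr_eq0.
rewrite (LnormDE D _ (lt0r_neq0 p0)).
rewrite (ae_eq_integral (cst 0%E)) ?integral0 ?poweR0r ?invr_neq0 ?(lt0r_neq0 p0)//.
  by apply: measurable_normr_powR; apply: measurable_enorm => i; exact: cmeasurable_cgradient tp mD.
have /filterS : {ae mu, forall x i, D x -> cpartial i phi x = 0}.
  exact: (@filter_forall _ _ (fun i x => D x -> cpartial i phi x = 0)).
apply => x H Dx /=; rewrite (_ : cgradient phi x = 0) ?enorm0 ?normr0 ?powR0 ?(lt0r_neq0 p0)//.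
by apply/rowP => i; rewrite !mxE H.
Qed.

(** Here [u] is not known to be nontrivial. A test function whose gradient is closer to [g] than the
    norm of [g] is nontrivial: otherwise its gradient would be null, and the distance would be at
    least the norm of [g]. *)
Lemma sobolev_constant_gt0_gradient u g : W01p D p u g ->
  (0 < LnormD D p%:E (enorm \o g))%E -> (0 < sobolev_constant D q p)%E.
Proof.
move=> [W [phi tphi [_ cg]]] g0.
have goo : (LnormD D p%:E (enorm \o g) < +oo)%E by case: W.
have gE : LnormD D p%:E (enorm \o g) = (fine (LnormD D p%:E (enorm \o g)))%:E.
  by rewrite fineK// ge0_fin_numE// ltW.
have [k gk] : exists k, (LnormD D p%:E (enorm \o (g \- cgradient (phi k))%R) < LnormD D p%:E (enorm \o g))%E.
  rewrite gE; apply: (@filter_ex _ \oo).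
  by apply: near_lt_cvg0 cg; rewrite -lte_fin -gE.
apply: (sobolev_constant_gt0 p1 pn pq qpn mD Doo (W01p_test mD Doo p1 (tphi k))).
move=> phi0; move: gk; rewrite ltNge => /negP; apply.
have mg i : cmeasurable D (fun x => g x ord0 i) by case: W.
have mphi i := cmeasurable_cgradient i (tphi k) mD.
have mgp : measurable_fun D (enorm \o (g \- cgradient (phi k))).
  apply: measurable_enorm => i.
  rewrite (_ : (fun x => _) = fun x => (g x + (-1)%:C *: cgradient (phi k) x) ord0 i).
    exact: cmeasurableDZ.
  by apply/funext => x; rewrite !mxE rmorphN1 mulN1r.
rewrite -[leRHS]adde0 -[X in (_ + X)%E](trivial_test_gradient (tphi k) phi0).
apply: LnormD_triangle (ltW p1) _ _ _ _ => //; try exact: measurable_enorm.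
move=> x _; rewrite /= !ger0_norm ?enorm_ge0//.
by rewrite -{1}(subrK (cgradient (phi k) x) (g x)) enorm_triangle.
Qed.

End sobolev_constant_pos.

Section scalar_tangent.
Context {R : realType} {n : nat}.
Local Notation ReC := (@complex.Re R).
Local Notation normC := (@ComplexField.Normc.normc R).

Lemma ReC_dotZ (c : R) (a b : 'rV[R[i]]_n) :
  ReC (\sum_i a ord0 i * ((c%:C *: b) ord0 i)^*%C) = c * ReC (\sum_i a ord0 i * (b ord0 i)^*%C).
Proof.
rewrite !ReC_sum mulr_sumr; apply: eq_bigr => i _; rewrite !mxE.
by case: (a _ _) (b _ _) => [a1 a2] [b1 b2] /=; ring.
Qed.

Lemma normC_powR_tangent (p : R) (x y : R[i]) : 1 < p ->
  normC x `^ p + p * (normC x `^ (p - 2) * ReC (x * y^*%C)) <= normC (x + y) `^ p.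
Proof.
move=> p1.
(* A complex number is treated as a vector of length one. *)
have E z : enorm (\row_(i < 1) z) = normC z.
  by rewrite /enorm big_ord1 mxE sqrtr_sqr ger0_norm ?normC_ge0.
have := enorm_powR_tangent (\row_(i < 1) x) (\row_(i < 1) y) p1.
rewrite big_ord1 !mxE E (_ : _ + _ = \row_(i < 1) (x + y)) ?E//.
by apply/rowP => i; rewrite !mxE.
Qed.

Lemma cgradientZ (D : set 'rV[R]_n) (c : R) eta x : test_function D eta ->
  cgradient (fun y => c%:C * eta y) x = c%:C *: cgradient eta x.
Proof. by move=> te; apply/rowP => i; rewrite !mxE (cpartialZ _ i x te). Qed.

End scalar_tangent.

(** * The variational inequality at an extremal *)

Section extremal.
Context {R : realType} {n : nat}.
Variables (p q : R) (p1 : 1 < p) (pn : p < n%:R) (pq : p <= q).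
Hypothesis qpn : q * (n%:R - p) < n%:R * p.
Variables (D : set 'rV[R]_n) (mD : measurable D).
Local Notation mu := (lebesgue_rV R n).
Hypothesis Doo : (mu D < +oo)%E.
Local Notation ReC := (@complex.Re R).
Local Notation normC := (@ComplexField.Normc.normc R).
Local Notation K := (sobolev_constant D q p).

Let p0 : 0 < p. Proof. exact: lt_trans p1. Qed.
Let q1 : 1 < q. Proof. exact: lt_le_trans pq. Qed.
Let q0 : 0 < q. Proof. exact: lt_le_trans pq. Qed.

Variables (u : 'rV[R]_n -> R[i]) (g : 'rV[R]_n -> 'rV[R[i]]_n).
Hypotheses (W : W01p D p u g) (gn : LnormD D p%:E (enorm \o g) = 1%E)
  (uK : cLnormD D q%:E u = K).

Let k := fine K.

(** The Sobolev inequality bounds [K] above; being equal to a norm, [K] is not [-oo]. *)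
Lemma extremal_constantE : K = k%:E.
Proof.
rewrite fineK// ge0_fin_numE ?(sobolev_constant_lty p1 pn pq qpn mD Doo)//.
by rewrite -uK LnormD_ge0.
Qed.

Lemma extremal_constant_gt0 : 0 < k.
Proof.
rewrite -lte_fin -extremal_constantE.
by apply: (sobolev_constant_gt0_gradient p1 pn pq qpn mD Doo W); rewrite gn.
Qed.

(** Extends the inequality to null functions, over which the supremum does not range: a perturbation
    of [u] might be one. *)
Lemma le_extremal_constant v h : W01p D p v h ->
  (cLnormD D q%:E v <= k%:E * LnormD D p%:E (enorm \o h))%E.
Proof.
move=> Wv; rewrite -extremal_constantE.
have [v0|ntv] := pselect {ae mu, forall x, D x -> v x = 0}; last exact: le_sobolev_constant.
rewrite (cLnormD_eq0 mD q0 _ v0); last by case: Wv => -[].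
by rewrite mule_ge0 ?LnormD_ge0// extremal_constantE lee_fin ltW// extremal_constant_gt0.
Qed.

Section variation.
Variables (eta : 'rV[R]_n -> R[i]) (te : test_function D eta).

Let mu_ : cmeasurable D u. Proof. by case: W => -[]. Qed.
Let mg i : cmeasurable D (fun x => g x ord0 i). Proof. by case: W => -[]. Qed.
Let mh i : cmeasurable D (fun x => cgradient eta x ord0 i).
Proof. exact: cmeasurable_cgradient te mD. Qed.
Let mnu : measurable_fun D (normC \o u). Proof. exact: measurable_normC. Qed.
Let me : cmeasurable D eta. Proof. exact: cmeasurable_test te mD. Qed.
Let hoo : (LnormD D p%:E (enorm \o cgradient eta) < +oo)%E.
Proof. by case: (W1p_test mD Doo p1 te). Qed.
Let goo : (LnormD D p%:E (enorm \o g) < +oo)%E. Proof. by case: W => -[]. Qed.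
Let uoo : (cLnormD D q%:E u < +oo)%E. Proof. by rewrite uK extremal_constantE ltry. Qed.
Let eoo : (cLnormD D q%:E eta < +oo)%E. Proof. by case: (W1p_test mD Doo q1 te). Qed.

Lemma integrable_normC_pairing :
  mu.-integrable D (EFin \o (fun x => normC (u x) `^ (q - 2) * ReC (u x * (eta x)^*%C))).
Proof.
have mr : measurable_fun D (fun x => ReC (u x * (eta x)^*%C)).
  by have [] := cmeasurableM mu_ (cmeasurable_conj me).
apply: (integrable_le mD _ (h := fun x => normC (u x) `^ (q - 1) * normC (eta x))).
- by apply: measurable_funM mr; exact: (measurableT_comp (measurable_powR _)).
- apply: (integrable_pm1 mD q1) => //; try by move=> x; exact: normC_ge0.
  exact: measurable_normC.
by move=> x _; exact: normC_powR_dot_le.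
Qed.

Lemma extremal_variation_le :
  \int[mu]_(x in D) (normC (u x) `^ (q - 2) * ReC (u x * (eta x)^*%C)) <=
  k `^ q * \int[mu]_(x in D) (enorm (g x) `^ (p - 2) *
    ReC (\sum_i g x ord0 i * (cgradient eta x ord0 i)^*%C)).
Proof.
set b := (X in X <= _).
pose t j : R := j.+1%:R^-1.
have t0 j : 0 < t j by rewrite invr_gt0 ltr0n.
have t1 j : `|t j| <= 1 by rewrite gtr0_norm// invf_le1 ?ltr0n// ler1n.
have tc : t j @[j --> \oo] --> 0 by exact: cvg_harmonic.
pose gt j x := g x + (t j)%:C *: cgradient eta x.
pose ut j x := u x + (t j)%:C * eta x.
pose al j := \int[mu]_(x in D) (enorm (gt j x) `^ (p - 2) *
    ReC (\sum_i gt j x ord0 i * (cgradient eta x ord0 i)^*%C)).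
have k0 := extremal_constant_gt0.
have alc := pairing_integral_cvg mD p1 mg mh goo hoo t1 tc.
have Wt j : W01p D p (ut j) (gt j).
  have := W01pD_test mD Doo p1 W (test_functionZ (t j) te).
  by congr (W01p D p _ _); apply/funext => x; rewrite (cgradientZ _ _ te).
have mgt j i : cmeasurable D (fun x => gt j x ord0 i) by case: (Wt j) => -[].
have gtoo j : (LnormD D p%:E (enorm \o gt j) < +oo)%E by case: (Wt j) => -[].
have mut j : cmeasurable D (ut j) by case: (Wt j) => -[].
have utle j := le_extremal_constant (Wt j).
have utoo j : (cLnormD D q%:E (ut j) < +oo)%E.
  by apply: le_lt_trans (utle j) _; rewrite lte_mul_pinfty ?lee_fin// ltW.
have powE (s : R) (f : 'rV[R]_n -> R) : 0 < s -> (forall x, 0 <= f x) -> measurable_fun D f ->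
    (LnormD D s%:E f < +oo)%E ->
    mu.-integrable D (EFin \o (fun x => f x `^ s)) /\
    (LnormD D s%:E f `^ s = (\int[mu]_(x in D) (f x `^ s))%:E)%E.
  move=> s0 f0 mf foo.
  have i_f : mu.-integrable D (EFin \o (fun x => f x `^ s)).
    by apply: eq_integrable (LnormD_fin_integrable_powR s0 mf foo) => // x _; rewrite /= ger0_norm.
  split=> //; rewrite (poweR_LnormD D f (lt0r_neq0 s0)) /Rintegral fineK; last first.
    exact: (integrable_fin_num mD i_f).
  by apply: eq_integral => x _; rewrite ger0_norm.
have [ig IE] := powE p _ p0 (fun x => enorm_ge0 (g x)) (measurable_enorm mg) goo.
have [iu JE] := powE q _ q0 (fun x => normC_ge0 (u x)) mnu uoo.
have gtE j := powE p _ p0 (fun x => enorm_ge0 (gt j x)) (measurable_enorm (mgt j)) (gtoo j).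
have utE j := powE q _ q0 (fun x => normC_ge0 (ut j x)) (measurable_normC (mut j)) (utoo j).
pose It j := \int[mu]_(x in D) (enorm (gt j x) `^ p).
pose Jt j := \int[mu]_(x in D) (normC (ut j x) `^ q).
have It0 j : 0 <= It j by apply: Rintegral_ge0 => x _; exact: powR_ge0.
have {IE} IE : \int[mu]_(x in D) (enorm (g x) `^ p) = 1.
  by apply: EFin_inj; rewrite -IE gn poweR1r.
have {JE} JE : \int[mu]_(x in D) (normC (u x) `^ q) = k `^ q.
  by apply: EFin_inj; rewrite -JE -poweR_EFin -extremal_constantE -uK.
have JI j : Jt j <= k `^ q * It j `^ (q / p).
  rewrite -lee_fin EFinM -!poweR_EFin -[(Jt j)%:E](utE j).2 -[(It j)%:E](gtE j).2.
  rewrite -poweRrM (_ : p * (q / p) = q); last by field; rewrite (lt0r_neq0 p0).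
  rewrite -poweRM ?LnormD_ge0 ?lee_fin ?(ltW k0)//.
  by apply: le_poweR (utle j); rewrite ?LnormD_ge0 ?(ltW q0).
(* Tangent at the moving point [gt j], evaluated at [g], whose energy is [1]. *)
have Ile j : It j <= 1 + p * (t j * al j).
  have iP := integrable_pairing mD p1 (mgt j) mh (gtoo j) hoo.
  rewrite -IE -lerBlDr mulrA -(RintegralZl _ mD iP) -RintegralB//; first last.
  - exact: (integrableZl mD (p * t j) iP).
  - exact: (gtE j).1.
  apply: le_Rintegral => //.
  - exact: (integrableB mD (gtE j).1 (integrableZl mD (p * t j) iP)).
  move=> x _; have := enorm_powR_tangent (gt j x) ((- t j)%:C *: cgradient eta x) p1.
  rewrite ReC_dotZ (_ : gt j x + _ = g x); last first.
    by rewrite /gt -addrA -scalerDl -rmorphD/= subrr scale0r addr0.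
  set A := enorm (gt j x) `^ (p - 2); set B := ReC _.
  by rewrite (_ : p * (A * (- t j * B)) = - (p * t j * (A * B)))//; ring.
(* Tangent at the fixed point [u], where the integral of [|u|^q] is [k^q]. *)
have Jge j : k `^ q + q * (t j * b) <= Jt j.
  have iP := integrable_normC_pairing.
  rewrite -JE mulrA -(RintegralZl _ mD iP) -RintegralD//; last exact: (integrableZl mD (q * t j) iP).
  apply: le_Rintegral => //.
  - exact: (integrableD mD iu (integrableZl mD (q * t j) iP)).
  - exact: (utE j).1.
  move=> x _; apply: le_trans (normC_powR_tangent (u x) _ q1).
  rewrite lerD2l le_eqVlt; apply/orP; left; apply/eqP; rewrite -mulrA; congr (_ * _).
  rewrite mulrCA; congr (_ * _).
  by case: (u x) (eta x) => [x1 x2] [y1 y2] /=; ring.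
apply: (@first_variation_le _ p q (k `^ q) _ b t al p1 pq (powR_gt0 _ k0) t0 tc alc) => j.
  exact: le_trans (It0 j) (Ile j).
apply: le_trans (Jge j) (le_trans (JI j) _).
rewrite ler_wpM2l ?powR_ge0// ge0_ler_powR ?nnegrE ?divr_ge0 ?(ltW p0) ?(ltW q0)//.
exact: le_trans (It0 j) (Ile j).
Qed.

End variation.

End extremal.

(** * The Euler-Lagrange equation *)

Section euler_lagrange.
Context {R : realType} {n : nat}.
Variables (p q : R) (p1 : 1 < p) (pn : p < n%:R) (pq : p <= q).
Hypothesis qpn : q * (n%:R - p) < n%:R * p.
Variables (D : set 'rV[R]_n) (mD : measurable D).
Local Notation mu := (lebesgue_rV R n).
Hypothesis Doo : (mu D < +oo)%E.
Local Notation ReC := (@complex.Re R).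
Local Notation ImC := (@complex.Im R).
Local Notation normC := (@ComplexField.Normc.normc R).
Local Notation K := (sobolev_constant D q p).
Local Notation k := (fine K).

Let p0 : 0 < p. Proof. exact: lt_trans p1. Qed.
Let q1 : 1 < q. Proof. exact: lt_le_trans pq. Qed.
Let q0 : 0 < q. Proof. exact: lt_le_trans pq. Qed.

Local Notation flux g psi := (fun x =>
  (enorm (g x) `^ (p - 2))%:C * \sum_i g x ord0 i * cgradient psi x ord0 i).

Lemma cintegrable_flux u g psi : W01p D p u g -> test_function D psi ->
  cintegrable D (flux g psi).
Proof.
move=> [[_ _ mg goo _] _] tp; have mh i := cmeasurable_cgradient i tp mD.
apply: (cintegrable_le mD (h := fun x => enorm (g x) `^ (p - 1) * enorm (cgradient psi x))).
- apply: cmeasurableM.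
    by apply: cmeasurable_real; exact: (measurableT_comp (measurable_powR _) (measurable_enorm mg)).
  by apply: cmeasurable_sum => i; exact: cmeasurableM.
- apply: (integrable_pm1 mD p1) => //; try exact: measurable_enorm; try by move=> x; exact: enorm_ge0.
  by case: (W1p_test mD Doo p1 tp).
move=> x _; rewrite ComplexField.Normc.normcM normC_real ger0_norm ?powR_ge0//.
by rewrite -(powR_sub2M p1 (enorm_ge0 _)) -mulrA ler_wpM2l ?powR_ge0// enorm_dot_le.
Qed.

Section complex_extremal.
Variables (u : 'rV[R]_n -> R[i]) (g : 'rV[R]_n -> 'rV[R[i]]_n).
Hypotheses (W : W01p D p u g) (gn : LnormD D p%:E (enorm \o g) = 1%E)
  (uK : cLnormD D q%:E u = K).

(** The variation is taken in the direction of the conjugate of the test function, which turns its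
    Hermitian pairings into the bilinear ones of [weak_solution]. *)
Lemma extremal_euler_lagrange psi : test_function D psi ->
  \int[mu]_(x in D) (normC (u x) `^ (q - 2) * ReC (u x * psi x)) =
  k `^ q * ReC (cintegral D (flux g psi)).
Proof.
pose B psi := \int[mu]_(x in D) (normC (u x) `^ (q - 2) * ReC (u x * psi x)).
pose A psi := ReC (cintegral D (flux g psi)).
have le1 eta : test_function D eta -> B eta <= k `^ q * A eta.
  move=> te; have := extremal_variation_le p1 pn pq qpn mD Doo W gn uK (test_function_conj te).
  under eq_Rintegral do rewrite conjcK.
  congr (_ <= _ * _); apply: eq_Rintegral => x _.
  rewrite ReCM/= mul0r subr0; congr (_ * ReC _); apply: eq_bigr => i _.
  by rewrite !mxE (cpartial_conj i x te) conjcK.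
move=> tp; apply/eqP; rewrite eq_le le1//=.
have tN := test_functionZ (-1) tp.
have AN : A (fun x => (-1)%:C * psi x) = - A psi.
  rewrite /A (eq_cintegral (v := fun x => (-1)%:C * flux g psi x)).
    by rewrite cintegralZ ?ReCM/= ?mulN1r ?mul0r ?subr0//; exact: cintegrable_flux W tp.
  move=> x _; rewrite mulrCA; congr (_ * _); rewrite mulr_sumr.
  by apply: eq_bigr => i _; rewrite !mxE (cpartialZ _ i x tp) mulrCA.
have BN : B (fun x => (-1)%:C * psi x) = - B psi.
  have iu := integrable_normC_pairing p1 pn pq qpn mD Doo W uK (test_function_conj tp).
  have iB : mu.-integrable D (EFin \o (fun x => normC (u x) `^ (q - 2) * ReC (u x * psi x))).
    by apply: eq_integrable iu => // x _; rewrite /= conjcK.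
  rewrite -[RHS]mulN1r; refine (etrans _ (RintegralZl (-1) mD iB)); apply: eq_Rintegral => x _.
  rewrite [RHS]mulrCA; congr (_ * _); rewrite mulrCA [in LHS]ReCM.
  by rewrite [ImC _]/= mul0r subr0.
by have := le1 _ tN; rewrite AN BN mulrN lerN2.
Qed.

End complex_extremal.

Lemma cLnormD_real (w : 'rV[R]_n -> R) g (L : \bar R) : W01p D p (fun x => (w x)%:C) g ->
  LnormD D q%:E w = L -> cLnormD D q%:E (fun x => (w x)%:C) = L.
Proof.
move=> W <-; set u := fun x => _.
have mw : measurable_fun D w by case: W => -[[m _] _ _ _ _] _.
have mnu : measurable_fun D (normC \o u) by apply: measurable_normC; exact: cmeasurable_real.
have uE x : `|(normC \o u) x| = `|w x| by rewrite /comp normC_real normr_id.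
by apply/le_anti/andP; split; apply: (le_LnormD mD q0) => // x _; rewrite uE.
Qed.

Variables (w : 'rV[R]_n -> R) (g : 'rV[R]_n -> 'rV[R[i]]_n).
Let u x := (w x)%:C.
Hypotheses (W : W01p D p u g) (w0 : {ae mu, forall x, D x -> 0 <= w x})
  (gn : LnormD D p%:E (enorm \o g) = 1%E) (wK : LnormD D q%:E w = K).

Let V x := k `^ (- q) * w x `^ (q - p).

Let uK : cLnormD D q%:E u = K.
Proof. exact: cLnormD_real W wK. Qed.

Let k0 : 0 < k. Proof. exact: (extremal_constant_gt0 p1 pn pq qpn mD Doo W gn uK). Qed.

Let c0 : 0 <= k `^ (- q). Proof. exact: powR_ge0. Qed.

Let mw : measurable_fun D w.
Proof. by case: W => -[[m _] _ _ _ _] _. Qed.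

Let potential psi x : R[i] := (V x)%:C * (normC (u x) `^ (p - 2))%:C * u x * psi x.

Lemma powR_subD (a : R) : 0 <= a -> a `^ (q - p) * a `^ (p - 1) = a `^ (q - 1).
Proof.
have [->|an0] := eqVneq a 0.
  by rewrite !(@powR0 _ (_ - 1)) ?mulr0// gt_eqF// subr_gt0.
rewrite -powRD ?an0 ?implybT// => _; congr (_ `^ _); lra.
Qed.

(* [a `^ b] is [1] when [a < 0]. *)
Lemma powR_le_normD1 (a b : R) : a `^ b <= `|a| `^ b + 1.
Proof.
have [a0|a0] := leP 0 a; first by rewrite ger0_norm// lerDl.
by rewrite {1}/powR lt_eqF// ln0 ?(ltW a0)// mulr0 expR0 lerDr powR_ge0.
Qed.

Lemma potential_ge0E psi x : 0 <= w x ->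
  potential psi x = (k `^ (- q) * normC (u x) `^ (q - 2))%:C * (u x * psi x).
Proof.
move=> wx0; rewrite /potential /V /u normC_real (ger0_norm wx0) !mulrA; congr (_ * _).
rewrite -!rmorphM/=; congr (_%:C); rewrite -!mulrA; congr (_ * _).
by rewrite (powR_sub2M p1 wx0) (powR_sub2M q1 wx0) powR_subD.
Qed.

Lemma cintegrable_potential psi : test_function D psi -> cintegrable D (potential psi).
Proof.
move=> tp; have mpsi := cmeasurable_test tp mD.
have mpow (s : R) (f : 'rV[R]_n -> R) : measurable_fun D f -> measurable_fun D (fun x => f x `^ s).
  by move=> mf; exact: (measurableT_comp (measurable_powR _) mf).
have mu_ : cmeasurable D u by exact: cmeasurable_real.
have mnu := measurable_normC mu_.
have mnpsi := measurable_normC mpsi.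
have iq : mu.-integrable D (EFin \o (fun x => normC (u x) `^ (q - 1) * normC (psi x))).
  apply: (integrable_pm1 mD q1) => //; try by move=> x; exact: normC_ge0.
    by rewrite -/(cLnormD D q%:E u) uK (sobolev_constant_lty p1 pn pq qpn mD Doo).
  by case: (W1p_test mD Doo q1 tp).
have ip : mu.-integrable D (EFin \o (fun x => normC (u x) `^ (p - 1) * normC (psi x))).
  apply: (integrable_pm1 mD p1) => //; try by move=> x; exact: normC_ge0.
    by case: W => -[].
  by case: (W1p_test mD Doo p1 tp).
have ib : mu.-integrable D (EFin \o (fun x => k `^ (- q) *
    (normC (u x) `^ (q - 1) * normC (psi x) + normC (u x) `^ (p - 1) * normC (psi x)))).
  exact: (integrableZl mD _ (integrableD mD iq ip)).
apply: (cintegrable_le mD _ ib).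
  apply: cmeasurableM => //; apply: cmeasurableM => //; apply: cmeasurableM.
    by apply: cmeasurable_real; apply: measurable_funM; [exact: measurable_cst|exact: mpow].
  by apply: cmeasurable_real; exact: mpow.
move=> x _; rewrite /potential !ComplexField.Normc.normcM !normC_real.
rewrite -mulrDl mulrA ler_wpM2r ?normC_ge0//.
rewrite (ger0_norm (powR_ge0 _ _)) -[leLHS]mulrA (powR_sub2M p1 (normr_ge0 _)).
rewrite /V ger0_norm ?mulr_ge0 ?powR_ge0// -mulrA ler_wpM2l//.
rewrite -(powR_subD (normr_ge0 (w x))) -[X in _ <= _ + X]mul1r -mulrDl ler_wpM2r ?powR_ge0//.
exact: powR_le_normD1.
Qed.

Lemma ReC_integral_potential psi : test_function D psi ->
  ReC (cintegral D (flux g psi)) = ReC (cintegral D (potential psi)).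
Proof.
move=> tp; have [ip _] := cintegrable_potential tp.
have iu := integrable_normC_pairing p1 pn pq qpn mD Doo W uK (test_function_conj tp).
have iB : mu.-integrable D (EFin \o (fun x => normC (u x) `^ (q - 2) * ReC (u x * psi x))).
  by apply: eq_integrable iu => // x _; rewrite /= conjcK.
have kq : k `^ q * k `^ (- q) = 1.
  by rewrite -powRD ?(lt0r_neq0 k0) ?implybT// subrr powRr0.
have kqn : k `^ q != 0 by rewrite powR_eq0 (gt_eqF k0).
apply: (mulfI kqn); apply: etrans (esym (extremal_euler_lagrange W gn uK tp)) _.
suff -> : ReC (cintegral D (potential psi)) = k `^ (- q) *
    \int[mu]_(x in D) (normC (u x) `^ (q - 2) * ReC (u x * psi x)).
  by rewrite mulrA kq mul1r.
apply: etrans (RintegralZl (k `^ (- q)) mD iB); congr fine; apply: ae_eq_integral => //.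
- by case/integrableP: ip.
- by case/integrableP: (integrableZl mD (k `^ (- q)) iB).
apply: filterS w0 => x H Dx; rewrite /= (potential_ge0E _ (H Dx)) ReCM/= mul0r subr0.
by rewrite mulrA.
Qed.

Lemma extremal_weak_solution : weak_solution D p V u g.
Proof.
move=> psi tp; split; [exact: cintegrable_flux W tp|exact: cintegrable_potential|].
apply/eqP; rewrite eq_complex; apply/andP; split; apply/eqP; first exact: ReC_integral_potential.
have := ReC_integral_potential (test_function_mulNi tp).
(* The imaginary part of the equation for [psi] is its real part for [- 'i * psi]. *)
have ImE z : ReC (- 'i%C * z) = ImC z by rewrite ReCM/= oppr0 mul0r sub0r mulN1r opprK.
congr (_ = _); apply: eq_Rintegral => x _; rewrite -ImE; congr ReC.
- rewrite [in RHS]mulrCA; congr (_ * _); rewrite mulr_sumr; apply: eq_bigr => i _.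
  by rewrite !mxE (cpartial_mulNi i x tp) mulrCA.
- by rewrite /potential mulrCA.
Qed.

End euler_lagrange.

(** * The norm of the extremal potential *)

Section extremal_norm.
Context {R : realType} {n : nat}.
Variables (p q : R) (p1 : 1 < p) (pq : p <= q).
Variables (D : set 'rV[R]_n) (mD : measurable D).
Local Notation mu := (lebesgue_rV R n).

Let p0 : 0 < p. Proof. exact: lt_trans p1. Qed.
Let q0 : 0 < q. Proof. exact: lt_le_trans pq. Qed.

Lemma LnormDy_cst (c : R) : 0 <= c -> mu D != 0%E -> LnormD D +oo (fun=> c) = c%:E.
Proof.
move=> c0 D0.
have muT : (0 < mu [set: 'rV[R]_n])%E.
  apply: (@lt_le_trans _ _ (mu D)); first by rewrite lt0e D0 measure_ge0.
  by apply: le_measure; rewrite ?inE.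
apply/le_anti/andP; split.
  rewrite /LnormD unlock /= muT; apply/ess_supP; apply: nearW => x /=.
  by rewrite lee_fin patchE; case: ifP => _; rewrite ?normr0// ger0_norm.
(* A norm below [c] would contradict the almost everywhere bound at each point of [D], so [D] would
   be null. *)
rewrite leNgt; apply/negP => cL; move/eqP: D0; apply.
have : {ae mu, forall x, ~ D x}.
  apply: filterS (ae_le_LnormDy D (fun=> c)) => x + Dx => /(_ Dx).
  by rewrite (ger0_norm c0) leNgt cL.
move=> [N [mN N0 DN]]; apply/eqP; rewrite eq_le measure_ge0 andbT -N0.
by apply: le_measure; rewrite ?inE// => x Dx; apply: DN; apply.
Qed.

Lemma extremal_potential_norm (r : \bar R) (w : 'rV[R]_n -> R) (k : R) :
  conjugate_exponents p q r -> 0 < k -> mu D != 0%E -> measurable_fun D w ->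
  {ae mu, forall x, D x -> 0 <= w x} -> LnormD D q%:E w = k%:E ->
  (k%:E `^ p * LnormD D r ((fun x => k `^ (- q) * w x `^ (q - p))^\+)%R = 1)%E.
Proof.
move=> cpq k0 D0 mw w0 wk; have c0 : 0 <= k `^ (- q) by exact: powR_ge0.
have kn0 := lt0r_neq0 k0.
(* Powers are nonnegative even at negative arguments, so the potential equals its positive part
   everywhere. *)
rewrite (_ : (_^\+)%R = fun x => k `^ (- q) * w x `^ (q - p)); last first.
  by apply/funext => x; rewrite /funrpos (max_idPl _)// mulr_ge0 ?powR_ge0.
case: cpq => [[-> qp]|[s s0 [-> sE]]].
  rewrite (_ : (fun x => _) = fun=> k `^ (- q)); last first.
    by apply/funext => x; rewrite qp subrr powRr0 mulr1.
  rewrite (LnormDy_cst c0 D0) qp poweR_EFin -EFinM -powRD ?kn0 ?implybT//.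
  by rewrite subrr powRr0.
have qps : (q - p) * s = q.
  have : s^-1 = (q - p) / q.
    by rewrite mulrBl mulfV ?(lt0r_neq0 q0)// -sE addrK.
  move=> /(congr1 (fun z => s * z * q)).
  by rewrite mulfV ?(lt0r_neq0 s0)// mul1r -mulrA divfK ?(lt0r_neq0 q0)// mulrC.
rewrite (LnormDE D _ (lt0r_neq0 s0)).
have -> : (\int[mu]_(x in D) (`|k `^ (- q) * w x `^ (q - p)| `^ s)%:E =
    (k `^ (- q) `^ s)%:E * \int[mu]_(x in D) (`|w x| `^ q)%:E)%E.
  rewrite -ge0_integralZl ?lee_fin ?powR_ge0//; last exact: measurable_normr_powR.
  apply: ae_eq_integral => //.
  - apply: measurable_normr_powR; apply: measurable_funM; first exact: measurable_cst.
    exact: (measurableT_comp (measurable_powR _) mw).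
  - by apply: measurable_funeM; exact: measurable_normr_powR.
  apply: filterS w0 => x H Dx; rewrite -EFinM; congr EFin.
  by rewrite ger0_norm ?mulr_ge0 ?powR_ge0// powRM ?powR_ge0// -(powRrM (w x)) qps ger0_norm ?H.
rewrite -(poweR_LnormD D w (lt0r_neq0 q0)) wk !poweR_EFin -EFinM.
congr EFin; rewrite -powRrM -powRD ?kn0 ?implybT// -powRrM -powRD ?kn0 ?implybT//.
(* The exponents of [k] add up to [p + (q - q s)/s = p - q + q/s = 0]. *)
have qs : q / s = q - p by rewrite -[X in X / s]qps mulfK// (lt0r_neq0 s0).
by rewrite mulrDl mulfK ?(lt0r_neq0 s0)// qs addKr subrr powRr0.
Qed.

End extremal_norm.

Theorem theorem1p1 (R : realType) (n : nat) (D : set 'rV[R]_n)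
    (p q : R) (r : \bar R)
    (openD : open D) (boundedD : bounded_set D)
    (p_gt1 : 1 < p) (p_ltn : p < n%:R)
    (r_gt : ((n%:R / p)%:E < r)%E)
    (rpq : (r^-1 + (p / q)%:E = 1)%E) :
  (forall (V : 'rV[R]_n -> R) (u : 'rV[R]_n -> R[i])
      (gradu : 'rV[R]_n -> 'rV[R[i]]_n),
    LpD D r V -> W01p D p u gradu -> nontrivial D u ->
    weak_solution D p V u gradu ->
    (1 <= sobolev_constant D q p `^ p * LnormD D r (V^\+)%R)%E) /\
  (forall (ustar : 'rV[R]_n -> R) (gradustar : 'rV[R]_n -> 'rV[R[i]]_n),
    let u := fun x => (ustar x)%:C in
    W01p D p u gradustar ->
    {ae lebesgue_rV R n, forall x, D x -> 0 <= ustar x} ->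
    LnormD D p%:E (enorm \o gradustar) = 1%E ->
    LnormD D q%:E ustar = sobolev_constant D q p ->
    let cstar := fine (LnormD D q%:E ustar) `^ (- q) in
    let V := fun x => cstar * ustar x `^ (q - p) in
    weak_solution D p V u gradustar /\
    (sobolev_constant D q p `^ p * LnormD D r (V^\+)%R = 1)%E).
Proof.
have mD : measurable D by exact: measurable_open_rV.
have Doo := lebesgue_rV_bounded_lty mD boundedD.
have [cpq pq qpn] := conjugate_exponentsP p_gt1 p_ltn r_gt rpq.
split=> [V u g LV W ntu sol|w g u W w0 gn wK c V].
  exact: lower_bound_ineq W ntu sol.
have p0 : 0 < p by exact: lt_trans p_gt1.
have uK : cLnormD D q%:E u = sobolev_constant D q p by exact: cLnormD_real W wK.
have KE := extremal_constantE p_gt1 p_ltn pq qpn mD Doo uK.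
have k0 := extremal_constant_gt0 p_gt1 p_ltn pq qpn mD Doo W gn uK.
rewrite /V /c wK; split; first exact: extremal_weak_solution.
rewrite [X in (X `^ _ * _)%E]KE; apply: extremal_potential_norm => //.
(* Over a null set [D] the gradient would have norm [0] instead of [1]. *)
- apply/eqP => D0; move: gn; rewrite (LnormDE D _ (lt0r_neq0 p0)) null_set_integral//.
  + by rewrite poweR0r ?invr_neq0 ?(lt0r_neq0 p0)// => -[] /eqP; rewrite eq_sym oner_eq0.
  + by apply: measurable_normr_powR; apply: measurable_enorm; case: W => -[].
- by case: W => -[[m _] _ _ _ _] _.
- by rewrite wK.
Qed.
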